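(* Consider the censored single-index setting of the context, with a fixed trimming set $B$, $\tilde J(x)=\mathbf 1_{x\in B}$, and an estimator $\hat f$ of $f$. For a function $g$ of $(u;\theta)$ put $$M_n(\theta,g)=\int (y-g(\theta'x;\theta))^2\tilde J(x)\,d\hat F_{(X,Y)}(x,y),\qquad M_\infty(\theta,g)=M(\theta,g)=E\big[(Y-g(\theta'X;\theta))^2\tilde J(X)\big],$$ and let $\theta_n\in\arg\min_{\theta\in\Theta}M_n(\theta,\hat f)$. Assume: (1) $E[Y^2]<\infty$; (2) if $\theta_1\in\Theta$ and $M(\theta_1,f)=M(\theta_0,f)$ then $\theta_1=\theta_0$; (3) $\Theta$ and $\mathcal X=\mathrm{Supp}(X)$ are compact subsets of $\mathbb R^d$, $f(\theta'x;\theta)$ is continuous with respect to $x$ and $\theta$, and there are $\gamma>0$ and a bounded function $\Phi$ with $|f(\theta_1'x;\theta_1)-f(\theta_2'x;\theta_2)|\le\|\theta_1-\theta_2\|^\gamma\Phi(x)$ for all $\theta_1,\theta_2\in\Theta$, $x\in\mathcal X$; (4) $\|\hat f-f\|_\infty=o_P(1)$, where $\|g\|_\infty=\sup_{\theta\in\Theta,x\in\mathcal X}|g(\theta'x;\theta)|\mathbf 1_{f_{\theta'X}(\theta'x)>c/2}$. Then $$\sup_{\theta\in\Theta}\big|M_n(\theta,\hat f)-M_\infty(\theta,f)\big|=o_P(1),$$ and consequently $\theta_n\to\theta_0$ in probability.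
   Context: Model: $Y\in\mathbb R$, $X\in\mathbb R^d$, $\Theta\subset\mathbb R^d$, $\theta_0\in\Theta$ has first component $1$, $f(u;\theta)=E[Y\mid X'\theta=u]$, and $Y=f(\theta_0'X;\theta_0)+\varepsilon$ with $E[\varepsilon\mid X]=0$. For $\theta\in\Theta$, $\theta'X$ has a density $f_{\theta'X}$ on $\mathbb R$. Censoring: $C$ is a censoring variable, $T=Y\wedge C$, $\delta=\mathbf 1_{Y\le C}$; one observes i.i.d. copies $(T_i,\delta_i,X_i)_{1\le i\le n}$ of $(T,\delta,X)$. $F,G,H$ are the distribution functions of $Y,C,T$, and $F_{(X,Y)}(x,t)=\mathbb P(X\le x,Y\le t)$. Standing assumptions: $Y$ and $C$ are independent; $\mathbb P(Y\le C\mid X,Y)=\mathbb P(Y\le C\mid Y)$; $\inf\{t:F(t)=1\}=\inf\{t:H(t)=1\}$; $\mathbb P(Y=C)=0$. $\hat G$ is the Kaplan-Meier estimator of $G$: $1-\hat G(t)=\prod_{s\le t}\big(1-\#\{j:T_j=s,\delta_j=0\}/\#\{j:T_j\ge s\}\big)$, the product being over the distinct observed values $s$ of the $T_j$. Put $W_{in}=n^{-1}\delta_i/(1-\hat G(T_i-))$ (with $W_{in}=0$ if $\delta_i=0$); these are the jumps of the Kaplan-Meier estimator of $F$. Define $\hat F_{(X,Y)}(x,y)=\sum_{i=1}^nW_{in}\mathbf 1_{X_i\le x,\,T_i\le y}$, so $\int\phi\,d\hat F_{(X,Y)}=\sum_iW_{in}\phi(X_i,T_i)$. Trimming: $c>0$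 is a constant and $B\subset\mathbb R^d$ a known set such that $f_{\theta'X}(\theta'x)\ge c$ for all $x\in B$ and $\theta\in\Theta$. $\hat f(u;\theta)$ is a data-dependent estimator of $f(u;\theta)$.
   Formalization: Added assumption: if the common right endpoint t of F and H is finite and P(Y=t)>0, then P(T=t)>0. Without it the uniform convergence fails, e.g. Y with an atom at 1 and C uniform on [0,1], since the mass of Y at the endpoint is never observed uncensored. *)

(* Defs.v *)
From HB Require Import structures.
From mathcomp Require Import all_boot all_order all_algebra.
From mathcomp Require Import all_classical all_reals all_analysis.
Set Implicit Arguments.
Unset Strict Implicit.
Unset Printing Implicit Defensive.
Import Order.TTheory GRing.Theory Num.Theory.
Import numFieldNormedType.Exports.
Local Open Scope classical_set_scope.
Local Open Scope ring_scope.

(* Matrices over R, hence the row vectors that play the role of R^d, carry the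
   Borel sigma-algebra of their (product) topology. *)
Definition mx_borel_display : measure_display.
Proof. exact: default_measure_display. Qed.

Section mx_borel.
Context (R : realType) (m n : nat).

Let mx_borel : set (set 'M[R]_(m, n)) := <<s [set U | open U] >>.

Let mx_borel0 : mx_borel set0.
Proof. exact: sigma_algebra0. Qed.

Let mx_borelC A : mx_borel A -> mx_borel (~` A).
Proof. by move=> mA; rewrite -setTD; exact: sigma_algebraCD. Qed.

Let mx_borel_bigcup (F : (set 'M[R]_(m, n))^nat) :
  (forall i, mx_borel (F i)) -> mx_borel (\bigcup_i F i).
Proof. exact: sigma_algebra_bigcup. Qed.

HB.instance Definition _ := @isMeasurable.Build mx_borel_display 'M[R]_(m, n)
  mx_borel mx_borel0 mx_borelC mx_borel_bigcup.

End mx_borel.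

Section vectors.
Context (R : realType) (d : nat).

Definition dot (u v : 'rV[R]_d) : R := \sum_(i < d) u 0 i * v 0 i.

(* The norm `|u| of the library is the sup norm; this is the Euclidean one. *)
Definition enorm (u : 'rV[R]_d) : R := Num.sqrt (dot u u).

End vectors.

Section probability_notions.
Context (disp : measure_display) (Omega : measurableType disp) (R : realType)
  (P : probability Omega R).

Definition independent2 (U V : Omega -> R) : Prop :=
  forall A B : set R, measurable A -> measurable B ->
    P (U @^-1` A `&` V @^-1` B) = (P (U @^-1` A) * P (V @^-1` B))%E.

(* h is a regression function of V on Z: h(Z) is a version of E[V | Z]. *)
Definition is_cond_expect (disp' : measure_display) (S : measurableType disp')
    (Z : Omega -> S) (V : Omega -> R) (h : S -> R) : Prop :=
  [/\ P.-integrable setT (EFin \o V),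
      measurable_fun setT h,
      P.-integrable setT (EFin \o (h \o Z)) &
      forall A : set S, measurable A ->
        (\int[P]_(w in Z @^-1` A) (V w)%:E =
         \int[P]_(w in Z @^-1` A) (h (Z w))%:E)%E].

Definition is_density (V : Omega -> R) (g : R -> R) : Prop :=
  [/\ measurable_fun setT g,
      forall u, 0 <= g u &
      forall A : set R, measurable A ->
        P (V @^-1` A) = (\int[lebesgue_measure]_(u in A) (g u)%:E)%E].

(* inf {t : P(V <= t) = 1}, equal to +oo when there is no such t. *)
Definition right_endpoint (V : Omega -> R) : \bar R :=
  ereal_inf [set t%:E | t in [set t : R | P [set w | V w <= t] = 1%E]].

Definition rv_support (d : nat) (X : Omega -> 'rV[R]_d) : set 'rV[R]_d :=
  [set x | forall U, open U -> U x -> (0 < P (X @^-1` U))%E].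

Definition iid_copies (disp' : measure_display) (S : measurableType disp')
    (Z : nat -> Omega -> S) (Z0 : Omega -> S) : Prop :=
  [/\ forall i, measurable_fun setT (Z i),
      forall i (A : set S), measurable A -> P (Z i @^-1` A) = P (Z0 @^-1` A) &
      forall (J : seq nat) (A : nat -> set S), uniq J ->
        (forall i, measurable (A i)) ->
        P (\bigcap_(i in [set` J]) (Z i @^-1` A i)) =
        (\prod_(i <- J) P (Z i @^-1` A i))%E].

(* Z_n = o_P(1). The outer probability is used because suprema over uncountable
   sets, and selected minimisers, need not be measurable; it agrees with P on
   measurable events. *)
Definition oP1 (Z : nat -> Omega -> \bar R) : Prop :=
  forall e : R, 0 < e ->
    (mu_ext P [set w | (e%:E < `|Z n w|)%E] @[n --> \oo] --> 0%E).

End probability_notions.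

(* An observation is ((T, delta), X). *)
Notation obs R d := (R * bool * 'rV[R]_d)%type.

Section kaplan_meier.
Context (R : realType) (d n : nat).
Implicit Types (z : 'I_n -> obs R d).

Definition obs_time (o : obs R d) : R := o.1.1.
Definition obs_uncens (o : obs R d) : bool := o.1.2.
Definition obs_cov (o : obs R d) : 'rV[R]_d := o.2.

Definition km_cens z (t : R) : R :=
  1 - \prod_(s <- undup [seq obs_time (z j) | j : 'I_n] | s <= t)
        (1 - #|[pred j | (obs_time (z j) == s) && ~~ obs_uncens (z j)]|%:R
             / #|[pred j | s <= obs_time (z j)]|%:R).

Definition km_weight z (i : 'I_n) : R :=
  n%:R^-1 * (obs_uncens (z i))%:R
    / (1 - lim (km_cens z t @[t --> (obs_time (z i))^'-])).

(* Integral of phi against the purely atomic estimator of F_(X,Y). *)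
Definition km_integral z (phi : 'rV[R]_d -> R -> R) : R :=
  \sum_(i < n) km_weight z i * phi (obs_cov (z i)) (obs_time (z i)).

Definition crit_n z (B : set 'rV[R]_d) (theta : 'rV[R]_d)
    (g : R -> 'rV[R]_d -> R) : R :=
  km_integral z (fun x y => (y - g (dot theta x) theta) ^+ 2 * \1_B x).

End kaplan_meier.

Section single_index.
Context (disp : measure_display) (Omega : measurableType disp) (R : realType)
  (P : probability Omega R) (d : nat).

Definition crit_lim (X : Omega -> 'rV[R]_d) (Y : Omega -> R)
    (B : set 'rV[R]_d) (theta : 'rV[R]_d) (g : R -> 'rV[R]_d -> R) : \bar R :=
  'E_P[(fun w => (Y w - g (dot theta (X w)) theta) ^+ 2 * \1_B (X w))].

(* Sup of |g(theta'x; theta)| over the (theta, x) with dens theta (theta'x) > c/2. *)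
Definition trimmed_sup_norm (Theta Xset : set 'rV[R]_d)
    (dens : 'rV[R]_d -> R -> R) (c : R) (g : R -> 'rV[R]_d -> R) : \bar R :=
  ereal_sup [set (`|g (dot theta x) theta|
                  * (c / 2 < dens theta (dot theta x))%R%:R)%:E
            | theta in Theta & x in Xset].

End single_index.

(* Main.v *)
Require Import Defs.
From HB Require Import structures.
From mathcomp Require Import all_boot all_order all_algebra.
From mathcomp Require Import all_classical all_reals all_analysis.
From mathcomp Require Import measurable_realfun.
From mathcomp Require Import ring lra.
Import Order.TTheory GRing.Theory Num.Theory.
Import numFieldNormedType.Exports.

(* Write A = 1 / (1 - Ghat(t-)), a(t) = 1 / P(C >= t) and r(t) = #{j : T_j >= t}.

   Without ties between censored and uncensored times, A solves the Volterra
   equation r(t) A(t) + sum_{T_j < t} delta_j A(T_j) = n, while a solves its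
   population version.  By Gronwall's inequality, A - a is controlled on
   (-oo, t0], as long as P(T >= t0) > 0, by centred empirical means, whose second
   moments are O(1/n).  Hence the Kaplan-Meier integral of a bounded phi supported
   by {y <= t0} converges in probability to the integral of the inverse-weighted
   delta a(T) phi(X, T), that is, to E phi(X, Y).

   To reach phi of quadratic growth, one removes an observation: the sum of the
   n + 1 Kaplan-Meier integrals obtained by leaving one observation out is at most
   n + 1 times the full one, when phi >= 0.  By exchangeability, the mean of the
   Kaplan-Meier integral is nondecreasing in n, so it is at most its limit
   E phi(X, Y), first for truncated phi and then for all phi >= 0.  Markov's
   inequality makes the contribution of the tail of phi negligible.

   The Hoelder condition and a finite net of Theta make the convergence uniform,
   and fhat is replaced by f at the cost of (sup norm) * (Kaplan-Meier integral of
   1 + y^2).  Finally M(., f) is continuous on the compact set Theta, and theta0 is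
   its unique minimiser because the cross term of the square has mean zero. *)

Set Implicit Arguments.
Unset Strict Implicit.
Unset Printing Implicit Defensive.
Local Open Scope ring_scope.

(** * Kaplan-Meier weights *)

Section kaplan_meier_factor.
Context (R : realType) (I : finType) (T : I -> R) (delta : I -> bool).
Implicit Types (D : {set I}) (s t : R) (i j : I).

(** The obstacle is the right tail. Near the common endpoint of Y and T, P(C >= t) may tend to 0,
    nothing bounds 1 / (1 - Ghat) uniformly, and Y is only square integrable; so no deviation bound
    is sought there, only a bound on a mean. That bound needs no rate: the limit of the means is
    identified on truncated functions, for which weights of total mass at most 1 give bounded
    convergence. Values of Y where P(T >= Y) = 0 would never be observed; [endpoint] and
    [endpoint_atom] make them null. The hypothesis P(Y = C) = 0 concerns one individual, but as Y
    and C are independent it also excludes ties across individuals, with which the Volterra equation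
    is only an inequality. Counts are relative to a subset [D] of the sample, so that leaving an
    observation out stays inside one index set. As f is controlled on the support S of X only, the
    argument runs with [B] replaced by its intersection with S, which almost surely changes neither
    criterion. *)

Definition at_risk D s : nat := #|[pred j | (j \in D) && (s <= T j)]|.

Definition censored_at D s : nat :=
  #|[pred j | [&& j \in D, T j == s & ~~ delta j]]|.

Definition uncensored_at D s : nat :=
  #|[pred j | [&& j \in D, T j == s & delta j]]|.

(* 1 / (1 - Ghat(t-)) for the subsample D.  Once everybody at risk at some s < t is
   censored at s, the value is 0^-1 = 0 from there on. *)
Definition km_inv D t : R :=
  \prod_(s <- undup [seq T j | j : I] | s < t)
    (1 - (censored_at D s)%:R / (at_risk D s)%:R)^-1.

(** The risk counts and products are step functions of t, constant between consecutive observed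
    times; so induction goes from t back to the last observed time strictly before it, and starts
    where no time lies before t. *)
Lemma time_ind (Q : R -> Prop) :
  (forall t, (forall j, t <= T j) -> Q t) ->
  (forall i t, T i < t -> (forall j, T j < t -> T j <= T i) ->
    Q (T i) -> Q t) ->
  forall t, Q t.
Proof.
move=> Q0 QS t; have [m] := ubnP #|[pred j | T j < t]|.
elim: m t => // m IH t; rewrite ltnS => le_m.
have [j0 /= lt_j0|none] := pickP [pred j | T j < t]; last first.
  by apply: Q0 => j; rewrite leNgt; apply/negP => /[dup] lt; have := none j; rewrite /= lt.
case: (Order.TotalTheory.arg_maxP T (lt_j0 : [pred j | T j < t] j0)) => i /= lt_i max_i.
apply: (QS i) => //; apply: IH; apply: leq_trans le_m.
apply: proper_card; apply/properP; split.
  by apply/fintype.subsetP => j; rewrite !inE => /lt_trans; apply.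
by exists i; rewrite !inE ?ltxx.
Qed.

Lemma km_inv_first D t : (forall j, t <= T j) -> km_inv D t = 1.
Proof.
move=> le_t; rewrite /km_inv big_seq_cond big_pred0// => s.
rewrite mem_undup; apply/negbTE/negP => /andP[/mapP[j _ ->]].
by rewrite ltNge le_t.
Qed.

Lemma prod_times_next (F : R -> R) i t :
  T i < t -> (forall j, T j < t -> T j <= T i) ->
  \prod_(s <- undup [seq T j | j : I] | s < t) F s =
  \prod_(s <- undup [seq T j | j : I] | s < T i) F s * F (T i).
Proof.
move=> lt_i max_i.
have Ti : T i \in undup [seq T j | j : I] by rewrite mem_undup; apply: map_f; rewrite mem_enum.
rewrite big_mkcond (bigD1_seq (T i)) ?undup_uniq//= lt_i mulrC; congr (_ * _).
rewrite -big_mkcondr [RHS]big_seq_cond [LHS]big_seq_cond; apply: eq_bigl => s.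
have [/=|//] := boolP (s \in _); rewrite mem_undup => /mapP[j _ ->].
rewrite (lt_neqAle (T j) (T i)); case: eqVneq => //= ne.
by apply/idP/idP => [/max_i//|le]; exact: le_lt_trans lt_i.
Qed.

Lemma km_inv_next D i t :
  T i < t -> (forall j, T j < t -> T j <= T i) ->
  km_inv D t =
  km_inv D (T i) * (1 - (censored_at D (T i))%:R / (at_risk D (T i))%:R)^-1.
Proof. by move=> lt_i max_i; rewrite /km_inv (prod_times_next _ lt_i). Qed.

Lemma at_risk_next D i t :
  T i < t -> (forall j, T j < t -> T j <= T i) ->
  at_risk D (T i) =
  (censored_at D (T i) + uncensored_at D (T i) + at_risk D t)%N.
Proof.
move=> lt_i max_i; rewrite /at_risk /censored_at /uncensored_at -!sum1_card.
rewrite (bigID (fun j => T j == T i)) /=.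
rewrite [X in (X + _)%N](bigID (fun j => ~~ delta j)) /=.
congr (_ + _ + _)%N; apply: eq_bigl => j; rewrite /= !inE ?negbK -?andbA;
  case: (j \in D) => //=.
- by case: eqVneq => [->|]; rewrite ?lexx ?andbF.
- by case: eqVneq => [->|]; rewrite ?lexx ?andbF.
- apply/andP/idP => [[le ne]|le]; last first.
    by rewrite gt_eqF ?(lt_le_trans lt_i le) // ltW // (lt_le_trans lt_i le).
  by rewrite leNgt; apply/negP => /max_i le'; case/negP: ne; rewrite eq_le le' le.
Qed.

Lemma censored_le_at_risk D s : (censored_at D s <= at_risk D s)%N.
Proof.
apply: subset_leq_card; apply/fintype.subsetP => j; rewrite !inE.
by case/and3P=> -> /eqP-> _; rewrite lexx.
Qed.

Lemma km_factor_ge0 D s :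
  0 <= (1 - (censored_at D s)%:R / (at_risk D s)%:R : R).
Proof.
rewrite subr_ge0; have [->|ne0] := eqVneq (at_risk D s) 0%N.
  by rewrite invr0 mulr0.
by rewrite ler_pdivrMr ?mul1r ?ltr0n ?lt0n // ler_nat censored_le_at_risk.
Qed.

Lemma km_inv_ge0 D t : 0 <= km_inv D t.
Proof. by apply: prodr_ge0 => s _; rewrite invr_ge0 km_factor_ge0. Qed.

Lemma sum_next (V : nmodType) (F : I -> V) i t :
  T i < t -> (forall j, T j < t -> T j <= T i) ->
  \sum_(j | T j < t) F j =
  \sum_(j | T j < T i) F j + \sum_(j | T j == T i) F j.
Proof.
move=> lt_i max_i; rewrite (bigID (fun j => T j == T i)) /= addrC; congr (_ + _).
  apply: eq_bigl => j; rewrite (lt_neqAle (T j) (T i)) andbC; case: eqVneq => //= ne.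
  by apply/idP/idP => [/max_i//|le]; exact: le_lt_trans lt_i.
by apply: eq_bigl => j; case: eqVneq => [->|]; rewrite ?lt_i ?andbF.
Qed.

Lemma sum_uncensored_at (F : R -> R) t :
  \sum_(j | T j == t) (delta j)%:R * F (T j) =
  (uncensored_at [set: I]%SET t)%:R * F t.
Proof.
rewrite /uncensored_at -sum1_card natr_sum mulr_suml big_mkcond [RHS]big_mkcond /=.
apply: eq_bigr => j _; rewrite !inE /=; case: eqVneq => [->|] //=.
by case: delta; rewrite ?mul0r.
Qed.

Lemma km_factorE (c m : nat) : (0 < m)%N ->
  (1 - c%:R / (c + m)%:R : R)^-1 = (c + m)%:R / m%:R.
Proof.
move=> m0; have q : (c + m)%:R != 0 :> R by rewrite pnatr_eq0 addn_eq0 negb_and -!lt0n m0 orbT.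
rewrite -[X in X - _](divff q) -mulrBl invf_div; congr (_ / _).
by rewrite natrD addrC addKr.
Qed.

(** Let c, e and r count the items censored at a time, uncensored at it and at risk after it, and
    let K be the value of [km_inv] there. For e + r > 0, passing that time lowers the left-hand side
    by K c e / (e + r), so nothing is lost when c = 0 or e = 0. For e + r = 0 the new factor is 0
    and the loss is K c. *)
Lemma km_inv_mass_le t :
  (at_risk [set: I]%SET t)%:R * km_inv [set: I]%SET t +
    \sum_(j | T j < t) (delta j)%:R * km_inv [set: I]%SET (T j) <= #|I|%:R.
Proof.
elim/time_ind: t => [t le_t|i t lt_i max_i].
  rewrite km_inv_first// mulr1 big_pred0 ?addr0 => [|j]; last by rewrite ltNge le_t.
  by rewrite ler_nat max_card.
apply: le_trans; rewrite (sum_next _ lt_i max_i) addrCA addrC lerD2r.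
rewrite sum_uncensored_at.
rewrite (km_inv_next _ lt_i max_i) (at_risk_next _ lt_i max_i).
have := km_inv_ge0 [set: I]%SET (T i); set K := km_inv _ _.
set c := censored_at _ _; set e := uncensored_at _ _; set r := at_risk _ t => K0.
have [/eqP|ne0] := eqVneq (e + r)%N 0%N.
  by rewrite addn_eq0 => /andP[/eqP-> /eqP->]; rewrite !mul0r !addr0 mulr_ge0.
have p : 0 < (e + r)%:R :> R by rewrite ltr0n lt0n.
rewrite -addnA km_factorE ?lt0n// mulrCA (mulrC e%:R) -mulrDr [leRHS]mulrC.
rewrite ler_wpM2l// mulrA -lerBrDr ler_pdivrMr// !natrD.
have := ler0n R c; have := ler0n R e; have := ler0n R r; nra.
Qed.

(* The discrete Volterra equation of 1 / (1 - Ghat). *)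
Lemma km_inv_mass_eq t : (forall i j, T i = T j -> delta i = delta j) ->
  (0 < at_risk [set: I]%SET t)%N ->
  (at_risk [set: I]%SET t)%:R * km_inv [set: I]%SET t +
    \sum_(j | T j < t) (delta j)%:R * km_inv [set: I]%SET (T j) = #|I|%:R.
Proof.
move=> noties; elim/time_ind: t => [t le_t|i t lt_i max_i IH r_gt0].
  move=> _; rewrite km_inv_first// mulr1 big_pred0 ?addr0 => [|j]; last by rewrite ltNge le_t.
  by congr _%:R; apply: eq_card => j; rewrite !inE le_t.
rewrite (sum_next _ lt_i max_i) addrCA sum_uncensored_at.
have {IH} <- := IH _; last first.
  by apply/card_gt0P; exists i; rewrite !inE lexx.
rewrite [RHS]addrC; congr (_ + _).
rewrite (km_inv_next _ lt_i max_i) (at_risk_next _ lt_i max_i).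
set K := km_inv _ _.
have [c0|e0] : (censored_at [set: I]%SET (T i) = 0 \/ uncensored_at [set: I]%SET (T i) = 0)%N.
- have [|/card_gt0P[j]] := posnP (censored_at [set: I]%SET (T i)); first by left.
  rewrite !inE /= => /andP[/eqP Tj /negP dj]; right; apply: eq_card0 => k.
  by rewrite !inE /=; case: eqVneq => //= Tk; apply/negP; rewrite (noties k j) ?Tk ?Tj.
- by rewrite c0 !add0n mul0r subr0 invr1 mulr1 natrD mulrDl addrC.
- rewrite e0 addn0 mul0r addr0 km_factorE// mulrCA [RHS]mulrC; congr (_ * _).
  by rewrite mulrCA divff ?mulr1// pnatr_eq0 -lt0n.
Qed.

Lemma exists_gt_times : exists t, forall i, T i < t.
Proof.
exists (1 + \sum_i `|T i|) => i; rewrite (bigD1 i)//=.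
have : 0 <= \sum_(j | j != i) `|T j| by rewrite sumr_ge0.
have := ler_norm (T i); lra.
Qed.

Lemma sum_km_inv_le :
  \sum_j (delta j)%:R * km_inv [set: I]%SET (T j) <= #|I|%:R.
Proof.
have [t lt_t] := exists_gt_times.
apply: le_trans (km_inv_mass_le t); rewrite (eq_bigl (fun j => T j < t)).
  by rewrite ler_wpDl// mulr_ge0// km_inv_ge0.
by move=> j; rewrite lt_t.
Qed.

Lemma at_risk_remove j s :
  at_risk [set: I]%SET s = (at_risk [set~ j] s + (s <= T j)%R)%N.
Proof.
rewrite /at_risk (cardD1 j) /= addnC !inE /=; congr (_ + _)%N.
by apply: eq_card => k; rewrite !inE.
Qed.

Lemma censored_at_remove j s :
  censored_at [set: I]%SET s =
  (censored_at [set~ j] s + ((T j == s) && ~~ delta j))%N.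
Proof.
rewrite /censored_at (cardD1 j) /= addnC !inE /=; congr (_ + _)%N.
by apply: eq_card => k; rewrite !inE.
Qed.

(* The common value of km_inv [set~ j] t for all j still at risk at t. *)
Let km_inv_pred t : R :=
  \prod_(s <- undup [seq T j | j : I] | s < t)
    (1 - (censored_at [set: I]%SET s)%:R / ((at_risk [set: I]%SET s).-1)%:R)^-1.

(** An item j with T j >= t is at risk at every s < t and censored at none of them, so its removal
    lowers each risk count by one and leaves the censored counts alone. *)
Lemma km_inv_removeE j t : t <= T j -> km_inv [set~ j] t = km_inv_pred t.
Proof.
move=> le_t; apply: eq_bigr => s lt_s.
rewrite (at_risk_remove j) (censored_at_remove j) (gt_eqF (lt_le_trans lt_s le_t)).
by rewrite (ltW (lt_le_trans lt_s le_t)) addn1 addn0.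
Qed.

(* Leaving out a random observation does not increase the weight of i on average:
   this is what makes the mean Kaplan-Meier integral nondecreasing in n. *)
Lemma sum_km_inv_remove i :
  \sum_(j | j != i) km_inv [set~ j] (T i) <=
  #|I|.-1%:R * km_inv [set: I]%SET (T i).
Proof.
(* The sum over j is split at t: items gone before t keep their own terms, while the items at risk
   at t other than i, [(at_risk [set: I]%SET t).-1] in number, share the value [km_inv_pred t]. At t
   = T i this is the claim. *)
suff main t : t <= T i ->
    \sum_(j | T j < t) km_inv [set~ j] t
      + (at_risk [set: I]%SET t).-1%:R * km_inv_pred t
    <= #|I|.-1%:R * km_inv [set: I]%SET t.
  apply: le_trans (main _ (lexx _)); rewrite (bigID (fun j => T j < T i)) /=.
  apply: lerD.
    rewrite le_eqVlt (eq_bigl (fun j => T j < T i)) ?eqxx// => j.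
    by case: eqVneq => [->|]//=; rewrite ltxx.
  rewrite (eq_bigr (fun=> km_inv_pred (T i))) => [|j /andP[_]]; last first.
    by rewrite -leNgt => /km_inv_removeE.
  rewrite sumr_const -[leLHS]mulr_natl le_eqVlt; apply/orP; left; apply/eqP.
  congr (_%:R * _); rewrite /at_risk [in RHS](cardD1 i) !inE lexx /=.
  by apply: eq_card => j; rewrite !inE leNgt.
elim/time_ind: t => [t le_t _|k t lt_k max_k IH le_ti].
  rewrite big_pred0 ?add0r => [|j]; last by rewrite ltNge le_t.
  rewrite km_inv_first// mulr1 /km_inv_pred big_seq_cond big_pred0 ?mulr1.
    by rewrite ler_nat -!subn1 leq_sub2r// max_card.
  move=> s; rewrite mem_undup; apply/negbTE/negP => /andP[/mapP[j _ ->]].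
  by rewrite ltNge le_t.
have {}IH := IH (ltW (lt_le_trans lt_k le_ti)).
set s := T k in IH *; set c := censored_at [set: I]%SET s.
set e := uncensored_at [set: I]%SET s; set r := at_risk [set: I]%SET t.
have r_gt0 : (0 < r)%N by apply/card_gt0P; exists i; rewrite !inE.
have rE : at_risk [set: I]%SET s = (c + e + r)%N by exact: at_risk_next.
set A := km_inv_pred s.
have A_ge0 : 0 <= A by rewrite /A -(km_inv_removeE (lexx s)) km_inv_ge0.
rewrite (km_inv_next _ lt_k max_k) -/s -/c rE -addnA km_factorE ?addn_gt0 ?r_gt0 ?orbT//.
set G := (1 - c%:R / (at_risk [set: I]%SET s).-1%:R : R)^-1.
(* An equality if e + r > 1. If e + r = 1 the left factor is 0, whatever value [G] takes. *)
have G_le : (e + r).-1%:R * G <= (c + e + r).-1%:R.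
  have [->|er] := posnP (e + r).-1; first by rewrite mul0r.
  have q : (c + e + r).-1 = (c + (e + r).-1)%N.
    by rewrite -addnA -!subn1 addnBA// addn_gt0 r_gt0 orbT.
  by rewrite /G rE q km_factorE// mulrCA divff ?mulr1// pnatr_eq0 -lt0n.
have -> : km_inv_pred t = A * G by rewrite /km_inv_pred (prod_times_next _ lt_k).
rewrite (sum_next _ lt_k max_k) -/s.
have -> : \sum_(j | T j < s) km_inv [set~ j] t =
    ((c + e + r)%:R / (e + r)%:R) * \sum_(j | T j < s) km_inv [set~ j] s.
  rewrite mulr_sumr; apply: eq_bigr => j lt_j; rewrite (km_inv_next _ lt_k max_k) -/s mulrC.
  congr (_ * _); rewrite -addnA -km_factorE ?addn_gt0 ?r_gt0 ?orbT// addnA -rE /c.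
  by rewrite (at_risk_remove j) (censored_at_remove j) (lt_eqF lt_j) leNgt lt_j !addn0.
(* Leaving out a censored item lowers both counts at s, which gives the factor (c + e + r - 1) / (e
   + r); leaving out an uncensored one lowers only the risk count, which gives [G]. *)
have -> : \sum_(j | T j == s) km_inv [set~ j] t =
    c%:R * (A * ((c + e + r).-1%:R / (e + r)%:R)) + e%:R * (A * G).
  rewrite (bigID delta) /= addrC; congr (_ + _).
    transitivity (\sum_(j | (T j == s) && ~~ delta j) A * ((c + e + r).-1%:R / (e + r)%:R)).
      apply: eq_bigr => j /andP[/eqP Tj dj].
      rewrite (km_inv_next _ lt_k max_k) -/s km_inv_removeE ?Tj//; congr (_ * _).
      have cE : c = (censored_at [set~ j] s + 1)%N.
        by rewrite /c (censored_at_remove j) Tj eqxx dj.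
      have -> : at_risk [set~ j] s = (c + e + r).-1.
        by rewrite -rE (at_risk_remove j) Tj lexx addn1.
      have -> : (c + e + r).-1 = (censored_at [set~ j] s + (e + r))%N.
        by rewrite cE -addnA addn1 addSn.
      by rewrite km_factorE// addn_gt0 r_gt0 orbT.
    rewrite sumr_const -[LHS]mulr_natl; congr (_%:R * _); apply: eq_card => j.
    by rewrite !inE.
  transitivity (\sum_(j | (T j == s) && delta j) A * G).
    apply: eq_bigr => j /andP[/eqP Tj dj].
    rewrite (km_inv_next _ lt_k max_k) -/s km_inv_removeE ?Tj//; congr (_ * _).
    have := censored_at_remove j s; have := at_risk_remove j s.
    by rewrite /G /c Tj lexx eqxx dj /= addn0 addn1 => -> ->.
  rewrite sumr_const -[LHS]mulr_natl; congr (_%:R * _); apply: eq_card => j.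
  by rewrite !inE.
have p : 0 < (e + r)%:R :> R by rewrite ltr0n addn_gt0 r_gt0 orbT.
set X := \sum_(j | T j < s) _.
have {}IH : X + (c + e + r).-1%:R * A <= #|I|.-1%:R * km_inv [set: I]%SET s.
  by rewrite -rE.
apply: le_trans (_ : (c + e + r)%:R / (e + r)%:R * (X + (c + e + r).-1%:R * A) <= _); last first.
  by rewrite addnA mulrA [leLHS]mulrC ler_wpM2r// divr_ge0.
rewrite mulrDr -addrA lerD2l.
have er1 : (e + r).-1%:R = e%:R + r.-1%:R :> R.
  by rewrite -natrD -!subn1 addnBA.
rewrite er1 in G_le; move: G_le p; rewrite !natrD; set m := (c + e + r).-1%:R.
set c' := c%:R; set e' := e%:R; set r' := r%:R; set r1 := r.-1%:R => G_le p.
rewrite -addrA -mulrDl.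
(* [G_le] replaces (e + r - 1) G by m = c + e + r - 1, and c m / (e + r) + m is exactly m (c + e +
   r) / (e + r). *)
apply: le_trans (_ : c' * (A * (m / (e' + r'))) + A * m <= _).
  by rewrite lerD2l [leLHS]mulrCA ler_wpM2l//.
by rewrite le_eqVlt; apply/orP; left; apply/eqP; field; rewrite gt_eqF.
Qed.

(** Items that share a time are all bounded through the same past sum, so a time with p items
    multiplies the bound on that sum by 1 + p q, which Bernoulli's inequality bounds by (1 + q) ^ p.
    Ties thus cost nothing in the exponent. *)
Lemma discrete_gronwall (v x : I -> R) (q : R) : 0 <= q ->
  (forall i, 0 <= x i) ->
  (forall i, v i <= x i + q * \sum_(j | T j < T i) v j) ->
  \sum_i v i <= (\sum_i x i) * (1 + q) ^+ #|I|.
Proof.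
move=> q0 x0 hv.
suff main t : \sum_(j | T j < t) v j <=
    (\sum_(j | T j < t) x j) * (1 + q) ^+ #|[pred j | T j < t]|.
  have [t lt_t] := exists_gt_times; have := main t.
  by rewrite !(eq_bigl predT)// (eq_card (B := I)).
have q1 : 1 <= 1 + q by rewrite lerDl.
elim/time_ind: t => [t le_t|k t lt_k max_k IH].
  by rewrite !big_pred0 ?mul0r// => j; rewrite ltNge le_t.
rewrite !(sum_next _ lt_k max_k); set s := T k in IH *.
set V := \sum_(j | T j < s) v j in IH *; set X := \sum_(j | T j < s) x j in IH *.
set m := #|[pred j | T j < s]| in IH *.
have X0 : 0 <= X by rewrite sumr_ge0.
set X' := \sum_(j | T j == s) x j.
have X'0 : 0 <= X' by rewrite sumr_ge0.
set p := #|[pred j | T j == s]|.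
have -> : #|[pred j | T j < t]| = (m + p)%N.
  rewrite /m /p -!sum1_card; exact: (sum_next (fun=> 1%N)).
have B : 1 + p%:R * q <= (1 + q) ^+ p.
  elim: (p) => [|n IHn]; first by rewrite mul0r addr0 expr0.
  rewrite exprS; apply: le_trans (_ : (1 + q) * (1 + n%:R * q) <= _).
    by rewrite -natr1; have := ler0n R n; nra.
  by rewrite ler_wpM2l// (le_trans ler01).
have le1 : \sum_(j | T j == s) v j <= X' + p%:R * q * V.
  apply: le_trans (_ : \sum_(j | T j == s) (x j + q * V) <= _).
    by apply: ler_sum => j /eqP Tj; apply: le_trans (hv j) _; rewrite Tj.
  by rewrite big_split /= sumr_const -[X in _ + X <= _]mulr_natl mulrA.
apply: (le_trans (lerD IH le1)).
have m1 : 1 <= (1 + q) ^+ m by exact: exprn_ege1.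
have p1 : 1 <= (1 + q) ^+ p by exact: exprn_ege1.
rewrite exprD mulrDl; set M := (1 + q) ^+ m in IH m1 *; set P := (1 + q) ^+ p in B p1 *.
have : p%:R * q * V <= p%:R * q * (X * M) by rewrite ler_wpM2l// mulr_ge0.
have : X * M * (1 + p%:R * q) <= X * M * P by rewrite ler_wpM2l// mulr_ge0// (le_trans ler01).
have : X' * 1 <= X' * (M * P) by rewrite ler_wpM2l// mulr_ege1.
lra.
Qed.

End kaplan_meier_factor.

Local Open Scope classical_set_scope.
Local Open Scope ring_scope.

(** * Weights of a sample and of its leave-one-out subsamples *)

Section kaplan_meier_weights.
Context (R : realType).

(** Identifies the subsample without j with a sample of size n. The two products run over different
    lists of times, since that of j may disappear; its factor is then 1 because nobody else is
    censored there. *)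
Lemma km_inv_lift n (T : 'I_n.+1 -> R) (delta : 'I_n.+1 -> bool) j t :
  km_inv (T \o lift j) (delta \o lift j) [set: 'I_n]%SET t =
  km_inv T delta [set~ j] t.
Proof.
have card_lift (Q : pred 'I_n.+1) :
    #|[pred k : 'I_n | Q (lift j k)]| = #|[pred i | (i != j) && Q i]|.
  rewrite -(fintype.card_image (@lift_inj _ j)); apply: eq_card => i; rewrite !inE.
  apply/fintype.imageP/andP => [[k Qk ->]|[ne Qi]]; first by rewrite eq_sym neq_lift.
  by case: (unliftP j i) ne Qi => [k ->|->]; rewrite ?eqxx// => _ Qk; exists k.
have at_riskE s : at_risk (T \o lift j) [set: 'I_n]%SET s = at_risk T [set~ j] s.
  transitivity #|[pred k : 'I_n | s <= T (lift j k)]|.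
    by apply: eq_card => k; rewrite !inE.
  by rewrite (card_lift (fun i => s <= T i)); apply: eq_card => i; rewrite !inE.
have censE s : censored_at (T \o lift j) (delta \o lift j) [set: 'I_n]%SET s =
    censored_at T delta [set~ j] s.
  transitivity #|[pred k : 'I_n | (T (lift j k) == s) && ~~ delta (lift j k)]|.
    by apply: eq_card => k; rewrite !inE.
  rewrite (card_lift (fun i => (T i == s) && ~~ delta i)).
  by apply: eq_card => i; rewrite !inE.
rewrite /km_inv; under eq_bigr do rewrite at_riskE censE.
rewrite [RHS](bigID (fun s => s \in [seq T (lift j k) | k : 'I_n])) /=.
rewrite [X in _ = _ * X]big1_seq ?mulr1 => [|s /andP[/andP[_ nT] _]].
  rewrite -big_filter -[RHS]big_filter; apply: perm_big.
  apply: uniq_perm => [||s]; rewrite ?filter_uniq ?undup_uniq//.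
  rewrite !mem_filter !mem_undup.
  have : s \in [seq T (lift j k) | k : 'I_n] -> s \in [seq T i | i : 'I_n.+1].
    by case/mapP=> k _ ->; apply/mapP; exists (lift j k); rewrite ?mem_enum.
  by case: (s < t); case: (s \in _) => //= ->.
have -> : censored_at T delta [set~ j] s = 0%N; last by rewrite mul0r subr0 invr1.
apply: eq_card0 => i; rewrite !inE; apply/negP => /and3P[ne /eqP Ti _].
case/negP: nT; case: (unliftP j i) ne Ti => [k -> _ <-|->]; last by rewrite eqxx.
by apply/mapP; exists k; rewrite ?mem_enum.
Qed.

Context (d : nat).

(** For t between the last observed time before T_i and T_i itself, s <= t and s < T_i select the
    same observed times s. So [km_cens] is constant there, and its left limit is 1 minus the product
    that [km_inv] inverts. *)
Lemma km_weightE n (z : 'I_n -> obs R d) i :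
  km_weight z i = n%:R^-1 * ((obs_uncens (z i))%:R *
    km_inv (fun j => obs_time (z j)) (fun j => obs_uncens (z j))
      [set: 'I_n]%SET (obs_time (z i))).
Proof.
set T := fun j => obs_time (z j); set t0 := obs_time (z i).
have [a lt_a max_a] : exists2 a, a < t0 & forall j, T j < t0 -> T j <= a.
  have [j0 lt_j0|none] := pickP [pred j | T j < t0].
    case: (Order.TotalTheory.arg_maxP T (lt_j0 : [pred j | T j < t0] j0)) => j lt_j max_j.
    by exists (T j).
  by exists (t0 - 1) => [|j lt]; [lra | have := none j; rewrite /= lt].
rewrite /km_weight -mulrA; congr (_ * (_ * _)).
rewrite /km_inv prodfV; congr (_^-1).
set p := \prod_(s <- _ | _) _.
suff -> : lim (km_cens z t @[t --> t0^'-]) = 1 - p by rewrite opprB addrC subrK.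
apply: cvg_lim => //; apply: cvg_near_cst.
near=> t; rewrite /km_cens; congr (_ - _).
rewrite /p big_seq_cond [RHS]big_seq_cond; apply: eq_big => [s|s _].
  have [|//] := boolP (s \in _); rewrite mem_undup => /mapP[j _ ->] /=.
  apply/idP/idP => [le|/max_a le].
    by apply: le_lt_trans le _; near: t; exact: nbhs_left_lt.
  by apply: le_trans le _; apply: ltW; near: t; exact: nbhs_left_gt.
by congr (1 - _%:R / _%:R); apply: eq_card => j; rewrite !inE.
Unshelve. all: by end_near. Qed.

Lemma km_weight_ge0 n (z : 'I_n -> obs R d) i : 0 <= km_weight z i.
Proof. by rewrite km_weightE !mulr_ge0 ?km_inv_ge0 ?invr_ge0. Qed.

Lemma sum_km_weight_le1 n (z : 'I_n -> obs R d) : \sum_i km_weight z i <= 1.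
Proof.
under eq_bigr do rewrite km_weightE.
rewrite -mulr_sumr; have [n0|n0] := posnP n; first by rewrite [in n%:R]n0 invr0 mul0r.
rewrite mulrC ler_pdivrMr ?ltr0n// mul1r.
by rewrite (le_trans (sum_km_inv_le _ _))// card_ord.
Qed.

(** After an exchange of sums, i occurs in the n subsamples that leave out some j != i; their
    normalisation n^-1 cancels the factor [#|I|.-1] of [sum_km_inv_remove], applied to one i at a
    time. *)
Lemma sum_km_integral_lift n (z : 'I_n.+1 -> obs R d) (phi : 'rV[R]_d -> R -> R) :
  (forall x y, 0 <= phi x y) ->
  \sum_(j < n.+1) km_integral (fun k : 'I_n => z (lift j k)) phi <=
  n.+1%:R * km_integral z phi.
Proof.
move=> phi0; set T := fun j => obs_time (z j); set de := fun j => obs_uncens (z j).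
set F := fun i => phi (obs_cov (z i)) (obs_time (z i)).
have -> : \sum_(j < n.+1) km_integral (fun k : 'I_n => z (lift j k)) phi =
    \sum_i (de i)%:R * F i * (n%:R^-1 * \sum_(j | j != i) km_inv T de [set~ j] (T i)).
  transitivity (\sum_(j < n.+1) \sum_(i < n.+1 | i != j) n%:R^-1 * ((de i)%:R *
      km_inv T de [set~ j] (T i)) * F i).
    apply: eq_bigr => j _.
    rewrite (reindex_omap (lift j) (unlift j)) => [|i]; last first.
      by case: unliftP => [k ->|->]; rewrite ?eqxx ?andbF.
    rewrite [RHS](eq_bigl xpredT) => [|k]; last first.
      by rewrite liftK eqxx eq_sym neq_lift.
    by apply: eq_bigr => k _; rewrite km_weightE -km_inv_lift.
  rewrite (exchange_big_dep xpredT)//=; apply: eq_bigr => i _.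
  rewrite !mulr_sumr; apply: eq_big => [j|j _]; first by rewrite eq_sym.
  by rewrite -/(T i) -/(de i) /F; ring.
rewrite /km_integral mulr_sumr; apply: ler_sum => i _.
rewrite km_weightE -/(T i) -/(de i) -/(F i).
rewrite (_ : n.+1%:R * _ = (de i)%:R * F i * km_inv T de [set: 'I_n.+1]%SET (T i)).
  rewrite ler_wpM2l ?mulr_ge0 ?phi0//.
  have [n0|n_gt0] := posnP n; first by rewrite [in n%:R]n0 invr0 mul0r km_inv_ge0.
  rewrite mulrC ler_pdivrMr ?ltr0n// mulrC.
  by have := sum_km_inv_remove T de i; rewrite card_ord.
by rewrite !mulrA divff ?pnatr_eq0// mul1r mulrAC.
Qed.

End kaplan_meier_weights.

(** * Laws, independence and i.i.d. samples *)

Section law.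
Context (d1 d2 : measure_display) (Omega : measurableType d1)
  (S : measurableType d2) (R : realType) (mu : {measure set Omega -> \bar R})
  (U : Omega -> S) (mU : measurable_fun setT U).

(** The vacuous [let] makes the term depend on the proof of measurability, so that the measure
    instance can be inferred from the term alone. *)
Definition law_of := let _ := mU in pushforward mu U.

Let law0 : law_of set0 = 0%E.
Proof. by rewrite /law_of /pushforward preimage_set0 measure0. Qed.

Let law_ge0 A : (0 <= law_of A)%E. Proof. exact: measure_ge0. Qed.

Let law_sigma_additive : semi_sigma_additive law_of.
Proof. exact: (@measure_semi_sigma_additive _ _ _ (measure_function_pushforward__canonical__measure_function_Measure mu mU)). Qed.

HB.instance Definition _ := isMeasure.Build _ _ _ law_of law0 law_ge0
  law_sigma_additive.

Lemma integral_law (g : S -> \bar R) :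
  measurable_fun setT g -> (forall x, (0 <= g x)%E) ->
  (\int[law_of]_x g x = \int[mu]_w g (U w))%E.
Proof. by move=> mg g0; rewrite ge0_integral_pushforward//. Qed.

End law.

Section law_probability.
Context (d1 d2 : measure_display) (Omega : measurableType d1)
  (S : measurableType d2) (R : realType) (P : probability Omega R)
  (U : Omega -> S) (mU : measurable_fun setT U).

Let law_setT : law_of P mU setT = 1%E.
Proof. by rewrite /law_of /pushforward preimage_setT; exact: probability_setT. Qed.

HB.instance Definition _ :=
  Measure_isProbability.Build _ _ _ (law_of P mU) law_setT.

End law_probability.

Section independence.
Context (d0 d1 d2 : measure_display) (Omega : measurableType d0)
  (S1 : measurableType d1) (S2 : measurableType d2) (R : realType)
  (P : probability Omega R) (U : Omega -> S1) (V : Omega -> S2)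
  (mU : measurable_fun setT U) (mV : measurable_fun setT V)
  (UV : forall A B, measurable A -> measurable B ->
    P (U @^-1` A `&` V @^-1` B) = (P (U @^-1` A) * P (V @^-1` B))%E).

(** The joint law agrees with the product law on rectangles, hence everywhere, and Tonelli's theorem
    applies. Freezing the first variable in the inner integral does the work of conditioning on
    it. *)
Lemma integral_indep (g : S1 * S2 -> \bar R) :
  measurable_fun setT g -> (forall x, (0 <= g x)%E) ->
  (\int[P]_w g (U w, V w) = \int[P]_w \int[P]_w' g (U w, V w'))%E.
Proof.
move=> mg g0; have mUV : measurable_fun setT (fun w => (U w, V w)).
  exact: measurable_fun_pair.
rewrite -(integral_law P mUV)//.
rewrite (eq_measure_integral (law_of P mU \x law_of P mV)%E); last first.
  by move=> A mA _; apply/esym; apply: product_measure_unique => // B C mB mC; exact: UV.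
rewrite fubini_tonelli1//.
rewrite integral_law; last 2 first.
- exact: measurable_fun_fubini_tonelli_F.
- by move=> x; exact: integral_ge0.
apply: eq_integral => w _; rewrite /fubini_F integral_law//.
exact: measurable_fun_pair2.
Qed.

End independence.

Section conditioning.
Import HBNNSimple.
Context (d1 d2 : measure_display) (Omega : measurableType d1)
  (S : measurableType d2) (R : realType) (P : probability Omega R)
  (Z : Omega -> S) (mZ : measurable_fun setT Z).

(** The hypothesis says that V1 and V2 have the same conditional expectation given Z, without
    forming it; it passes from indicators to g by simple functions and monotone convergence. It
    serves to replace the indicator of no censoring by its conditional probability, and the positive
    part of a centred error by the negative part. *)
Lemma integral_weight_eq (V1 V2 : Omega -> R) (g : S -> R) :
  measurable_fun setT V1 -> measurable_fun setT V2 ->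
  (forall w, 0 <= V1 w) -> (forall w, 0 <= V2 w) ->
  (forall A, measurable A -> \int[P]_(w in Z @^-1` A) (V1 w)%:E =
    \int[P]_(w in Z @^-1` A) (V2 w)%:E)%E ->
  measurable_fun setT g -> (forall x, 0 <= g x) ->
  (\int[P]_w (V1 w * g (Z w))%:E = \int[P]_w (V2 w * g (Z w))%:E)%E.
Proof.
move=> mV1 mV2 V10 V20 V12 mg g0.
have mEg : measurable_fun setT (EFin \o g) by exact/measurable_EFinP.
pose f := nnsfun_approx measurableT mEg.
have cvf w : (fun n => (f n (Z w))%:E) @ \oo --> (g (Z w))%:E.
  by apply: cvg_nnsfun_approx => // x _; rewrite lee_fin.
have mfZ n : measurable_fun setT (f n \o Z) by exact: measurableT_comp.
have mono (V : Omega -> R) : measurable_fun setT V -> (forall w, 0 <= V w) ->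
    (\int[P]_w (V w * g (Z w))%:E = limn (fun n => \int[P]_w (V w * f n (Z w))%:E))%E.
  move=> mV V0; rewrite -monotone_convergence//=.
  - apply: eq_integral => w _; apply/esym/cvg_lim => //.
    under eq_fun do rewrite EFinM.
    by rewrite EFinM; apply: cvgeZl.
  - by move=> n; apply/measurable_EFinP; apply: measurable_funM => //; exact: mfZ.
  - by move=> n w _; rewrite lee_fin mulr_ge0.
  - move=> w _ a b ab; rewrite lee_fin ler_wpM2l//.
    exact/lefP/nd_nnsfun_approx.
rewrite !mono//; congr (limn _); apply/funext => n.
have simple (V : Omega -> R) : measurable_fun setT V -> (forall w, 0 <= V w) ->
    (\int[P]_w (V w * f n (Z w))%:E =
     \sum_(k \in range (f n)) (k%:E * \int[P]_(w in Z @^-1` (f n @^-1` [set k])) (V w)%:E))%E.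
  move=> mV V0.
  have mI k : measurable_fun setT (fun w => \1_(f n @^-1` [set k]) (Z w) : R).
    by apply: measurableT_comp => //.
  transitivity (\int[P]_w (\sum_(k \in range (f n)) (k%:E * ((V w)%:E * (\1_(f n @^-1` [set k]) (Z w))%:E)))%E)%E.
    apply: eq_integral => w _; rewrite fimfunE EFinM -fsumEFin// ge0_mule_fsumr.
      by apply: eq_fsbigr => k _; rewrite EFinM muleCA.
    by move=> k; rewrite EFinM nnfun_muleindic_ge0.
  rewrite ge0_integral_fsum//; last 2 first.
  - move=> k; apply: measurable_funeM; apply: emeasurable_funM; exact/measurable_EFinP.
  - move=> k w _; rewrite muleCA mule_ge0 ?lee_fin//; exact: (nnfun_muleindic_ge0 (f n) k (Z w)).
  apply: eq_fsbigr => k; rewrite inE => -[x _ <-].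
  rewrite ge0_integralZl//.
  - congr (_ * _)%E; rewrite [RHS]integral_mkcond; apply: eq_integral => w _.
    rewrite patchE indicE; case: ifPn => h.
      by rewrite (_ : Z w \in _) ?mule1//; move: h; rewrite !inE.
    by rewrite (_ : Z w \in _ = false) ?mule0//; apply/negbTE; move: h; apply: contra; rewrite !inE.
  - apply: emeasurable_funM; exact/measurable_EFinP.
  - by move=> w _; rewrite mule_ge0 ?lee_fin.
  - by rewrite lee_fin.
by rewrite !simple//; apply: eq_fsbigr => k _; rewrite V12.
Qed.

End conditioning.

Section bounded_functions.
Context (d1 : measure_display) (Omega : measurableType d1) (R : realType)
  (P : probability Omega R).

Lemma bounded_integrable (f : Omega -> R) (K : R) : measurable_fun setT f ->
  (forall w, `|f w| <= K) -> P.-integrable setT (EFin \o f).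
Proof.
move=> mf fK; apply: measurable_bounded_integrable => //.
  by rewrite (@le_lt_trans _ _ 1%E) ?probability_le1// ltry.
exists K; split; first exact: num_real.
by move=> M KM w _; apply: le_trans (fK w) (ltW KM).
Qed.

Lemma integral_prob_cst (K : R) : (\int[P]_w K%:E = K%:E)%E.
Proof.
rewrite integral_cst// -[RHS]mule1; congr (_ * _)%E; exact: probability_setT.
Qed.

End bounded_functions.

(** * Exchangeability and second moments of i.i.d. samples *)

Section iid.
Context (d0 d1 : measure_display) (Omega : measurableType d0)
  (S : measurableType d1) (R : realType) (P : probability Omega R)
  (Z : nat -> Omega -> S) (Z0 : Omega -> S) (iidZ : iid_copies P Z Z0).

Let mZ i : measurable_fun setT (Z i). Proof. by have [] := iidZ. Qed.

Let cylinder n : set (set (n.-tuple S)) :=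
  [set B | exists A : 'I_n -> set S, (forall k, measurable (A k)) /\
     B = [set t | forall k, A k (tnth t k)]].

Let cylinder_measurable n : @cylinder n `<=` measurable.
Proof.
move=> _ [A [mA ->]].
rewrite (_ : mkset _ = \bigcap_(k in [set: 'I_n]) ((@tnth n S ^~ k) @^-1` A k)).
  apply: fin_bigcap_measurable => // k _.
  by rewrite -[X in measurable X]setTI; exact: measurable_tnth.
by apply/seteqP; split=> t /= h k; [move=> _; exact: h | exact: h].
Qed.

Let cylinder_generates n : (measurable : set (set (n.-tuple S))) = <<s @cylinder n >>.
Proof.
apply/seteqP; split; last first.
  apply: smallest_sub; last exact: cylinder_measurable.
  exact: sigma_algebra_measurable.
apply: smallest_sub; first exact: smallest_sigma_algebra.
move=> B; rewrite -bigcup_seq => -[i _ [A mA <-]]; apply: sub_sigma_algebra.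
exists (fun k => if k == i then A else setT); split.
  by move=> k; case: ifP.
rewrite setTI; apply/seteqP; split=> [t At k|t /(_ i)]; last by rewrite eqxx.
by case: eqP => // ->.
Qed.

Lemma tuple_measure_unique n (m1 m2 : {measure set (n.-tuple S) -> \bar R}) :
  (m1 setT < +oo)%E ->
  (forall A : 'I_n -> set S, (forall k, measurable (A k)) ->
    m1 [set t | forall k, A k (tnth t k)] =
    m2 [set t | forall k, A k (tnth t k)]) ->
  forall B, measurable B -> m1 B = m2 B.
Proof.
move=> m1T m12 B mB; apply: (measure_unique (@cylinder n) (fun=> setT)) => //.
- exact: cylinder_generates.
- move=> _ _ [A [mA ->]] [A' [mA' ->]]; exists (fun k => A k `&` A' k); split.
    by move=> k; exact: measurableI.
  apply/seteqP; split=> t /=; first by move=> [h h'] k; split.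
  by move=> h; split=> k; have [] := h k.
- by move=> _; exists (fun=> setT); split=> //; apply/seteqP; split.
- by rewrite bigcup_const.
- by move=> _ [A [mA ->]]; exact: m12.
Qed.

Definition subsample n (s : n.-tuple nat) (w : Omega) : n.-tuple S :=
  [tuple Z (tnth s k) w | k < n].

Lemma measurable_subsample n (s : n.-tuple nat) :
  measurable_fun setT (subsample s).
Proof.
apply/measurable_fun_tnthP => k.
by rewrite (_ : _ \o _ = Z (tnth s k))//; apply/funext => w /=; rewrite tnth_mktuple.
Qed.

(** [iid_copies] wants sets indexed by positions in the sequence: [A k] is put at the position
    [tnth s k], and the full set at positions outside [s]. *)
Let cylinder_ext n (s : n.-tuple nat) (A : 'I_n -> set S) (m : nat) : set S :=
  if insub (index m s) is Some k then A k else setT.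

Let cylinder_extE n (s : n.-tuple nat) (A : 'I_n -> set S) k : uniq s ->
  cylinder_ext s A (tnth s k) = A k.
Proof.
move=> us; rewrite /cylinder_ext (tnth_nth 0%N) index_uniq ?size_tuple//.
by rewrite insubT// => lt; congr A; exact: val_inj.
Qed.

Let subsample_cylinder n (s : n.-tuple nat) (A : 'I_n -> set S) : uniq s ->
  subsample s @^-1` [set t | forall k, A k (tnth t k)] =
  \bigcap_(i in [set` tval s]) (Z i @^-1` cylinder_ext s A i).
Proof.
move=> us; apply/seteqP; split=> w /=.
  move=> h i /= /tnthP[k ->]; have := h k.
  by rewrite cylinder_extE// tnth_mktuple.
by move=> h k; rewrite tnth_mktuple -(cylinder_extE A k us); apply: h; rewrite /= mem_tnth.
Qed.

Let measurable_cylinder_ext n (s : n.-tuple nat) (A : 'I_n -> set S) i :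
  (forall k, measurable (A k)) -> measurable (cylinder_ext s A i).
Proof. by rewrite /cylinder_ext; case: insub. Qed.

Let law_cylinder n (s : n.-tuple nat) (A : 'I_n -> set S) : uniq s ->
  (forall k, measurable (A k)) ->
  P (subsample s @^-1` [set t | forall k, A k (tnth t k)]) =
  (\prod_(k < n) P (Z0 @^-1` A k))%E.
Proof.
move=> us mA; rewrite subsample_cylinder//; have [_ idZ indZ] := iidZ.
rewrite indZ//; last by move=> i; exact: measurable_cylinder_ext.
rewrite big_tuple; apply: eq_bigr => k _.
by rewrite idZ; [rewrite cylinder_extE | exact: measurable_cylinder_ext].
Qed.

(** Independence and equality of laws give a cylinder the same product of probabilities under both
    subsamples; this is the exchangeability behind the leave-one-out argument. *)
Lemma integral_subsample n (s1 s2 : n.-tuple nat) (g : n.-tuple S -> \bar R) :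
  uniq s1 -> uniq s2 -> measurable_fun setT g -> (forall t, 0 <= g t)%E ->
  (\int[P]_w g (subsample s1 w) = \int[P]_w g (subsample s2 w))%E.
Proof.
move=> u1 u2 mg g0.
rewrite -(integral_law P (measurable_subsample s1))//.
rewrite -(integral_law P (measurable_subsample s2))//.
apply: eq_measure_integral => A mA _; apply: tuple_measure_unique => //.
  by rewrite (@le_lt_trans _ _ 1%E) ?probability_le1// ltry.
by move=> {mA}A' mA'; exact: etrans (law_cylinder u1 mA') (esym (law_cylinder u2 mA')).
Qed.

Lemma integral_iid (i j : nat) (g : S -> \bar R) :
  measurable_fun setT g -> (forall x, 0 <= g x)%E ->
  (\int[P]_w g (Z i w) = \int[P]_w g (Z j w))%E.
Proof.
move=> mg g0; rewrite -(integral_law P (mZ i))// -(integral_law P (mZ j))//.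
apply: eq_measure_integral => A mA _; have [_ idZ _] := iidZ.
exact: etrans (idZ i A mA) (esym (idZ j A mA)).
Qed.

Lemma subsample_indep n (s : n.-tuple nat) k : uniq s -> k \notin (s : seq nat) ->
  forall A B, measurable A -> measurable B ->
  P (subsample s @^-1` A `&` Z k @^-1` B) =
  (P (subsample s @^-1` A) * P (Z k @^-1` B))%E.
Proof.
move=> us ks A B mA mB; have [_ idZ indZ] := iidZ.
have mZB : measurable (Z k @^-1` B).
  by rewrite -[X in measurable X]setTI; exact: mZ.
have PZB0 : 0 <= fine (P (Z k @^-1` B)) by rewrite fine_ge0.
have PZBfin : P (Z k @^-1` B) \is a fin_num by exact: fin_num_measure.
(* For B fixed, both sides are finite measures of A, so it is enough to compare them on cylinders,
   where the product formula of [iid_copies] for the indices k :: s applies. *)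
pose m1 := law_of (mrestr P mZB) (measurable_subsample s).
pose m2 := mscale (NngNum PZB0) (law_of P (measurable_subsample s)).
suff : m1 A = m2 A.
  by rewrite /m1 /m2 /law_of /mscale /pushforward /mrestr /= muleC fineK.
apply: tuple_measure_unique mA.
  apply: (@le_lt_trans _ _ 1%E); last by rewrite ltry.
  change (P (subsample s @^-1` setT `&` Z k @^-1` B) <= 1)%E.
  by apply: probability_le1; rewrite preimage_setT setTI.
move=> A' mA'; pose D := [set t : n.-tuple S | forall j, A' j (tnth t j)].
change (P (subsample s @^-1` D `&` Z k @^-1` B) =
  (fine (P (Z k @^-1` B)))%:E * P (subsample s @^-1` D))%E.
rewrite muleC fineK// {}/D.
rewrite subsample_cylinder// indZ//; last by move=> i; exact: measurable_cylinder_ext.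
pose A'' m := if m == k then B else cylinder_ext s A' m.
have -> : \bigcap_(i in [set` tval s]) (Z i @^-1` cylinder_ext s A' i) `&` Z k @^-1` B =
    \bigcap_(i in [set` k :: tval s]) (Z i @^-1` A'' i).
  apply/seteqP; split=> w /=.
    move=> [h1 h2] i; rewrite /= in_cons /A''; case: eqP => [->//|_ /=]; exact: h1.
  move=> h; split; last by have := h k; rewrite /A'' /= in_cons !eqxx; exact.
  move=> i /= si; have := h i; rewrite /A'' /= in_cons si orbT.
  by case: eqP => [ik|_]; [move: ks; rewrite -ik si | exact].
rewrite indZ /= ?ks//; last first.
  by move=> i; rewrite /A''; case: eqP => // _; exact: measurable_cylinder_ext.
rewrite big_cons muleC; congr (_ * _)%E; last by rewrite /A'' eqxx.
apply: eq_big_seq => i si; rewrite /A''; case: eqP => // ik.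
by move: ks; rewrite -ik si.
Qed.

(** Of the n^2 products in the expanded square, those with i, j, k distinct have mean zero: once Z_i
    and Z_j are frozen, only the centred factor in Z_k is random. At most 3 n pairs are left, with j
    = i, k = i or k = j, and each contributes at most K^2. *)
Lemma second_moment_le (zeta : S * S -> R) (K : R) (i n : nat) :
  measurable_fun setT zeta -> (forall x, `|zeta x| <= K) ->
  (forall s k, \int[P]_w zeta (s, Z k w) = 0) ->
  (\int[P]_w ((\sum_(j < n) zeta (Z i w, Z j w)) ^+ 2)%:E <=
   (3 * n%:R * K ^+ 2)%:E)%E.
Proof.
move=> mz zK z0; have K0 : 0 <= K by exact: le_trans (zK point).
have mzij j k : measurable_fun setT (fun w => zeta (Z j w, Z k w)).
  exact: (measurableT_comp mz (measurable_fun_pair (mZ j) (mZ k))).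
have mt j k : measurable_fun setT (fun w => zeta (Z i w, Z j w) * zeta (Z i w, Z k w)).
  exact: measurable_funM.
have tK j k w : `|zeta (Z i w, Z j w) * zeta (Z i w, Z k w)| <= K ^+ 2.
  by rewrite normrM expr2 ler_pM.
have int j k : P.-integrable setT (fun w => (zeta (Z i w, Z j w) * zeta (Z i w, Z k w))%:E).
  exact: (bounded_integrable P (mt j k) (tK j k)).
pose dist j k := [&& j != i, k != i & k != j].
have zero j k : dist j k ->
    (\int[P]_w (zeta (Z i w, Z j w) * zeta (Z i w, Z k w))%:E = 0)%E.
  case/and3P=> ji ki kj.
  pose s := [tuple i; j].
  have us : uniq s by rewrite /= inE eq_sym ji.
  have ks : k \notin (s : seq nat) by rewrite !inE negb_or ki.
  (* Adding K^2 makes the integrand nonnegative, as [integral_indep] requires; it is subtracted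
     again at the end. *)
  pose g (x : 2.-tuple S * S) := zeta (tnth x.1 ord0, tnth x.1 (lift ord0 ord0)) *
    zeta (tnth x.1 ord0, x.2) + K ^+ 2.
  have mf1 (l : 'I_2) : measurable_fun setT (fun x : 2.-tuple S * S => tnth x.1 l).
    exact: (measurableT_comp (measurable_tnth l) measurable_fst).
  have mg : measurable_fun setT g.
    apply: measurable_funD => //; apply: measurable_funM.
      exact: (measurableT_comp mz (measurable_fun_pair (mf1 _) (mf1 _))).
    exact: (measurableT_comp mz (measurable_fun_pair (mf1 _) measurable_snd)).
  have g0 x : 0 <= g x.
    rewrite /g -lerBlDr sub0r lerNl; apply: le_trans (ler_norm _) _.
    by rewrite normrN normrM expr2 ler_pM.
  have inner w : (\int[P]_w' (g (subsample s w, Z k w'))%:E = (K ^+ 2)%:E)%E.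
    rewrite /g /=; under eq_integral do rewrite EFinD EFinM.
    set a := tnth _ _; set b := tnth _ _.
    have iz : P.-integrable setT (fun w' => (zeta (a, Z k w'))%:E).
      apply: (bounded_integrable P) (fun w' => zK (a, Z k w')).
      exact: (measurableT_comp mz (measurable_fun_pair (measurable_cst a) (mZ k))).
    rewrite integralD//=; last 2 first.
    - exact: integrableZl.
    - by apply: (bounded_integrable P (f := fun=> K ^+ 2) (K := K ^+ 2)) => // ?; rewrite ger0_norm ?sqr_ge0.
    rewrite integralZl//.
    have -> : (\int[P]_w' (zeta (a, Z k w'))%:E = 0)%E.
      by rewrite -[LHS]fineK ?integrable_fin_num//; congr EFin; exact: z0.
    rewrite mule0 add0e integral_cst//.
    by rewrite -[RHS]mule1; congr (_ * _)%E; exact: probability_setT.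
  have mEg : measurable_fun setT (EFin \o g) by exact/measurable_EFinP.
  have : (\int[P]_w (zeta (Z i w, Z j w) * zeta (Z i w, Z k w) + K ^+ 2)%:E = (K ^+ 2)%:E)%E.
    transitivity (\int[P]_w (EFin \o g) (subsample s w, Z k w))%E.
      apply: eq_integral => w _; rewrite /g /= !tnth_mktuple.
      by rewrite /s !(tnth_nth 0%N).
    rewrite (integral_indep (measurable_subsample s) (mZ k) (subsample_indep us ks) mEg); last first.
      by move=> x; rewrite lee_fin.
    rewrite (eq_integral (fun=> (K ^+ 2)%:E)) => [|w _]; last exact: inner.
    by rewrite integral_prob_cst.
  under eq_integral do rewrite EFinD.
  rewrite integralD//; last first.
    by apply: (bounded_integrable P (f := fun=> K ^+ 2) (K := K ^+ 2)) => // ?; rewrite ger0_norm ?sqr_ge0.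
  rewrite integral_prob_cst => /(congr1 (fun z => z - (K ^+ 2)%:E)%E).
  by rewrite addeK// subee.
have expand w : ((\sum_(j < n) zeta (Z i w, Z j w)) ^+ 2)%:E =
    (\sum_(j < n) \sum_(k < n) (zeta (Z i w, Z j w) * zeta (Z i w, Z k w))%:E)%E.
  rewrite expr2 mulr_suml -sumEFin; apply: eq_bigr => j _.
  by rewrite mulr_sumr -sumEFin.
under eq_integral do rewrite expand.
rewrite integral_sum//; last by move=> j; exact: integrable_sum.
under eq_bigr do rewrite integral_sum//.
apply: (@le_trans _ _ (\sum_(j < n) \sum_(k < n) ((~~ dist j k)%:R * K ^+ 2)%:E)%E).
  apply: lee_sum => j _; apply: lee_sum => k _.
  have [/zero ->|_] := boolP (dist j k); first by rewrite mul0r.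
  rewrite mul1r; apply: le_trans (_ : \int[P]_w (K ^+ 2)%:E <= _)%E.
    apply: le_integral => //.
      by apply: (bounded_integrable P (f := fun=> K ^+ 2) (K := K ^+ 2)) => // ?; rewrite ger0_norm ?sqr_ge0.
    by move=> w _; rewrite lee_fin (le_trans (ler_norm _)).
  by rewrite integral_prob_cst.
under eq_bigr do rewrite sumEFin -mulr_suml.
rewrite sumEFin lee_fin -mulr_suml ler_wpM2r ?sqr_ge0//.
apply: le_trans (_ : \sum_(j < n) \sum_(k < n) ((j == i :> nat) + (k == i :> nat) + (k == j :> nat))%:R <= _).
  apply: ler_sum => j _; apply: ler_sum => k _; rewrite ler_nat /dist.
  by do 3 case: eqP.
have le1 (l : nat) : \sum_(k < n) (k == l :> nat)%:R <= 1 :> R.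
  have [ln|nl] := ltnP l n.
    rewrite (bigD1 (Ordinal ln))//= eqxx big1 ?addr0// => k kl.
    by case: eqP => // kl'; case/eqP: kl; exact: val_inj.
  by rewrite big1// => k _; case: eqP => // kl; have := ltn_ord k; rewrite kl ltnNge nl.
have lens (F : 'I_n -> R) : (forall j, F j <= 1) -> \sum_j F j <= n%:R.
  move=> F1; apply: le_trans (ler_sum _ (fun j _ => F1 j)) _.
  by rewrite sumr_const card_ord.
have -> : \sum_(j < n) \sum_(k < n) ((j == i :> nat) + (k == i :> nat) + (k == j :> nat))%:R =
    \sum_(j < n) n%:R * (j == i :> nat)%:R + \sum_(j < n) \sum_(k < n) (k == i :> nat)%:R +
    \sum_(j < n) \sum_(k < n) (k == j :> nat)%:R :> R.
  rewrite -!big_split /=; apply: eq_bigr => j _.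
  rewrite (_ : n%:R * _ = \sum_(k < n) (j == i :> nat)%:R).
    by rewrite -!big_split /=; apply: eq_bigr => k _; rewrite !natrD.
  by rewrite sumr_const card_ord mulr_natl.
have -> : 3 * n%:R = n%:R + n%:R + n%:R :> R by ring.
apply: lerD; [apply: lerD|].
- by rewrite -mulr_sumr ler_piMr.
- by apply: lens => j; exact: le1.
- by apply: lens => j; exact: le1.
Qed.

End iid.

(** * Inverse-probability weighting under censoring *)

Section measurability.
Context (d0 : measure_display) (Omega : measurableType d0) (R : realType).

Lemma measurable_bool_natr (p : Omega -> bool) :
  measurable_fun setT p -> measurable_fun setT (fun w => (p w)%:R : R).
Proof. by move=> mp; apply: (@measurableT_comp _ _ _ _ _ _ (fun b : bool => b%:R : R)). Qed.

Lemma measurable_inv_ge0 (g : Omega -> R) : (forall w, 0 <= g w) ->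
  measurable_fun setT g -> measurable_fun setT (fun w => (g w)^-1).
Proof.
move=> g0 mg; rewrite (_ : (fun w => _) = (@powR R ^~ (-1)) \o g).
  exact: measurableT_comp.
by apply/funext => w /=; rewrite powR_inv1.
Qed.

Lemma measurable_pred_set (p : Omega -> bool) :
  measurable_fun setT p -> measurable [set w | p w].
Proof.
move=> mp; rewrite (_ : mkset _ = p @^-1` [set true]).
  by rewrite -[X in measurable X]setTI; exact: mp.
by apply/seteqP; split.
Qed.

Context (P : probability Omega R).

Lemma integral_bool (p : Omega -> bool) : measurable_fun setT p ->
  (\int[P]_w ((p w)%:R)%:E = P [set w | p w])%E.
Proof.
move=> mp; rewrite -[X in _ = P X]setIT -integral_indic//; last exact: measurable_pred_set.
apply: eq_integral => w _; rewrite indicE; congr (_%:R)%:E; congr nat_of_bool.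
by apply/idP/idP; rewrite inE.
Qed.

Lemma ge0_integral_scale (c : R) (g : Omega -> R) : 0 <= c ->
  measurable_fun setT g -> (forall w, 0 <= g w) ->
  (\int[P]_w (c * g w)%:E = c%:E * \int[P]_w (g w)%:E)%E.
Proof.
move=> c0 mg g0; under eq_integral do rewrite EFinM.
apply: ge0_integralZl => //.
- exact/measurable_EFinP.
- by move=> w _; rewrite lee_fin.
Qed.

Lemma ge0_integral_add (g h : Omega -> R) :
  measurable_fun setT g -> (forall w, 0 <= g w) ->
  measurable_fun setT h -> (forall w, 0 <= h w) ->
  (\int[P]_w (g w + h w)%:E = \int[P]_w (g w)%:E + \int[P]_w (h w)%:E)%E.
Proof.
move=> mg g0 mh h0; under eq_integral do rewrite EFinD.
by apply: ge0_integralD => //;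
  [move=> w _; rewrite lee_fin | exact/measurable_EFinP
  | move=> w _; rewrite lee_fin | exact/measurable_EFinP].
Qed.

Lemma ge0_integral_mono (g h : Omega -> R) :
  measurable_fun setT g -> (forall w, 0 <= g w) ->
  measurable_fun setT h -> (forall w, g w <= h w) ->
  (\int[P]_w (g w)%:E <= \int[P]_w (h w)%:E)%E.
Proof.
move=> mg g0 mh gh; apply: ge0_le_integral => //.
- by move=> w _; rewrite lee_fin.
- exact/measurable_EFinP.
- exact/measurable_EFinP.
by move=> w _; rewrite lee_fin.
Qed.

End measurability.

(** * Left-continuous survival functions *)

Section survival.
Context (d0 : measure_display) (Omega : measurableType d0) (R : realType)
  (P : probability Omega R) (V : Omega -> R) (mV : measurable_fun setT V).

(** The non-strict inequality makes the function left-continuous; for V = C it is 1 - G(t-), which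
    the denominators of the weights estimate. *)
Definition surv (t : R) : R := fine (P [set w | (t <= V w)%R]).

Let mle t : measurable_fun setT (fun w => t <= V w).
Proof. exact: measurable_fun_ler. Qed.

Lemma survE t : (surv t)%:E = P [set w | (t <= V w)%R].
Proof. by rewrite fineK// fin_num_measure//; exact: measurable_pred_set. Qed.

Lemma surv_integral t : (surv t)%:E = (\int[P]_w ((t <= V w)%R%:R)%:E)%E.
Proof. by rewrite integral_bool// survE. Qed.

Lemma surv_ge0 t : 0 <= surv t. Proof. exact: fine_ge0. Qed.

Lemma surv_le1 t : surv t <= 1.
Proof. by rewrite -lee_fin survE probability_le1//; exact: measurable_pred_set. Qed.

Lemma le_surv s t : s <= t -> surv t <= surv s.
Proof.
move=> st; rewrite -lee_fin !survE le_measure ?inE//; try exact: measurable_pred_set.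
by move=> w /=; exact: le_trans.
Qed.

Lemma measurable_surv : measurable_fun setT surv.
Proof.
apply/measurable_EFinP; rewrite (_ : _ \o _ = fun t => (\int[P]_w ((t <= V w)%R%:R)%:E)%E).
  apply: (@measurable_fun_fubini_tonelli_F _ _ _ _ _ P (fun x : R * Omega => ((x.1 <= V x.2)%R%:R)%:E)).
    apply/measurable_EFinP; apply: measurable_bool_natr.
    by apply: measurable_fun_ler => //; exact: measurableT_comp.
  by move=> x; rewrite lee_fin.
by apply/funext => t /=; rewrite surv_integral.
Qed.

Lemma surv_cvgNy : surv (- n%:R) @[n --> \oo] --> (1 : R).
Proof.
apply: fine_cvg; rewrite (_ : (fun n => _) = P \o (fun n => [set w | (- n%:R <= V w)%R]))//.
have -> : (1%:E = P (\bigcup_n [set w | (- n%:R <= V w)%R]))%E.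
  rewrite (_ : \bigcup_n _ = setT); first by apply/esym; exact: probability_setT.
  apply/seteqP; split=> // w _; exists (Num.trunc `|V w|).+1 => //=.
  rewrite lerNl; apply: le_trans (ler_norm _) _; rewrite normrN.
  by apply: ltW; exact: Num.Theory.truncnS_gt.
apply: nondecreasing_cvg_mu.
- by move=> n; exact: measurable_pred_set.
- by apply: bigcupT_measurable => n; exact: measurable_pred_set.
- move=> n m nm; apply/subsetPset => w /=; apply: le_trans.
  by rewrite lerN2 ler_nat.
Qed.

Lemma surv_cvgy : surv n%:R @[n --> \oo] --> (0 : R).
Proof.
apply: fine_cvg; rewrite (_ : (fun n => _) = P \o (fun n => [set w | (n%:R <= V w)%R]))//.
have -> : (0%:E = P (\bigcap_n [set w | (n%:R <= V w)%R]))%E.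
  rewrite (_ : \bigcap_n _ = set0) ?measure0//.
  apply/seteqP; split=> // w /(_ (Num.trunc `|V w|).+1 I) /=; apply/negP.
  by rewrite -ltNge; apply: le_lt_trans (ler_norm _) _; exact: Num.Theory.truncnS_gt.
apply: nonincreasing_cvg_mu.
- by rewrite (@le_lt_trans _ _ 1%E) ?probability_le1 ?ltry//; exact: measurable_pred_set.
- by move=> n; exact: measurable_pred_set.
- by apply: bigcapT_measurable => n; exact: measurable_pred_set.
- move=> n m nm; apply/subsetPset => w /=; apply: le_trans.
  by rewrite ler_nat.
Qed.

Lemma surv_left t : surv (t - n.+1%:R^-1) @[n --> \oo] --> surv t.
Proof.
apply: fine_cvg; rewrite (_ : (fun n => _) = P \o (fun n => [set w | (t - n.+1%:R^-1 <= V w)%R]))//.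
rewrite survE (_ : [set w | (t <= V w)%R] = \bigcap_n [set w | (t - n.+1%:R^-1 <= V w)%R]).
  apply: nonincreasing_cvg_mu.
  - by rewrite (@le_lt_trans _ _ 1%E) ?probability_le1 ?ltry//; exact: measurable_pred_set.
  - by move=> n; exact: measurable_pred_set.
  - by apply: bigcapT_measurable => n; exact: measurable_pred_set.
  - move=> n m nm; apply/subsetPset => w /=; apply: le_trans.
    by rewrite lerD2l lerN2 lef_pV2 ?posrE// ler_nat.
apply/seteqP; split=> w /=.
  by move=> tV n _ /=; apply: le_trans tV; rewrite lerBlDr lerDl invr_ge0.
move=> h; rewrite leNgt; apply/negP => Vt.
have : 0 < t - V w by rewrite subr_gt0.
move=> /ltr_add_invr[n]; rewrite add0r => nt.
have /= := h n I; rewrite lerBlDr => tn.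
by move: nt; rewrite ltrBrDr addrC ltNge tn.
Qed.

(* t is the supremum of a superlevel set of the left-continuous function surv. *)
Lemma surv_level (e : R) : 0 < e -> e < 1 ->
  exists t, e <= surv t /\ forall s, t < s -> surv s < e.
Proof.
move=> e0 e1; pose A := [set t | e <= surv t].
have A0 : A !=set0.
  have [n _ /(_ n (leqnn n)) /= /ltW h] := cvgr_gt (1 : R) surv_cvgNy _ e1.
  by exists (- n%:R).
have [n _ /(_ n (leqnn n)) /= n_e] := cvgr_lt (0 : R) surv_cvgy _ e0.
have uA : ubound A n%:R.
  move=> t At; rewrite leNgt; apply/negP => /ltW /le_surv /(le_trans At).
  by rewrite leNgt n_e.
have supA : has_sup A by split=> //; exists n%:R.
exists (sup A); split; last first.
  move=> s ss; rewrite ltNge; apply/negP => As.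
  by move: ss; rewrite ltNge; apply/negP/negPn; apply: ub_le_sup => //; exists n%:R.
rewrite leNgt; apply/negP => lt_e.
have [m _ /(_ m (leqnn m)) /=] := cvgr_lt (surv (sup A)) (@surv_left (sup A)) _ lt_e.
have [a Aa lt_a] : exists2 a, A a & sup A - m.+1%:R^-1 < a.
  by apply: sup_adherent => //; rewrite invr_gt0.
by rewrite ltNge (le_trans Aa)// le_surv// ltW.
Qed.

End survival.

Section censoring.
Context (d0 d1 : measure_display) (Omega : measurableType d0) (R : realType)
  (P : probability Omega R) (S : measurableType d1)
  (Y C : Omega -> R) (X : Omega -> S)
  (mY : measurable_fun setT Y) (mC : measurable_fun setT C)
  (mX : measurable_fun setT X).

Let T w := Num.min (Y w) (C w).
Let delta w := Y w <= C w.

Lemma measurable_cens_time : measurable_fun setT T.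
Proof. exact: (measurable_minr mY mC). Qed.

Lemma measurable_cens_ind : measurable_fun setT delta.
Proof. exact: measurable_fun_ler. Qed.

Hypothesis YC_indep : independent2 P Y C.

Lemma surv_cens_time t : surv P T t = surv P Y t * surv P C t.
Proof.
apply/EFin_inj; rewrite EFinM !survE//; last exact: measurable_cens_time.
transitivity (P (Y @^-1` [set y | t <= y] `&` C @^-1` [set y | t <= y])).
  by congr (P _); apply/seteqP; split=> w /=; rewrite /T le_min => /andP.
by rewrite YC_indep//; apply: measurable_pred_set; exact: measurable_fun_ler.
Qed.

(** Integrating out C with Y frozen: by independence, [surv P C (Y w)] is a version of the
    conditional probability of delta given Y. *)
Lemma integral_cens_ind (B : set R) : measurable B ->
  (\int[P]_(w in Y @^-1` B) ((delta w)%:R)%:E =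
   \int[P]_(w in Y @^-1` B) (surv P C (Y w))%:E)%E.
Proof.
move=> mB.
pose g (x : R * R) : \bar R := ((\1_B x.1 * (x.1 <= x.2)%R%:R)%:E)%E.
have mg : measurable_fun setT g.
  apply/measurable_EFinP; apply: measurable_funM.
    exact: (@measurableT_comp _ _ _ _ _ _ (\1_B : R -> R)).
  by apply: measurable_bool_natr; exact: measurable_fun_ler.
have g0 x : (0 <= g x)%E by rewrite lee_fin mulr_ge0.
have := integral_indep mY mC YC_indep mg g0.
rewrite [X in _ = X -> _](eq_integral (fun w => (\1_B (Y w) * surv P C (Y w))%:E)); last first.
  move=> w _; rewrite /g /=; under eq_integral do rewrite EFinM.
  rewrite ge0_integralZl//.
  - by rewrite EFinM surv_integral.
  - by apply/measurable_EFinP; apply: measurable_bool_natr; exact: measurable_fun_ler.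
move=> h; rewrite integral_mkcond [RHS]integral_mkcond.
have -> : (fun w => ((delta w)%:R)%:E) \_ (Y @^-1` B) = (fun w => g (Y w, C w)).
  apply/funext => w; rewrite patchE /g /= indicE.
  by rewrite (_ : (w \in Y @^-1` B) = (Y w \in B)); [case: ifP; rewrite ?mul1r ?mul0r | apply/idP/idP; rewrite !inE].
rewrite h.
apply: eq_integral => w _; rewrite patchE indicE.
by rewrite (_ : (w \in Y @^-1` B) = (Y w \in B)); [case: ifP; rewrite ?mul1r ?mul0r | apply/idP/idP; rewrite !inE].
Qed.

Hypothesis delta_cond : exists q : R -> R,
  is_cond_expect P Y (fun w => (delta w)%:R) q /\
  is_cond_expect P (fun w => (X w, Y w)) (fun w => (delta w)%:R)
    (fun xy => q xy.2).

(** Both [q (Y w)] and [surv P C (Y w)] are versions of the conditional expectation of delta given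
    Y, hence almost surely equal; the second half of [delta_cond] then lets the covariates join the
    conditioning. *)
Lemma integral_cens_ind_cov (A : set (S * R)) : measurable A ->
  (\int[P]_(w in (fun w => (X w, Y w)) @^-1` A) ((delta w)%:R)%:E =
   \int[P]_(w in (fun w => (X w, Y w)) @^-1` A) (surv P C (Y w))%:E)%E.
Proof.
move=> mA; have [q [[_ mq iq q1] [_ _ _ ->]]] := delta_cond; last by [].
have [N [mN PN0 subN]] : {ae P, forall w, q (Y w) = surv P C (Y w)}.
  have : ae_eq (law_of P mY) setT (EFin \o surv P C) (EFin \o q).
    apply: integral_ae_eq => //.
    - apply: (bounded_integrable (law_of P mY) (K := 1)); first exact: measurable_surv.
      by move=> t; rewrite ger0_norm ?surv_ge0// surv_le1.
    - exact/measurable_EFinP.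
    - move=> E _ mE.
      have mYE : measurable (Y @^-1` E) by rewrite -[X in measurable X]setTI; exact: mY.
      have iS : P.-integrable setT (EFin \o (surv P C \o Y)).
        apply: (bounded_integrable P (K := 1)) => [|w].
          by apply: measurableT_comp mY; exact: measurable_surv.
        by rewrite ger0_norm ?surv_ge0// surv_le1.
      rewrite (integral_pushforward mY)//; last 2 first.
      - by apply/measurable_EFinP; exact: measurable_surv.
      - exact: (integrableS measurableT mYE).
      rewrite (integral_pushforward mY)//; last 2 first.
      - exact/measurable_EFinP.
      - exact: (integrableS measurableT mYE).
      by rewrite -q1// integral_cens_ind.
  move=> [N [mN N0 subN]]; exists (Y @^-1` N); split => //.
    by rewrite -[X in measurable X]setTI; exact: mY.
  move=> w /= nq; apply: subN => /= h; apply: nq; apply/esym.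
  by have := h I => -[].
have mXY : measurable_fun setT (fun w => (X w, Y w)) by exact: measurable_fun_pair.
apply: ae_eq_integral => //.
- by rewrite -[X in measurable X]setTI; exact: mXY.
- apply/measurable_EFinP; apply: measurable_funTS; exact: measurableT_comp mY.
- apply/measurable_EFinP; apply: measurable_funTS.
  by apply: measurableT_comp mY; exact: measurable_surv.
exists N; split=> // w /= h; apply: subN => /= e; apply: h => _.
by rewrite e.
Qed.

(** When delta holds, T = Y, so the weight is a function of Y and delta may be replaced by its
    conditional probability [surv P C (Y w)]. As 0^-1 = 0, weight times probability is the indicator
    of a positive probability: values of Y that C never reaches drop out. *)
Lemma integral_cens_weight (g : S * R -> R) : measurable_fun setT g ->
  (forall x, 0 <= g x) ->
  (\int[P]_w ((delta w)%:R * ((surv P C (T w))^-1 * g (X w, T w)))%:E =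
   \int[P]_w ((0 < surv P C (Y w))%R%:R * g (X w, Y w))%:E)%E.
Proof.
move=> mg g0.
have mi : measurable_fun setT (fun x : S * R => (surv P C x.2)^-1).
  apply: measurable_inv_ge0 => [x|]; first exact: surv_ge0.
  by apply: measurableT_comp measurable_snd; exact: measurable_surv.
transitivity (\int[P]_w ((delta w)%:R * ((surv P C (Y w))^-1 * g (X w, Y w)))%:E)%E.
  apply: eq_integral => w _; rewrite /delta /T.
  by case: (boolP (Y w <= C w)) => [YC|_]; [rewrite min_l | rewrite !mul0r].
transitivity (\int[P]_w (surv P C (Y w) * ((surv P C (Y w))^-1 * g (X w, Y w)))%:E)%E.
  apply: (@integral_weight_eq _ _ _ _ _ P (fun w => (X w, Y w)) _ _ _
    (fun x => (surv P C x.2)^-1 * g x)) => //.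
  - exact: measurable_fun_pair.
  - by apply: measurable_bool_natr; exact: measurable_cens_ind.
  - by apply: measurableT_comp mY; exact: measurable_surv.
  - by move=> w; exact: surv_ge0.
  - exact: integral_cens_ind_cov.
  - exact: measurable_funM.
  - by move=> x; rewrite mulr_ge0 ?invr_ge0 ?surv_ge0.
apply: eq_integral => w _; have := surv_ge0 P C (Y w).
rewrite le_eqVlt => /orP[/eqP <-|lt]; first by rewrite ltxx !mul0r.
by rewrite lt mul1r mulrA divff ?mul1r// gt_eqF.
Qed.

Hypothesis endpoint : right_endpoint P Y = right_endpoint P T.
Hypothesis endpoint_atom : forall t : R, right_endpoint P Y = t%:E ->
  (0 < P [set w | Y w = t])%E -> (0 < P [set w | T w = t])%E.

Let mset (p : Omega -> bool) : measurable_fun setT p -> measurable [set w | p w].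
Proof. exact: measurable_pred_set. Qed.

(** If P(T >= t) vanishes at t = Y, then Y is at or above the common endpoint of Y and T. Values
    above it form a null set; the endpoint itself matters only if P(T >= .) vanishes there, and then
    it is no atom of T, hence by [endpoint_atom] no atom of Y. *)
Lemma ae_surv_cens_time_gt0 : {ae P, forall w, 0 < surv P T (Y w)}.
Proof.
have mT := measurable_cens_time.
have ubN t : surv P T t = 0 -> (right_endpoint P T <= t%:E)%E.
  move=> Tt0; apply: ereal_inf_lbound; exists t => //=.
  rewrite -[X in P X]setCK probability_setC; last first.
    by apply: measurableC; apply: mset; exact: measurable_fun_ler.
  suff -> : P (~` [set w | (T w <= t)%R]) = 0%E by rewrite sube0.
  apply/eqP; rewrite eq_le measure_ge0 andbT.
  have <- : (surv P T t)%:E = 0%E by rewrite Tt0.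
  rewrite survE// le_measure ?inE//.
  - by apply: measurableC; apply: mset; exact: measurable_fun_ler.
  - by apply: mset; exact: measurable_fun_ler.
  - by move=> w /= /negP; rewrite -ltNge => /ltW.
have above t : (right_endpoint P Y < t%:E)%E -> P [set w | t < Y w] = 0%E.
  move=> /ereal_inf_lt[_ [s Ys1 <-]]; rewrite lte_fin => st.
  apply/eqP; rewrite eq_le measure_ge0 andbT.
  apply: (@le_trans _ _ (P (~` [set w | (Y w <= s)%R]))).
    rewrite le_measure ?inE//.
    - by apply: mset; exact: measurable_fun_ltr.
    - by apply: measurableC; apply: mset; exact: measurable_fun_ler.
    - by move=> w /= tY; apply/negP; rewrite -ltNge (lt_trans st).
  rewrite probability_setC ?Ys1 ?subee//.
  by apply: mset; exact: measurable_fun_ler.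
have mlt t : measurable [set w | t < Y w] by apply: mset; exact: measurable_fun_ltr.
have null (A : set Omega) : measurable A -> P A = 0%E -> P.-negligible A.
  by move=> mA PA; exists A; split.
have above0 t : right_endpoint P Y = t%:E -> P.-negligible [set w | t < Y w].
  move=> Yt; rewrite (_ : mkset _ = \bigcup_n [set w | t + n.+1%:R^-1 < Y w]); last first.
    apply/seteqP; split=> w /=; last by move=> [n _ /=]; apply: lt_trans; rewrite ltrDl invr_gt0.
    by move=> /ltr_add_invr[n tn]; exists n.
  apply: negligible_bigcup => n; apply: null => //; apply: above.
  by rewrite Yt lte_fin ltrDl invr_gt0.
have zero w : ~ 0 < surv P T (Y w) -> (right_endpoint P Y <= (Y w)%:E)%E.
  move=> /negP; rewrite -leNgt => le0; rewrite endpoint; apply: ubN; apply/eqP.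
  by rewrite eq_le le0 surv_ge0.
case e : (right_endpoint P Y) zero above0 above => [t0| |] zero above0 above.
- have [Tt0|Tt0] := eqVneq (surv P T t0) 0.
    have mTt : measurable [set w | T w = t0].
      by rewrite -[X in measurable X]setTI; exact: (mT measurableT _ (measurable_set1 t0)).
    have PT0 : P [set w | T w = t0] = 0%E.
      apply/eqP; rewrite eq_le measure_ge0 andbT.
      have <- : (surv P T t0)%:E = 0%E by rewrite Tt0.
      rewrite survE// le_measure ?inE//.
      - by apply: mset; exact: measurable_fun_ler.
      - by move=> w /= ->.
    have PY0 : P [set w | Y w = t0] = 0%E.
      apply/eqP; rewrite eq_le measure_ge0 andbT leNgt; apply/negP.
      by move=> /(endpoint_atom e); rewrite PT0 ltxx.
    have mYt : measurable [set w | Y w = t0].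
      by have := mY measurableT (measurable_set1 t0); rewrite setTI.
    apply: (negligibleS _ (negligibleU (null _ mYt PY0) (above0 t0 erefl))).
    by move=> w /= /zero; rewrite lee_fin le_eqVlt => /orP[/eqP ->|]; [left|right].
  apply: negligibleS (above0 t0 erefl) => w /= nz; have := zero w nz.
  rewrite lee_fin le_eqVlt => /orP[/eqP Yw|//]; exfalso; apply: nz.
  by rewrite -Yw lt_def Tt0 surv_ge0.
- apply: negligibleS (negligible_set0 P) => w /= /zero.
  by rewrite leye_eq.
- rewrite /almost_everywhere /=.
  apply: (negligibleS (A := \bigcup_n [set w | - n%:R < Y w])).
    move=> w _; exists (Num.trunc `|Y w|).+1 => //=.
    rewrite ltrNl; apply: le_lt_trans (ler_norm _) _; rewrite normrN.
    exact: Num.Theory.truncnS_gt.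
  by apply: negligible_bigcup => n; apply: null => //; apply: above; rewrite ltNyr.
Qed.

Lemma integral_cens (g : S * R -> R) : measurable_fun setT g ->
  (forall x, 0 <= g x) ->
  (\int[P]_w ((delta w)%:R * ((surv P C (T w))^-1 * g (X w, T w)))%:E =
   \int[P]_w (g (X w, Y w))%:E)%E.
Proof.
move=> mg g0; rewrite integral_cens_weight//.
have mgY : measurable_fun setT (fun w => g (X w, Y w)).
  exact: (measurableT_comp mg (measurable_fun_pair mX mY)).
apply: ge0_ae_eq_integral => //.
- apply/measurable_EFinP; apply: measurable_funM => //.
  apply: measurable_bool_natr; apply: measurable_fun_ltr => //.
  by apply: measurableT_comp mY; exact: measurable_surv.
- exact/measurable_EFinP.
- by move=> w _; rewrite lee_fin mulr_ge0.
- by move=> w _; rewrite lee_fin.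
apply: filterS ae_surv_cens_time_gt0 => w lt _ /=.
move: lt; rewrite surv_cens_time; have [->|ne] := eqVneq (surv P C (Y w)) 0.
  by rewrite mulr0 ltxx.
move=> _; have -> : 0 < surv P C (Y w) by rewrite lt_def ne surv_ge0.
by rewrite mul1r.
Qed.

End censoring.

(** * Truncation below the right endpoint *)

Section truncation.
Context (d0 : measure_display) (Omega : measurableType d0) (R : realType)
  (P : probability Omega R) (Y T : Omega -> R)
  (mY : measurable_fun setT Y) (mT : measurable_fun setT T).

(** The bound y <= t keeps P(T >= y) away from 0, hence the population weights bounded; the bound on
    |y| makes functions of quadratic growth bounded. *)
Definition trunc (t K y : R) : bool := (y <= t) && (`|y| <= K).

Lemma measurable_trunc (t K : R) : measurable_fun setT (trunc t K).
Proof.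
apply: measurable_and; apply: measurable_fun_ler => //; exact: measurableT_comp.
Qed.

(** The events P(T >= Y) >= 1 / (k + 2), |Y| <= k exhaust the space almost surely, so dominated
    convergence applies; [surv_level] then encloses the first condition in a half-line Y <= t whose
    end still satisfies P(T >= t) > 0. The index k + 2 keeps the level below 1. *)
Lemma exists_trunc (h : R -> R) (e : R) :
  {ae P, forall w, 0 < surv P T (Y w)} ->
  measurable_fun setT h -> (forall y, 0 <= h y) ->
  P.-integrable setT (fun w => (h (Y w))%:E) -> 0 < e ->
  exists t K, 0 < surv P T t /\
   (\int[P]_w (h (Y w) * (~~ trunc t K (Y w))%:R)%:E <= e%:E)%E.
Proof.
move=> survY mh h0 ih e0.
have msT : measurable_fun setT (fun w => surv P T (Y w)).
  by apply: measurableT_comp mY; exact: measurable_surv.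
have mhY : measurable_fun setT (fun w => h (Y w)) by exact: measurableT_comp.
pose p k w := (k.+2%:R^-1 <= surv P T (Y w)) && (`|Y w| <= k%:R).
have mp k : measurable_fun setT (p k).
  apply: measurable_and; apply: measurable_fun_ler => //; exact: measurableT_comp.
pose f k w : \bar R := (h (Y w) * (~~ p k w)%:R)%:E.
have mf k : measurable_fun setT (f k).
  apply/measurable_EFinP; apply: measurable_funM => //.
  by apply: measurable_bool_natr; exact: measurable_neg.
have [] := @dominated_convergence _ _ _ P setT measurableT f (cst 0%E) (fun w => (h (Y w))%:E).
- exact: mf.
- exact: measurable_cst.
- apply: filterS survY => w lt _; apply: cvg_near_cst.
  have [k1 k1P] : exists k1, forall k, (k1 <= k)%N -> k.+2%:R^-1 <= surv P T (Y w).
    have [k _ hk] := near_infty_natSinv_lt (PosNum lt); exists k => m km.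
    apply: ltW; apply: le_lt_trans (hk _ km) => /=.
    by rewrite lef_pV2 ?posrE// ler_nat.
  near=> k; rewrite /f /p k1P; last by near: k; exact: nbhs_infty_ge.
  suff -> : `|Y w| <= k%:R by rewrite /= mulr0.
  by near: k; exact: nbhs_infty_ger.
- exact: ih.
- apply: aeW => w k _; rewrite lee_fin normrM (ger0_norm (h0 _)) ger0_norm//.
  by rewrite ler_piMr//; case: (~~ _).
move=> _ _; rewrite integral0 => /(_ _)/= cvf0.
have {cvf0} [k ke] : exists k, (\int[P]_w f k w < e%:E)%E.
  have : \forall k \near \oo, (\int[P]_w f k w < e%:E)%E.
    move/fine_cvgP : cvf0 => [fin /cvgr_lt /(_ e e0) lt].
    by apply: filterS2 fin lt => k fink lt; rewrite -(fineK fink) lte_fin.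
  by move=> [k _ /(_ k (leqnn k))]; exists k.
have [t [le_t gt_t]] : exists t, k.+2%:R^-1 <= surv P T t /\
    forall s, t < s -> surv P T s < k.+2%:R^-1.
  by apply: surv_level => //; rewrite ?invr_gt0// invf_lt1// ltr1n.
exists t, k%:R; split; first by apply: lt_le_trans le_t; rewrite invr_gt0.
apply: le_trans (ltW ke); apply: ge0_le_integral => //.
- by move=> w _; rewrite lee_fin mulr_ge0.
- apply/measurable_EFinP; apply: measurable_funM => //.
  apply: measurable_bool_natr; apply: measurable_neg.
  by apply: measurableT_comp mY; exact: measurable_trunc.
move=> w _; rewrite lee_fin ler_wpM2l// ler_nat /p /trunc.
have [le_Y|lt_Y] := leP (Y w) t; last by rewrite [_ <= surv P T _]leNgt gt_t.
by case: (`|Y w| <= _); rewrite ?andbF//= andbT; case: (~~ _).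
Unshelve. all: by end_near. Qed.

End truncation.

(** * Measurability of Kaplan-Meier integrals *)

Section measurable_km.
Context (d0 : measure_display) (Omega : measurableType d0) (R : realType).

Lemma measurable_mem (I : eqType) (V : I -> Omega -> R) (u : Omega -> R)
    (l : seq I) :
  (forall k, measurable_fun setT (V k)) -> measurable_fun setT u ->
  measurable_fun setT (fun w => u w \in [seq V k w | k <- l]).
Proof.
move=> mV mu; elim: l => [|k l IH]; first exact: measurable_cst.
under eq_fun do rewrite /= in_cons.
by apply: measurable_or => //; exact: measurable_fun_eqr.
Qed.

(** The list of distinct values varies with w. Peeling off one index at a time turns [undup] into
    the measurable test whether the new value already occurs in the rest of the list. *)
Lemma measurable_prod_undup (I : eqType) (V : I -> Omega -> R)
    (h : R -> Omega -> R) (t : Omega -> R) (l : seq I) :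
  (forall k, measurable_fun setT (V k)) ->
  (forall k, measurable_fun setT (fun w => h (V k w) w)) ->
  measurable_fun setT t ->
  measurable_fun setT
    (fun w => \prod_(s <- undup [seq V k w | k <- l] | s < t w) h s w).
Proof.
move=> mV mh mt; elim: l => [|k l IH].
  by under eq_fun do rewrite big_nil; exact: measurable_cst.
rewrite (_ : (fun w => _) = fun w =>
  if V k w \in [seq V j w | j <- l]
  then \prod_(s <- undup [seq V k w | k <- l] | s < t w) h s w
  else if V k w < t w
  then h (V k w) w * \prod_(s <- undup [seq V k w | k <- l] | s < t w) h s w
  else \prod_(s <- undup [seq V k w | k <- l] | s < t w) h s w).
  apply: measurable_fun_ifT => //; first exact: measurable_mem.
  apply: measurable_fun_ifT => //; first exact: measurable_fun_ltr.
  exact: measurable_funM.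
by apply/funext => w /=; case: (V k w \in _) => //; rewrite big_cons.
Qed.

Lemma measurable_card (I : finType) (p : I -> Omega -> bool) :
  (forall k, measurable_fun setT (p k)) ->
  measurable_fun setT (fun w => #|[pred k | p k w]|%:R : R).
Proof.
move=> mp; rewrite (_ : (fun w => _) = fun w => \sum_k (p k w)%:R).
  by apply: measurable_sum => k; exact: measurable_bool_natr.
apply/funext => w; rewrite -sum1_card natr_sum big_mkcond /=.
by apply: eq_bigr => k _; rewrite inE; case: (p k w).
Qed.

Lemma measurable_km_inv (I : finType) (T : I -> Omega -> R)
    (delta : I -> Omega -> bool) (t : Omega -> R) :
  (forall k, measurable_fun setT (T k)) ->
  (forall k, measurable_fun setT (delta k)) -> measurable_fun setT t ->
  measurable_fun setT (fun w => km_inv (fun k => T k w) (fun k => delta k w)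
    [set: I]%SET (t w)).
Proof.
move=> mT md mt; pose h (s : R) w : R := (1 - (censored_at (fun k => T k w) (fun k => delta k w) [set: I]%SET s)%:R /
   (at_risk (fun k => T k w) [set: I]%SET s)%:R)^-1.
apply: (measurable_prod_undup (h := h) (enum I) mT) mt => k.
apply: measurable_inv_ge0 => [w|]; first exact: km_factor_ge0.
apply: measurable_funB => //; apply: measurable_funM.
  apply: measurable_card => j; apply: measurable_and => //; apply: measurable_and.
    exact: measurable_fun_eqr.
  exact: measurable_neg.
apply: measurable_inv_ge0 => //.
apply: measurable_card => j; apply: measurable_and => //.
exact: measurable_fun_ler.
Qed.

End measurable_km.

Section measurable_km_integral.
Context (R : realType) (d : nat).

Lemma measurable_obs_time : measurable_fun setT (@obs_time R d).
Proof. exact: (measurableT_comp measurable_fst measurable_fst). Qed.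

Lemma measurable_obs_uncens : measurable_fun setT (@obs_uncens R d).
Proof. exact: (measurableT_comp measurable_snd measurable_fst). Qed.

Lemma measurable_obs_cov : measurable_fun setT (@obs_cov R d).
Proof. exact: measurable_snd. Qed.

Lemma measurable_km_integral (d0 : measure_display) (Omega : measurableType d0)
    (n : nat) (z : 'I_n -> Omega -> obs R d) (phi : 'rV[R]_d -> R -> R) :
  (forall k, measurable_fun setT (z k)) ->
  measurable_fun setT (fun x : 'rV[R]_d * R => phi x.1 x.2) ->
  measurable_fun setT (fun w => km_integral (z ^~ w) phi).
Proof.
move=> mz mphi; apply: measurable_sum => i.
have mT k := measurableT_comp measurable_obs_time (mz k).
have md k := measurableT_comp measurable_obs_uncens (mz k).
have mX k := measurableT_comp measurable_obs_cov (mz k).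
apply: measurable_funM; last first.
  exact: (measurableT_comp mphi (measurable_fun_pair (mX i) (mT i))).
under eq_fun do rewrite km_weightE.
apply: measurable_funM => //; apply: measurable_funM.
  exact: (measurable_bool_natr (md i)).
exact: (measurable_km_inv mT md (mT i)).
Qed.

End measurable_km_integral.

(** * Consistency of Kaplan-Meier integrals *)

Section eventual_probability.
Context (d0 : measure_display) (Omega : measurableType d0) (R : realType)
  (P : probability Omega R).

(* Outer probability, as in [oP1]: the E n need not be measurable. *)
Definition evp (E : nat -> set Omega) (p : R) : Prop :=
  \forall n \near \oo, (mu_ext P (~` E n) <= p%:E)%E.

Lemma mu_extU2 (A B : set Omega) :
  (mu_ext P (A `|` B) <= mu_ext P A + mu_ext P B)%E.
Proof. exact: (@outer_measureU2 _ _ (mu_ext P)). Qed.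

Lemma mu_ext_measurable (A B : set Omega) : measurable B -> A `<=` B ->
  (mu_ext P A <= P B)%E.
Proof.
move=> mB AB; rewrite -(@measurable_mu_extE _ _ _ P)//; exact: le_mu_ext.
Qed.

Lemma evpI (E F G : nat -> set Omega) (p q : R) : evp E p -> evp F q ->
  (\forall n \near \oo, E n `&` F n `<=` G n) -> evp G (p + q).
Proof.
move=> hE hF EFG; near=> n.
apply: le_trans (_ : mu_ext P (~` E n `|` ~` F n) <= _)%E.
  by apply: le_mu_ext; rewrite -setCI; apply: subsetC; near: n.
apply: le_trans (mu_extU2 _ _) _; rewrite EFinD; apply: leeD; by near: n.
Unshelve. all: by end_near. Qed.

Lemma evpS (E G : nat -> set Omega) (p q : R) : evp E p -> p <= q ->
  (\forall n \near \oo, E n `<=` G n) -> evp G q.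
Proof.
move=> hE pq EG; near=> n.
apply: (@le_trans _ _ (mu_ext P (~` E n))).
  by apply: le_mu_ext; apply: subsetC; near: n.
by apply: (@le_trans _ _ p%:E); [near: n | rewrite lee_fin].
Unshelve. all: by end_near. Qed.

Lemma evp_ae (E : nat -> set Omega) : (forall n, {ae P, forall w, E n w}) ->
  evp E 0.
Proof.
move=> aeE; apply: nearW => n; have [N [mN N0 sub]] := aeE n.
by apply: le_trans (mu_ext_measurable mN sub) _; rewrite N0.
Qed.

Lemma markov_mu_ext (V : Omega -> R) (m e : R) : measurable_fun setT V ->
  (forall w, 0 <= V w) -> (\int[P]_w (V w)%:E <= m%:E)%E -> 0 < e ->
  (mu_ext P [set w | (e < V w)%R] <= (m / e)%:E)%E.
Proof.
move=> mV V0 Vm e0.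
have mp : measurable_fun setT (fun w => e < V w) by exact: measurable_fun_ltr.
apply: le_trans (mu_ext_measurable (measurable_pred_set mp) (@subset_refl _ _)) _.
rewrite -integral_bool// EFinM muleC lee_pdivlMl//.
have mb : measurable_fun setT (fun w => ((e < V w)%R%:R)%:E : \bar R).
  by apply/measurable_EFinP; exact: measurable_bool_natr.
apply: le_trans Vm; rewrite -ge0_integralZl//; last by rewrite lee_fin ltW.
apply: ge0_le_integral => //.
- by move=> w _; rewrite mule_ge0 ?lee_fin// ltW.
- exact: measurable_funeM.
- exact/measurable_EFinP.
by move=> w _; rewrite -EFinM lee_fin; case: ltP => [/ltW|]; rewrite ?mulr1 ?mulr0.
Qed.

End eventual_probability.

(** * Gronwall bound for the Kaplan-Meier weights *)

Section deterministic_bound.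
Context (R : realType) (n : nat) (T : 'I_n -> R) (delta : 'I_n -> bool).

Let A := km_inv T delta [set: 'I_n]%SET.

(* For a = 1 / P(C >= .), each summand of the inner sum has mean zero in the j-th
   observation, given the i-th one. *)
Lemma km_inv_dev_le (a : R -> R) (t0 b : R) : (0 < n)%N ->
  (forall i j, T i = T j -> delta i = delta j) -> 0 < b ->
  b * n%:R <= (at_risk T [set: 'I_n]%SET t0)%:R ->
  \sum_i n%:R^-1 * ((delta i)%:R * (T i <= t0)%R%:R * `|A (T i) - a (T i)|) <=
  b^-1 * (n%:R^-1 * \sum_i `|n%:R^-1 * \sum_j (T i <= t0)%R%:R *
     (a (T i) * (T i <= T j)%R%:R + (delta j)%:R * a (T j) * (T j < T i)%R%:R - 1)|)
  * expR (b^-1).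
Proof.
move=> n0 noties b0 bn; have nR : 0 < n%:R :> R by rewrite ltr0n.
set xi := fun i => n%:R^-1 * \sum_j (T i <= t0)%R%:R *
     (a (T i) * (T i <= T j)%R%:R + (delta j)%:R * a (T j) * (T j < T i)%R%:R - 1).
set v := fun i => n%:R^-1 * ((delta i)%:R * (T i <= t0)%R%:R * `|A (T i) - a (T i)|).
have v0 i : 0 <= v i by rewrite /v !mulr_ge0// invr_ge0.
pose q := b^-1 / n%:R.
have q0 : 0 <= q by rewrite divr_ge0 ?invr_ge0// ltW.
have := @discrete_gronwall R _ T v (fun i => q * `|xi i|) q q0.
have key i : v i <= q * `|xi i| + q * \sum_(j | T j < T i) v j.
  have [le_t|] := leP (T i) t0; last first.
    move=> lt; rewrite {1}/v (lt_geF lt) mulr0 mul0r mulr0.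
    by rewrite addr_ge0// mulr_ge0// sumr_ge0.
  rewrite -mulrDr.
  apply: le_trans (_ : n%:R^-1 * `|A (T i) - a (T i)| <= _).
    rewrite /v ler_wpM2l ?invr_ge0// ler_piMl//.
    by rewrite le_t mulr1; case: (delta i).
  rewrite /q mulrAC mulrC ler_wpM2r ?invr_ge0// ler_pdivlMl//.
  set r := at_risk T [set: 'I_n]%SET (T i).
  have r0 : (0 < r)%N by apply/card_gt0P; exists i; rewrite !inE lexx.
  have br : b * n%:R <= r%:R.
    apply: le_trans bn _; rewrite ler_nat; apply: subset_leq_card.
    by apply/fintype.subsetP => j; rewrite !inE /=; apply: le_trans.
  have massE := km_inv_mass_eq noties r0; rewrite card_ord in massE.
  have xiE : xi i = n%:R^-1 * (r%:R * a (T i) + \sum_(j | T j < T i) (delta j)%:R * a (T j)) - 1.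
    rewrite /xi le_t; under eq_bigr do rewrite mul1r.
    rewrite sumrB sumr_const card_ord mulrBr mulVf ?gt_eqF//; congr (_ * _ - 1).
    rewrite big_split /= -mulr_sumr mulrC; congr (_ * _ + _).
      rewrite /r /at_risk -sum1_card natr_sum [RHS]big_mkcond.
      by apply: eq_bigr => j _; rewrite !inE; case: (_ <= _).
    by rewrite [RHS]big_mkcond; apply: eq_bigr => j _; case: (_ < _); rewrite ?mulr1 ?mulr0.
  (* [xi i] measures by how much [a] fails the Volterra equation at T_i; subtracting it from the
     equation of [A] leaves a linear recursion for A - a over earlier times. *)
  have diff : r%:R / n%:R * (A (T i) - a (T i)) = - xi i -
      n%:R^-1 * \sum_(j | T j < T i) (delta j)%:R * (A (T j) - a (T j)).
    have -> : \sum_(j | T j < T i) (delta j)%:R * (A (T j) - a (T j)) =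
        \sum_(j | T j < T i) (delta j)%:R * A (T j) - \sum_(j | T j < T i) (delta j)%:R * a (T j).
      by rewrite -sumrB; apply: eq_bigr => j _; rewrite mulrBr.
    rewrite xiE; move: massE; rewrite -/A -/r => massE.
    have e1 : n%:R^-1 * (r%:R * A (T i) + \sum_(j | T j < T i) (delta j)%:R * A (T j)) = 1.
      by rewrite massE mulVf// gt_eqF.
    rewrite -[X in - (_ - X)]e1; ring.
  have : r%:R / n%:R * `|A (T i) - a (T i)| <= `|xi i| + \sum_(j | T j < T i) v j.
    rewrite -[X in X * `|_|]ger0_norm ?divr_ge0// -normrM diff.
    apply: le_trans (ler_normB _ _) _; rewrite normrN lerD2l mulr_sumr.
    apply: le_trans (ler_norm_sum _ _ _) _; apply: ler_sum => j lt_j.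
    rewrite /v (ltW (lt_le_trans lt_j le_t)) mulr1 !normrM.
    by rewrite (ger0_norm (_ : 0 <= n%:R^-1)) ?invr_ge0// (ger0_norm (_ : 0 <= (delta j)%:R)).
  apply: le_trans; rewrite ler_wpM2r//.
  by rewrite ler_pdivlMr.
move=> /(_ _ key); rewrite card_ord => /(_ _)/le_trans; apply.
  by move=> i; rewrite mulr_ge0.
rewrite -mulr_sumr /q mulrA.
apply: ler_wpM2l.
  by rewrite mulr_ge0 ?sumr_ge0// divr_ge0 ?invr_ge0// ltW.
(* The Gronwall factor (1 + q)^n is at most exp(n q), and n q = b^-1 is free of n. *)
rewrite -[X in expR X](_ : n%:R * q = _).
  rewrite expRM_natl; apply: lerXn2r; rewrite ?nnegrE ?expR_ge0 ?addr_ge0//.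
  exact: expR_ge1Dx.
by rewrite /q mulrC divfK// gt_eqF.
Qed.

End deterministic_bound.

Section wlln.
Context (d0 d1 : measure_display) (Omega : measurableType d0)
  (S : measurableType d1) (R : realType) (P : probability Omega R)
  (Z : nat -> Omega -> S) (Z0 : Omega -> S) (iidZ : iid_copies P Z Z0).

Let mZ i : measurable_fun setT (Z i). Proof. by have [] := iidZ. Qed.

Lemma near_ge_divn (K e : R) : 0 < e -> \forall n \near \oo, K / n%:R <= e :> R.
Proof.
move=> e0; near=> n.
have n0 : 0 < n%:R :> R by rewrite ltr0n; near: n; exact: nbhs_infty_gt.
rewrite ler_pdivrMr// mulrC -ler_pdivrMr//; near: n.
exact: nbhs_infty_ger.
Unshelve. all: by end_near. Qed.

Lemma Rintegral_iid (i j : nat) (h : S -> R) (K : R) : measurable_fun setT h ->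
  (forall x, `|h x| <= K) -> \int[P]_w h (Z i w) = \int[P]_w h (Z j w).
Proof.
move=> mh hK.
have bi k : P.-integrable setT (fun w => (h (Z k w))%:E).
  by apply: (bounded_integrable P (K := K)) => [|w//]; exact: (measurableT_comp mh (mZ k)).
have shift k : \int[P]_w h (Z k w) = fine (\int[P]_w (h (Z k w) + K)%:E)%E - K.
  under [in RHS]eq_integral do rewrite EFinD.
  have iK : P.-integrable setT (EFin \o cst K).
    by apply: (bounded_integrable P (K := `|K|)).
  rewrite integralD// integral_prob_cst fineD//= ?addrK//.
  exact: integrable_fin_num.
rewrite (shift i) (shift j); congr (fine _ - _).
apply: (integral_iid iidZ i j (g := fun x => (h x + K)%:E)).
  by apply/measurable_EFinP; exact: measurable_funD.
move=> x; rewrite lee_fin -lerBlDr sub0r lerNl; apply: le_trans (hK x).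
by rewrite -normrN ler_norm.
Qed.

(** Chebyshev's inequality, with the bound of [second_moment_le] for a kernel that ignores its first
    argument. *)
Lemma wlln (h : S -> R) (K e p : R) : measurable_fun setT h ->
  (forall x, `|h x| <= K) -> 0 < e -> 0 < p ->
  evp P (fun n => [set w | `|n%:R^-1 * \sum_(i < n) h (Z i w) -
                            \int[P]_w h (Z 0%N w)| <= e]) p.
Proof.
move=> mh hK e0 p0; set m := \int[P]_w h (Z 0%N w).
pose zeta (x : S * S) := h x.2 - m.
have mz : measurable_fun setT zeta.
  by apply: measurable_funB => //; exact: (measurableT_comp mh measurable_snd).
have zK x : `|zeta x| <= K + `|m|.
  by apply: le_trans (ler_normB _ _) _; rewrite lerD2r.
have z0 s k : \int[P]_w zeta (s, Z k w) = 0.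
  rewrite /zeta /= RintegralB//.
  - rewrite (Rintegral_iid k 0 mh hK) -/m Rintegral_cst//.
    apply/eqP; rewrite subr_eq0; apply/eqP; rewrite -[LHS]mulr1; congr (_ * _).
    by rewrite -[LHS]/(fine 1%E); congr fine; apply/esym; exact: probability_setT.
  - by apply: (bounded_integrable P (K := K)) => [|w//]; exact: (measurableT_comp mh (mZ k)).
  - by apply: (bounded_integrable P (K := `|m|)).
pose V n w := (n%:R^-1 * \sum_(j < n) zeta (Z 0%N w, Z j w)) ^+ 2.
have mV n : measurable_fun setT (V n).
  apply: measurable_funX; apply: measurable_funM => //.
  by apply: measurable_sum => j; exact: (measurableT_comp mz (measurable_fun_pair (mZ 0%N) (mZ j))).
have IV n : (0 < n)%N -> (\int[P]_w (V n w)%:E <= ((3 * (K + `|m|) ^+ 2) / n%:R)%:E)%E.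
  move=> n0; have nR : 0 < n%:R :> R by rewrite ltr0n.
  rewrite (_ : (fun w => (V n w)%:E) = fun w => ((n%:R^-1 ^+ 2)%:E * ((\sum_(j < n) zeta (Z 0%N w, Z j w)) ^+ 2)%:E)%E); last first.
    by apply/funext => w; rewrite /V exprMn EFinM.
  rewrite ge0_integralZl//.
  2: apply/measurable_EFinP; apply: measurable_funX.
  2: by apply: measurable_sum => j; exact: (measurableT_comp mz (measurable_fun_pair (mZ 0%N) (mZ j))).
  2: by move=> w _; rewrite lee_fin sqr_ge0.
  apply: le_trans (lee_wpmul2l _ (second_moment_le iidZ 0 n mz zK z0)) _.
    by rewrite lee_fin sqr_ge0.
  by rewrite -EFinM lee_fin le_eqVlt; apply/orP; left; apply/eqP; field; rewrite gt_eqF.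
near=> n.
have n0 : (0 < n)%N by near: n; exact: nbhs_infty_gt.
have nR : 0 < n%:R :> R by rewrite ltr0n.
apply: le_trans (_ : mu_ext P [set w | (e ^+ 2 < V n w)%R] <= _)%E.
  apply: le_mu_ext => w /= /negP; rewrite -ltNge => lt.
  rewrite /V -[ltRHS]real_normK ?num_real// ltr_pXn2r ?nnegrE// ?(ltW e0)//.
  suff -> : n%:R^-1 * \sum_(j < n) zeta (Z 0%N w, Z j w) =
    n%:R^-1 * \sum_(i < n) h (Z i w) - m by rewrite lt.
  by rewrite /zeta /= sumrB sumr_const card_ord mulrBr -[m *+ n]mulr_natl mulKf// gt_eqF.
apply: le_trans (markov_mu_ext (mV n) _ (IV n n0) _) _.
- by move=> w; rewrite sqr_ge0.
- by rewrite exprn_gt0.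
rewrite lee_fin mulrAC; near: n.
exact: near_ge_divn.
Unshelve. all: by end_near. Qed.

End wlln.

Lemma measurable_section_prob (d0 d1 : measure_display)
    (Omega : measurableType d0) (S : measurableType d1) (R : realType)
    (P : probability Omega R) (p : S -> Omega -> bool) :
  measurable_fun setT (fun x : S * Omega => p x.1 x.2) ->
  measurable_fun setT (fun t => fine (\int[P]_w ((p t w)%:R)%:E)%E).
Proof.
move=> mp; apply: measurableT_comp => //.
apply: (@measurable_fun_fubini_tonelli_F _ _ _ _ _ P (fun x : S * Omega => ((p x.1 x.2)%:R)%:E)).
  by apply/measurable_EFinP; exact: measurable_bool_natr.
by move=> x; rewrite lee_fin.
Qed.

(** * Kaplan-Meier integrals of a censored i.i.d. sample *)

Section censored_sample.
Context (d0 : measure_display) (Omega : measurableType d0) (R : realType)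
  (P : probability Omega R) (d : nat) (Y C : Omega -> R)
  (X : Omega -> 'rV[R]_d) (mY : measurable_fun setT Y)
  (mC : measurable_fun setT C) (mX : measurable_fun setT X).

Let T w := Num.min (Y w) (C w).
Let delta w := Y w <= C w.

Context (Z : nat -> Omega -> obs R d)
  (iidZ : iid_copies P Z (fun w => (T w, delta w, X w) : obs R d))
  (YC_indep : independent2 P Y C)
  (delta_cond : exists q : R -> R,
     is_cond_expect P Y (fun w => (delta w)%:R) q /\
     is_cond_expect P (fun w => (X w, Y w)) (fun w => (delta w)%:R)
       (fun xy => q xy.2))
  (endpoint : right_endpoint P Y = right_endpoint P T)
  (endpoint_atom : forall t : R, right_endpoint P Y = t%:E ->
     (0 < P [set w | Y w = t])%E -> (0 < P [set w | T w = t])%E)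
  (YC_neq : P [set w | Y w = C w] = 0%E).

Let mZ i : measurable_fun setT (Z i). Proof. by have [] := iidZ. Qed.

Let mT : measurable_fun setT T. Proof. exact: measurable_cens_time. Qed.

Let mdelta : measurable_fun setT delta. Proof. exact: measurable_cens_ind. Qed.

Let mobs : measurable_fun setT (fun w => (T w, delta w, X w) : obs R d).
Proof. by apply: measurable_fun_pair => //; exact: measurable_fun_pair. Qed.

Lemma integral_obs (i : nat) (g : obs R d -> \bar R) : measurable_fun setT g ->
  (forall x, 0 <= g x)%E ->
  (\int[P]_w g (Z i w) = \int[P]_w g (T w, delta w, X w))%E.
Proof.
move=> mg g0; rewrite -(integral_law P (mZ i))// -(integral_law P mobs)//.
by apply: eq_measure_integral => A mA _; have [_ idZ _] := iidZ; exact: idZ.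
Qed.

Let weight (t : R) := (surv P C t)^-1.

Let weight_ge0 t : 0 <= weight t. Proof. by rewrite invr_ge0 surv_ge0. Qed.

Let mweight : measurable_fun setT weight.
Proof. by apply: measurable_inv_ge0; [exact: surv_ge0 | exact: measurable_surv]. Qed.

Lemma measurable_weighted (g : 'rV[R]_d -> R -> R) :
  measurable_fun setT (fun x : 'rV[R]_d * R => g x.1 x.2) ->
  measurable_fun setT (fun o : obs R d => (obs_uncens o)%:R *
    (weight (obs_time o) * g (obs_cov o) (obs_time o))).
Proof.
move=> mg; apply: measurable_funM.
  exact: (measurable_bool_natr (@measurable_obs_uncens R d)).
apply: measurable_funM.
  exact: (measurableT_comp mweight (@measurable_obs_time R d)).
exact: (measurableT_comp mg (measurable_fun_pair (@measurable_obs_cov R d) (@measurable_obs_time R d))).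
Qed.

Lemma integral_weighted (i : nat) (g : 'rV[R]_d -> R -> R) :
  measurable_fun setT (fun x : 'rV[R]_d * R => g x.1 x.2) ->
  (forall x y, 0 <= g x y) ->
  (\int[P]_w ((obs_uncens (Z i w))%:R * (weight (obs_time (Z i w)) *
      g (obs_cov (Z i w)) (obs_time (Z i w))))%:E =
   \int[P]_w (g (X w) (Y w))%:E)%E.
Proof.
move=> mg g0; rewrite (integral_obs i (g := fun o => ((obs_uncens o)%:R *
    (weight (obs_time o) * g (obs_cov o) (obs_time o)))%:E)); last 2 first.
- by apply/measurable_EFinP; exact: measurable_weighted.
- by move=> o; rewrite lee_fin !mulr_ge0.
by rewrite -(integral_cens mY mC mX YC_indep delta_cond endpoint endpoint_atom (g := fun x => g x.1 x.2)).
Qed.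

(** For i != j, freeze an uncensored Z_i, with time t = Y_i. A censored T_j = t forces C_j = t, of
    probability P(C = t). Averaging over the uncensored Y_i gives at most the mean of P(C = y) under
    the law of Y, which is P(Y = C) = 0 by independence of Y and C. *)
Lemma ae_noties : {ae P, forall w, forall i j,
  obs_time (Z i w) = obs_time (Z j w) -> obs_uncens (Z i w) = obs_uncens (Z j w)}.
Proof.
pose bad (i j : nat) w := [&& obs_time (Z i w) == obs_time (Z j w), obs_uncens (Z i w)
  & ~~ obs_uncens (Z j w)].
suff bad0 i j : P.-negligible [set w | bad i j w].
  have : {ae P, forall w, forall i j, ~ bad i j w}.
    apply: ae_foralln => i; apply: ae_foralln => j.
    by apply: negligibleS (bad0 i j) => w /= /contrapT.
  apply: filterS => w nb i j eT; have := nb i j; have := nb j i.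
  by rewrite /bad eT eqxx; case: obs_uncens; case: obs_uncens => //= _ /(_ isT).
have mTi k : measurable_fun setT (fun w => obs_time (Z k w)).
  exact: (measurableT_comp (@measurable_obs_time R d) (mZ k)).
have mdi k : measurable_fun setT (fun w => obs_uncens (Z k w)).
  exact: (measurableT_comp (@measurable_obs_uncens R d) (mZ k)).
have mbad : measurable_fun setT (bad i j).
  apply: measurable_and; first exact: measurable_fun_eqr.
  by apply: measurable_and => //; exact: measurable_neg.
have [<-|ij] := eqVneq i j.
  rewrite (_ : mkset _ = set0); first exact: negligible_set0.
  by apply/seteqP; split=> w //=; rewrite /bad; case: obs_uncens; rewrite ?andbF.
exists [set w | bad i j w]; split => //; first exact: measurable_pred_set.
rewrite -integral_bool//.
pose g (x : 1.-tuple (obs R d) * obs R d) : R := (obs_uncens (tnth x.1 ord0))%:R *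
  ((obs_time (tnth x.1 ord0) == obs_time x.2) && ~~ obs_uncens x.2)%:R.
have mt0 : measurable_fun setT (fun x : 1.-tuple (obs R d) * obs R d => tnth x.1 ord0).
  exact: (measurableT_comp (measurable_tnth ord0) measurable_fst).
have mg : measurable_fun setT g.
  apply: measurable_funM.
    exact: (measurable_bool_natr (measurableT_comp (@measurable_obs_uncens R d) mt0)).
  apply: measurable_bool_natr; apply: measurable_and.
    apply: measurable_fun_eqr.
      exact: (measurableT_comp (@measurable_obs_time R d) mt0).
    exact: (measurableT_comp (@measurable_obs_time R d) measurable_snd).
  apply: measurable_neg.
  exact: (measurableT_comp (@measurable_obs_uncens R d) measurable_snd).
have us : uniq [tuple i] by [].
have js : j \notin ([tuple i] : seq nat) by rewrite inE eq_sym.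
transitivity (\int[P]_w (EFin \o g) (subsample Z [tuple i] w, Z j w))%E.
  apply: eq_integral => w _; rewrite /g /bad /= tnth_mktuple (tnth_nth 0%N) /=.
  by case: obs_uncens; rewrite ?mul1r ?mul0r ?andbF//=; case: (_ == _).
rewrite (integral_indep (measurable_subsample iidZ [tuple i]) (mZ j) (subsample_indep iidZ us js)); last 2 first.
- exact/measurable_EFinP.
- by move=> x; rewrite lee_fin mulr_ge0.
pose pC t := fine (\int[P]_w ((C w == t)%R%:R)%:E)%E.
pose pT t := fine (\int[P]_w (((T w == t) && ~~ delta w)%R%:R)%:E)%E.
have mTt t : measurable_fun setT (fun w => (T w == t) && ~~ delta w).
  by apply: measurable_and; [exact: measurable_fun_eqr | exact: measurable_neg].
have mCt t : measurable_fun setT (fun w => C w == t) by exact: measurable_fun_eqr.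
have pCE t : (pC t)%:E = (\int[P]_w ((C w == t)%R%:R)%:E)%E.
  by rewrite /pC integral_bool// fineK//; apply: fin_num_measure; exact: measurable_pred_set.
have pTE t : (pT t)%:E = (\int[P]_w (((T w == t) && ~~ delta w)%R%:R)%:E)%E.
  by rewrite /pT integral_bool// fineK//; apply: fin_num_measure; exact: measurable_pred_set.
have mpC : measurable_fun setT pC.
  apply: (measurable_section_prob P (p := fun t w => C w == t)).
  by apply: measurable_fun_eqr => //; exact: (measurableT_comp mC measurable_snd).
have mpT : measurable_fun setT pT.
  apply: (measurable_section_prob P (p := fun t w => (T w == t) && ~~ delta w)).
  apply: measurable_and.
    by apply: measurable_fun_eqr => //; exact: (measurableT_comp mT measurable_snd).
  by apply: measurable_neg; exact: (measurableT_comp mdelta measurable_snd).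
have pT0 t : 0 <= pT t by apply: fine_ge0; apply: integral_ge0 => w _; rewrite lee_fin.
have pTC t : pT t <= pC t.
  rewrite -lee_fin pCE pTE; apply: ge0_le_integral => //.
  - by apply/measurable_EFinP; exact: measurable_bool_natr.
  - by apply/measurable_EFinP; exact: measurable_bool_natr.
  move=> w _; rewrite lee_fin ler_nat /T /delta; case: (leP (Y w) (C w)) => YC; rewrite ?andbF//=.
  by rewrite andbT.
rewrite (eq_integral (fun w => ((obs_uncens (Z i w))%:R * pT (obs_time (Z i w)))%:E)); last first.
  move=> w _; rewrite /g /= tnth_mktuple (tnth_nth 0%N) /=.
  under eq_integral do rewrite EFinM.
  rewrite ge0_integralZl//.
  - rewrite (integral_obs j (g := fun o => (((obs_time (Z i w) == obs_time o) && ~~ obs_uncens o)%R%:R)%:E)) //.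
    + by rewrite EFinM pTE; congr (_ * _)%E; apply: eq_integral => w' _; rewrite eq_sym.
    + apply/measurable_EFinP; apply: measurable_bool_natr; apply: measurable_and.
        by apply: measurable_fun_eqr => //; exact: measurable_obs_time.
      by apply: measurable_neg; exact: measurable_obs_uncens.
  - apply/measurable_EFinP; apply: measurable_bool_natr; apply: measurable_and.
      exact: measurable_fun_eqr.
    exact: measurable_neg.
rewrite (integral_obs i (g := fun o => ((obs_uncens o)%:R * pT (obs_time o))%:E)); last 2 first.
- apply/measurable_EFinP; apply: measurable_funM.
    exact: (measurable_bool_natr (@measurable_obs_uncens R d)).
  exact: (measurableT_comp mpT (@measurable_obs_time R d)).
- by move=> o; rewrite lee_fin mulr_ge0.
apply/eqP; rewrite eq_le integral_ge0 ?andbT; last first.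
  by move=> w _; rewrite lee_fin mulr_ge0.
apply: (@le_trans _ _ (\int[P]_w (pC (Y w))%:E)%E); last first.
  under eq_integral do rewrite pCE.
  have mh : measurable_fun setT (fun x : R * R => ((x.2 == x.1)%R%:R)%:E : \bar R).
    by apply/measurable_EFinP; apply: measurable_bool_natr; exact: measurable_fun_eqr.
  rewrite -(integral_indep mY mC YC_indep mh) => [|x]; last by rewrite lee_fin.
  rewrite /= integral_bool; last exact: measurable_fun_eqr.
  rewrite le_eqVlt -YC_neq; apply/orP; left; apply/eqP; congr (P _).
  by apply/seteqP; split=> w /= => [/eqP ->|->].
apply: ge0_le_integral.
- exact: measurableT.
- by move=> w _; rewrite lee_fin mulr_ge0.
- apply/measurable_EFinP; apply: measurable_funM; first exact: measurable_bool_natr.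
  exact: measurableT_comp.
- by apply/measurable_EFinP; exact: measurableT_comp.
move=> w _; rewrite lee_fin /T /delta; case: (leP (Y w) (C w)) => YC; rewrite ?mul0r ?mul1r//.
exact: le_trans (pT0 _) (pTC _).
Qed.

Let km (n : nat) (phi : 'rV[R]_d -> R -> R) (w : Omega) : R :=
  km_integral (fun i : 'I_n => Z i w) phi.

(** The summand of [km_inv_dev_le] for a = [weight], as a kernel in the observations i and j. *)
Let zeta (t0 : R) (x : obs R d * obs R d) : R :=
  (obs_time x.1 <= t0)%R%:R * (weight (obs_time x.1) *
    (obs_time x.1 <= obs_time x.2)%R%:R + (obs_uncens x.2)%:R *
    weight (obs_time x.2) * (obs_time x.2 < obs_time x.1)%R%:R - 1).

Let weight_le (t0 t : R) : 0 < surv P T t0 -> t <= t0 ->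
  0 < surv P C t /\ weight t <= (surv P T t0)^-1.
Proof.
move=> k0 le_t.
have le1 : surv P T t0 <= surv P C t.
  apply: (@le_trans _ _ (surv P C t0)); last exact: le_surv.
  by rewrite (surv_cens_time mY mC YC_indep) ler_piMl ?surv_ge0// surv_le1.
have C0 : 0 < surv P C t by exact: lt_le_trans le1.
by split=> //; rewrite lef_pV2 ?posrE.
Qed.

Let mzeta t0 : measurable_fun setT (zeta t0).
Proof.
have m1 := measurableT_comp (@measurable_obs_time R d) (@measurable_fst _ _ (obs R d) (obs R d)).
have m2 := measurableT_comp (@measurable_obs_time R d) (@measurable_snd _ _ (obs R d) (obs R d)).
apply: measurable_funM.
  by apply: measurable_bool_natr; exact: measurable_fun_ler.
apply: measurable_funB => //; apply: measurable_funD; apply: measurable_funM.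
- exact: (measurableT_comp mweight m1).
- by apply: measurable_bool_natr; exact: measurable_fun_ler.
- apply: measurable_funM; last exact: (measurableT_comp mweight m2).
  exact: (measurable_bool_natr (measurableT_comp (@measurable_obs_uncens R d) (@measurable_snd _ _ (obs R d) (obs R d)))).
- by apply: measurable_bool_natr; exact: measurable_fun_ltr.
Qed.

Let zeta_le t0 x : 0 < surv P T t0 -> `|zeta t0 x| <= (surv P T t0)^-1.
Proof.
move=> k0; have K1 : 1 <= (surv P T t0)^-1.
  by rewrite invf_ge1 ?surv_le1.
rewrite /zeta; have [le_t|_] := leP (obs_time x.1) t0; last first.
  by rewrite mul0r normr0 invr_ge0 surv_ge0.
have [_ w1] := weight_le k0 le_t; have w10 := weight_ge0 (obs_time x.1).
have w20 := weight_ge0 (obs_time x.2).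
rewrite mul1r; have [le12|lt21] := leP (obs_time x.1) (obs_time x.2).
  by rewrite mulr1 mulr0 addr0 ler_norml; apply/andP; split; lra.
have [_ w2] := weight_le k0 (le_trans (ltW lt21) le_t).
rewrite mulr0 add0r mulr1 ler_norml; apply/andP.
by case: obs_uncens; rewrite ?mul1r ?mul0r; split; lra.
Qed.

(** For T_i = t <= t0 the mean is P(T >= t) / P(C >= t) + P(Y < t) - 1, and the first term is P(Y >=
    t) by independence: this is the population Volterra equation. *)
Let zeta_mean t0 : 0 < surv P T t0 ->
  forall s k, \int[P]_w zeta t0 (s, Z k w) = 0.
Proof.
move=> k0 s k; rewrite /zeta /=; set t := obs_time s.
have [le_t|_] := leP t t0; last first.
  under eq_Rintegral do rewrite mul0r.
  by rewrite Rintegral_cst// mul0r.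
under eq_Rintegral do rewrite mul1r.
have [C0 w1] := weight_le k0 le_t.
have mTk : measurable_fun setT (fun w => obs_time (Z k w)).
  exact: (measurableT_comp (@measurable_obs_time R d) (mZ k)).
have mdk : measurable_fun setT (fun w => obs_uncens (Z k w)).
  exact: (measurableT_comp (@measurable_obs_uncens R d) (mZ k)).
have i1 : P.-integrable setT (fun w => ((t <= obs_time (Z k w))%R%:R)%:E).
  apply: (bounded_integrable P (K := 1)).
    by apply: measurable_bool_natr; exact: measurable_fun_ler.
  by move=> w; rewrite ger0_norm// lern1 leq_b1.
have i1' : P.-integrable setT (fun w => (weight t * (t <= obs_time (Z k w))%R%:R)%:E).
  under eq_fun do rewrite EFinM.
  exact: integrableZl.
have i2 : P.-integrable setT (fun w => ((obs_uncens (Z k w))%:R * weight (obs_time (Z k w)) *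
     (obs_time (Z k w) < t)%R%:R)%:E).
  apply: (bounded_integrable P (K := (surv P T t0)^-1)).
    apply: measurable_funM; last by apply: measurable_bool_natr; exact: measurable_fun_ltr.
    apply: measurable_funM; first exact: measurable_bool_natr.
    exact: (measurableT_comp mweight mTk).
  move=> w; rewrite ger0_norm ?mulr_ge0//.
  have [lt_t|_] := ltP; last by rewrite mulr0 invr_ge0 surv_ge0.
  have [_ w2] := weight_le k0 (le_trans (ltW lt_t) le_t).
  by rewrite mulr1; case: obs_uncens; rewrite ?mul1r// mul0r invr_ge0 surv_ge0.
have i3 : P.-integrable setT (EFin \o fun=> 1 : R).
  by apply: (bounded_integrable P (K := 1)) => // w; rewrite normr1.
rewrite RintegralB//; last first.
  exact: (integrableD measurableT i1' i2).
rewrite RintegralD// RintegralZl//.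
have -> : \int[P]_w (t <= obs_time (Z k w))%R%:R = surv P T t.
  rewrite -[RHS]/(fine (surv P T t)%:E) surv_integral//; congr fine.
  rewrite (integral_obs k (g := fun o => ((t <= obs_time o)%R%:R)%:E))//.
  by apply/measurable_EFinP; apply: measurable_bool_natr; apply: measurable_fun_ler => //; exact: measurable_obs_time.
have -> : \int[P]_w ((obs_uncens (Z k w))%:R * weight (obs_time (Z k w)) *
     (obs_time (Z k w) < t)%R%:R) = 1 - surv P Y t.
  transitivity (fine (\int[P]_w ((Y w < t)%R%:R)%:E)%E).
    congr fine; rewrite -(integral_weighted k (g := fun _ y => (y < t)%R%:R))//.
      by apply: eq_integral => w _; rewrite mulrA.
    by apply: measurable_bool_natr; apply: measurable_fun_ltr.
  rewrite integral_bool; last exact: measurable_fun_ltr.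
  have -> : [set w | Y w < t] = ~` [set w | t <= Y w].
    by apply/seteqP; split=> w /=; rewrite ltNge => /negP.
  rewrite probability_setC; last by apply: measurable_pred_set; exact: measurable_fun_ler.
  by rewrite -survE.
rewrite Rintegral_cst// (surv_cens_time mY mC YC_indep) /weight.
have -> : fine (P setT) = 1 by rewrite -[RHS]/(fine 1%E); congr fine; exact: probability_setT.
rewrite mulrCA mulVf ?gt_eqF//; ring.
Qed.

Lemma km_trunc_consistency (phi : 'rV[R]_d -> R -> R) (M t0 e p : R) :
  measurable_fun setT (fun x : 'rV[R]_d * R => phi x.1 x.2) ->
  (forall x y, 0 <= phi x y <= M) -> (forall x y, t0 < y -> phi x y = 0) ->
  0 < surv P T t0 -> 0 < e -> 0 < p ->
  evp P (fun n => [set w | `|km n phi w - \int[P]_w phi (X w) (Y w)| <= e]) p.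
Proof.
move=> mphi phiM phi0 k0 e0 p0; set kappa := surv P T t0 in k0.
have M0 : 0 <= M by have /andP[] := phiM 0 0; exact: le_trans.
(* Chosen so that [km_inv_dev_le] with b = kappa / 2, its mean of absolute values being at most eta,
   costs at most e / 2 on functions bounded by M; M + 1 avoids dividing by 0. *)
pose eta := e / 2 / (((kappa / 2)^-1) * expR ((kappa / 2)^-1) * (M + 1)).
have k2 : 0 < kappa / 2 by rewrite divr_gt0.
have eta0 : 0 < eta.
  by rewrite !divr_gt0// !mulr_gt0 ?invr_gt0 ?expR_gt0// ltr_wpDl.
pose h1 (o : obs R d) : R := (t0 <= obs_time o)%R%:R.
pose h2 (o : obs R d) : R := (obs_uncens o)%:R *
    (weight (obs_time o) * phi (obs_cov o) (obs_time o)).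
have mh1 : measurable_fun setT h1.
  by apply: measurable_bool_natr; apply: measurable_fun_ler => //; exact: measurable_obs_time.
have mh2 : measurable_fun setT h2 by exact: measurable_weighted.
have h1K o : `|h1 o| <= 1 by rewrite /h1 ger0_norm// lern1 leq_b1.
have h2K o : `|h2 o| <= kappa^-1 * M.
  have /andP[p1 p2] := phiM (obs_cov o) (obs_time o).
  rewrite /h2 ger0_norm ?mulr_ge0//; have KM : 0 <= kappa^-1 * M by rewrite mulr_ge0// invr_ge0 ltW.
  have [le_t|gt_t] := leP (obs_time o) t0; last by rewrite phi0// !mulr0.
  have [_ w2] := weight_le k0 le_t.
  by case: obs_uncens; rewrite /= ?mul0r// mul1r ler_pM.
have ev1 : evp P (fun n => [set w | forall i j : 'I_n,
  obs_time (Z i w) = obs_time (Z j w) -> obs_uncens (Z i w) = obs_uncens (Z j w)]) 0.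
  by apply: evp_ae => n; apply: filterS ae_noties => w h i j; exact: h.
have p3 : 0 < p / 3 by rewrite divr_gt0.
have ev2 := wlln iidZ mh1 h1K k2 p3.
have mean1 : \int[P]_w h1 (Z 0%N w) = kappa.
  rewrite -[RHS]/(fine (surv P T t0)%:E) surv_integral//; congr fine.
  rewrite (integral_obs 0%N (g := fun o => (h1 o)%:E))//.
    exact/measurable_EFinP.
  by move=> o; rewrite lee_fin.
have e2 : 0 < e / 2 by rewrite divr_gt0.
have ev3 := wlln iidZ mh2 h2K e2 p3.
have mean2 : \int[P]_w h2 (Z 0%N w) = \int[P]_w phi (X w) (Y w).
  congr fine; rewrite -(integral_weighted 0%N (g := phi))//.
  by move=> x y; have /andP[] := phiM x y.
rewrite mean1 in ev2; rewrite mean2 in ev3.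
pose V n w := n%:R^-1 * \sum_(i < n) (n%:R^-1 * \sum_(j < n) zeta t0 (Z i w, Z j w)) ^+ 2.
have mVi n i : measurable_fun setT (fun w => (\sum_(j < n) zeta t0 (Z i w, Z j w)) ^+ 2).
  apply: measurable_funX; apply: measurable_sum => j.
  exact: (measurableT_comp (mzeta t0) (measurable_fun_pair (mZ i) (mZ j))).
have VE n w : V n w = n%:R^-1 ^+ 3 * \sum_(i < n) (\sum_(j < n) zeta t0 (Z i w, Z j w)) ^+ 2.
  by rewrite /V exprS -mulrA; congr (_ * _); rewrite mulr_sumr; apply: eq_bigr => i _; rewrite exprMn.
have mV n : measurable_fun setT (V n).
  rewrite (funext (VE n)).
  by apply: measurable_funM => //; apply: measurable_sum => i.
have IV n : (0 < n)%N -> (\int[P]_w (V n w)%:E <= ((3 * kappa^-1 ^+ 2) / n%:R)%:E)%E.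
  move=> n0; have nR : 0 < n%:R :> R by rewrite ltr0n.
  under eq_integral do rewrite VE EFinM -sumEFin.
  rewrite ge0_integralZl//.
  2: by apply: emeasurable_sum => i; exact/measurable_EFinP.
  2: by move=> w _; apply: sume_ge0 => i _; rewrite lee_fin sqr_ge0.
  rewrite ge0_integral_sum//.
  2: by move=> i; exact/measurable_EFinP.
  2: by move=> i w _; rewrite lee_fin sqr_ge0.
  apply: (@le_trans _ _ ((n%:R^-1 ^+ 3)%:E * \sum_(i < n) (3 * n%:R * kappa^-1 ^+ 2)%:E))%E.
    apply: lee_wpmul2l; first by rewrite lee_fin exprn_ge0// invr_ge0.
    apply: lee_sum => i _; apply: (second_moment_le iidZ i n (mzeta t0)).
      by move=> x; exact: zeta_le.
    exact: zeta_mean.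
  rewrite sumEFin sumr_const card_ord -EFinM lee_fin -mulr_natl le_eqVlt.
  by apply/orP; left; apply/eqP; field; rewrite ?gt_eqF.
have ev4 : evp P (fun n => [set w | V n w <= eta ^+ 2]) (p / 3).
  near=> n; have n0 : (0 < n)%N by near: n; exact: nbhs_infty_gt.
  apply: (@le_trans _ _ (mu_ext P [set w | (eta ^+ 2 < V n w)%R])).
    by apply: le_mu_ext => w /= /negP; rewrite -ltNge.
  apply: le_trans (markov_mu_ext (mV n) _ (IV n n0) _) _.
  - move=> w; rewrite /V mulr_ge0 ?invr_ge0// sumr_ge0// => i _; exact: sqr_ge0.
  - by rewrite exprn_gt0.
  rewrite lee_fin mulrAC; near: n; exact: near_ge_divn.
have pE : p = 0 + p / 3 + p / 3 + p / 3 by field.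
rewrite pE; apply: (evpI (evpI (evpI ev1 ev2 _) ev3 _) ev4).
- by apply: nearW => n w h; exact: h.
- by apply: nearW => n w h; exact: h.
near=> n => w /= [[[noties r1] s1] v1].
have n0 : (0 < n)%N by near: n; exact: nbhs_infty_gt.
have nR : 0 < n%:R :> R by rewrite ltr0n.
pose Tn (i : 'I_n) := obs_time (Z i w); pose dn (i : 'I_n) := obs_uncens (Z i w).
have rk : kappa / 2 * n%:R <= (at_risk Tn [set: 'I_n]%SET t0)%:R.
  have -> : (at_risk Tn [set: 'I_n]%SET t0)%:R = \sum_(i < n) h1 (Z i w).
    rewrite /at_risk -sum1_card natr_sum big_mkcond; apply: eq_bigr => i _.
    by rewrite !inE /h1 /Tn; case: (_ <= _).
  rewrite -ler_pdivlMr// [leRHS]mulrC.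
  by move: r1; rewrite ler_norml => /andP[r1 _]; lra.
have := km_inv_dev_le weight n0 noties k2 rk.
set D := \sum_i _ => Dle.
have {Dle} DM : D * M <= e / 2.
  apply: (@le_trans _ _ (((kappa / 2)^-1 * eta * expR ((kappa / 2)^-1)) * M)).
    rewrite ler_wpM2r//; apply: le_trans Dle _.
    rewrite ler_wpM2r ?expR_ge0// ler_wpM2l ?invr_ge0 ?(ltW k2)//.
    pose xi (i : 'I_n) := n%:R^-1 * \sum_(j < n) zeta t0 (Z i w, Z j w).
    (* Second moments control the mean square [V n w], while a mean absolute value is needed:
       Young's inequality |x| <= eta / 2 + x^2 / (2 eta) turns V <= eta^2 into the bound eta. *)
    apply: (@le_trans _ _ (n%:R^-1 * \sum_(i < n) (eta / 2 + (2 * eta)^-1 * xi i ^+ 2))).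
      rewrite ler_wpM2l ?invr_ge0//; apply: ler_sum => i _.
      change (`|xi i| <= eta / 2 + (2 * eta)^-1 * xi i ^+ 2).
      rewrite -real_normK ?num_real//; set x := `|xi i|.
      have -> : eta / 2 + (2 * eta)^-1 * x ^+ 2 = x + (x - eta) ^+ 2 / (2 * eta).
        by field; rewrite ?gt_eqF.
      by rewrite lerDl divr_ge0 ?sqr_ge0// mulr_ge0// ltW.
    rewrite big_split /= sumr_const card_ord -mulr_sumr mulrDr -(mulr_natl (eta / 2)).
    rewrite mulKf ?gt_eqF// mulrCA -/(V n w).
    apply: (@le_trans _ _ (eta / 2 + (2 * eta)^-1 * eta ^+ 2)).
      by rewrite lerD2l ler_wpM2l// invr_ge0 mulr_ge0// ltW.
    by rewrite le_eqVlt; apply/orP; left; apply/eqP; field; rewrite ?gt_eqF.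
  rewrite mulrAC /eta; set E := expR _; have E0 : 0 < E by exact: expR_gt0.
  have -> : (kappa / 2)^-1 * (e / 2 / ((kappa / 2)^-1 * E * (M + 1))) * M * E =
     e / 2 * (M / (M + 1)).
    by field; rewrite ?gt_eqF// ltr_wpDl.
  by rewrite ler_piMr ?(ltW e2)// ler_pdivrMr ?ltr_wpDl// mul1r lerDl.
have dev : `|km n phi w - n%:R^-1 * \sum_(i < n) h2 (Z i w)| <= D * M.
  rewrite /km /km_integral mulr_sumr -sumrB.
  apply: le_trans (ler_norm_sum _ _ _) _; rewrite /D mulr_suml; apply: ler_sum => i _.
  rewrite km_weightE -/(Tn i) -/(dn i) /h2.
  set A := km_inv _ _ _ _.
  have /andP[f0 fM] := phiM (obs_cov (Z i w)) (Tn i).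
  have -> : n%:R^-1 * ((dn i)%:R * A) * phi (obs_cov (Z i w)) (Tn i) -
     n%:R^-1 * ((dn i)%:R * (weight (Tn i) * phi (obs_cov (Z i w)) (Tn i))) =
     n%:R^-1 * (dn i)%:R * (A - weight (Tn i)) * phi (obs_cov (Z i w)) (Tn i) by ring.
  rewrite !normrM (ger0_norm f0) (ger0_norm (_ : 0 <= n%:R^-1)) ?invr_ge0//.
  rewrite (ger0_norm (_ : 0 <= (dn i)%:R))// -!mulrA ler_wpM2l ?invr_ge0// ler_wpM2l//.
  have [le_t|gt_t] := leP (Tn i) t0; last by rewrite phi0// mulr0 mul0r.
  by rewrite mul1r ler_wpM2l.
have := lerD dev s1 => /(le_trans (ler_normD _ _)).
rewrite addrA subrK => /le_trans; apply; lra.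
Unshelve. all: by end_near. Qed.

Lemma measurable_km n (phi : 'rV[R]_d -> R -> R) :
  measurable_fun setT (fun x : 'rV[R]_d * R => phi x.1 x.2) ->
  measurable_fun setT (km n phi).
Proof.
by move=> mphi; apply: (measurable_km_integral (z := fun (i : 'I_n) w => Z i w)).
Qed.

Lemma km_ge0 n (phi : 'rV[R]_d -> R -> R) w : (forall x y, 0 <= phi x y) ->
  0 <= km n phi w.
Proof. by move=> phi0; apply: sumr_ge0 => i _; rewrite mulr_ge0 ?km_weight_ge0. Qed.

Lemma integral_km_le_succ n (phi : 'rV[R]_d -> R -> R) :
  measurable_fun setT (fun x : 'rV[R]_d * R => phi x.1 x.2) ->
  (forall x y, 0 <= phi x y) ->
  (\int[P]_w (km n phi w)%:E <= \int[P]_w (km n.+1 phi w)%:E)%E.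
Proof.
move=> mphi phi0.
pose g (t : n.-tuple (obs R d)) : R := km_integral (fun k : 'I_n => tnth t k) phi.
have mg : measurable_fun setT (EFin \o g).
  apply/measurable_EFinP.
  apply: (measurable_km_integral (z := fun (k : 'I_n) (t : n.-tuple (obs R d)) => tnth t k)) => // k.
  exact: measurable_tnth.
have g0 t : (0 <= (EFin \o g) t)%E.
  by rewrite lee_fin; apply: sumr_ge0 => i _; rewrite mulr_ge0 ?km_weight_ge0.
pose s0 := [tuple (k : nat) | k < n].
pose s (j : 'I_n.+1) := [tuple (lift j k : nat) | k < n].
have us0 : uniq s0 by rewrite map_inj_uniq ?enum_uniq//; exact: val_inj.
have us j : uniq (s j).
  by rewrite map_inj_uniq ?enum_uniq// => k k' /val_inj; exact: lift_inj.
have sE (j : 'I_n.+1) w : g (subsample Z (s j) w) = km_integral (fun k : 'I_n => Z (lift j k) w) phi.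
  by rewrite /g; congr km_integral; apply/funext => k; rewrite !tnth_mktuple.
have s0E w : g (subsample Z s0 w) = km n phi w.
  by rewrite /g /km; congr km_integral; apply/funext => k; rewrite !tnth_mktuple.
have Ej (j : 'I_n.+1) : (\int[P]_w (km_integral (fun k : 'I_n => Z (lift j k) w) phi)%:E =
    \int[P]_w (km n phi w)%:E)%E.
  transitivity (\int[P]_w (EFin \o g) (subsample Z (s j) w))%E.
    by apply: eq_integral => w _; rewrite /= sE.
  rewrite (integral_subsample iidZ (us j) us0)//.
  by apply: eq_integral => w _; rewrite /= s0E.
have mj (j : 'I_n.+1) : measurable_fun setT (fun w => km_integral (fun k : 'I_n => Z (lift j k) w) phi).
  by apply: (measurable_km_integral (z := fun (k : 'I_n) w => Z (lift j k) w)).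
have n1 : 0 < n.+1%:R :> R by [].
rewrite -(@lee_pmul2l _ n.+1%:R%:E) ?lte_fin//.
rewrite -[leRHS]ge0_integral_scale//; last 2 first.
- exact: measurable_km.
- by move=> w; rewrite km_ge0.
apply: (@le_trans _ _ (\int[P]_w (\sum_(j < n.+1) km_integral (fun k : 'I_n => Z (lift j k) w) phi)%:E)%E).
  under [leRHS]eq_integral do rewrite -sumEFin.
  rewrite ge0_integral_sum//.
  - by under [leRHS]eq_bigr do rewrite Ej; rewrite sumr_const card_ord mule_natl.
  - by move=> j; exact/measurable_EFinP.
  - by move=> j w _; rewrite lee_fin; apply: sumr_ge0 => i _; rewrite mulr_ge0 ?km_weight_ge0.
apply: ge0_integral_mono => //.
- by apply: measurable_sum.
- by move=> w; apply: sumr_ge0 => j _; apply: sumr_ge0 => i _; rewrite mulr_ge0 ?km_weight_ge0.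
- by apply: measurable_funM => //; exact: measurable_km.
move=> w; exact: (sum_km_integral_lift (fun i : 'I_n.+1 => Z i w)).
Qed.

(** By monotonicity n may be replaced by some m >= n at which the integral is within e1 of its limit
    outside an event of probability e1. On that event it is still at most M, since the weights sum
    to at most 1. The mean exceeds the limit by at most e1 + M e1, whence e1 = e / (1 + M). *)
Lemma integral_km_trunc_le n (phi : 'rV[R]_d -> R -> R) (M t0 : R) :
  measurable_fun setT (fun x : 'rV[R]_d * R => phi x.1 x.2) ->
  (forall x y, 0 <= phi x y <= M) -> (forall x y, t0 < y -> phi x y = 0) ->
  0 < surv P T t0 ->
  (\int[P]_w (km n phi w)%:E <= \int[P]_w (phi (X w) (Y w))%:E)%E.
Proof.
move=> mphi phiM phi0 k0.
have phi_ge0 x y : 0 <= phi x y by have /andP[] := phiM x y.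
have M0 : 0 <= M by have /andP[] := phiM 0 0; exact: le_trans.
have mono m : (n <= m)%N -> (\int[P]_w (km n phi w)%:E <= \int[P]_w (km m phi w)%:E)%E.
  elim: m => [|m IH]; first by rewrite leqn0 => /eqP ->.
  rewrite leq_eqVlt => /orP[/eqP -> //|/IH /le_trans]; apply.
  exact: integral_km_le_succ.
have mpXY : measurable_fun setT (fun w => phi (X w) (Y w)).
  exact: (measurableT_comp mphi (measurable_fun_pair mX mY)).
set m0 := \int[P]_w phi (X w) (Y w).
have -> : (\int[P]_w (phi (X w) (Y w))%:E = m0%:E)%E.
  rewrite fineK//; apply: integrable_fin_num => //.
  by apply: (bounded_integrable P (K := M)) => // w; rewrite ger0_norm//; have /andP[] := phiM (X w) (Y w).
apply/lee_addgt0Pr => e e0; rewrite -EFinD.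
pose e1 := e / (1 + M).
have e10 : 0 < e1 by rewrite divr_gt0// ltr_pwDl.
have [N _ /(_ (maxn n N) (leq_maxr n N)) Pm] := km_trunc_consistency mphi phiM phi0 k0 e10 e10.
set m := maxn n N in Pm.
apply: le_trans (mono m (leq_maxl _ _)) _.
pose bad w := ~~ (`|km m phi w - m0| <= e1).
have mbad : measurable_fun setT bad.
  apply: measurable_neg; apply: measurable_fun_ler => //.
  by apply: measurableT_comp => //; apply: measurable_funB => //; exact: measurable_km.
have Pbad : (\int[P]_w ((bad w)%:R)%:E <= e1%:E)%E.
  rewrite integral_bool// -(@measurable_mu_extE _ _ _ P); last exact: measurable_pred_set.
  by apply: le_trans Pm; apply: le_mu_ext => w /= /negP.
have m00 : 0 <= m0 by apply: Rintegral_ge0.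
apply: (@le_trans _ _ (\int[P]_w ((m0 + e1) + M * (bad w)%:R)%:E)%E).
  apply: ge0_integral_mono => //.
  - exact: measurable_km.
  - by move=> w; exact: km_ge0.
  - by apply: measurable_funD => //; apply: measurable_funM => //; exact: measurable_bool_natr.
  move=> w; rewrite /bad; case: (boolP (_ <= e1)) => /= h.
    by rewrite mulr0 addr0; move: h; rewrite ler_norml => /andP[_]; lra.
  rewrite mulr1; apply: (@le_trans _ _ M); last by rewrite lerDr addr_ge0// ltW.
  apply: (@le_trans _ _ (\sum_(i < m) km_weight (fun i : 'I_m => Z i w) i * M)).
    apply: ler_sum => i _; rewrite ler_wpM2l ?km_weight_ge0//.
    by have /andP[] := phiM (obs_cov (Z i w)) (obs_time (Z i w)).
  by rewrite -mulr_suml ler_piMl// sum_km_weight_le1.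
rewrite ge0_integral_add//.
2: by move=> w; rewrite addr_ge0// ltW.
2: by apply: measurable_funM => //; exact: measurable_bool_natr.
2: by move=> w; rewrite mulr_ge0.
rewrite integral_prob_cst ge0_integral_scale//; last exact: measurable_bool_natr.
apply: (@le_trans _ _ ((m0 + e1)%:E + M%:E * e1%:E)%E).
  by rewrite leeD2l// lee_wpmul2l// lee_fin.
rewrite -EFinM -EFinD lee_fin le_eqVlt; apply/orP; left; apply/eqP.
by rewrite /e1; field; rewrite gt_eqF// ltr_pwDl.
Qed.

Hypothesis Y_sq : (\int[P]_w ((Y w) ^+ 2)%:E < +oo)%E.

Let env (c y : R) : R := c * (1 + y ^+ 2).

Let menv c : measurable_fun setT (env c).
Proof.
apply: measurable_funM => //; apply: measurable_funD => //.
Qed.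

Let env_ge0 c y : 0 <= c -> 0 <= env c y.
Proof. by move=> c0; rewrite mulr_ge0// addr_ge0// sqr_ge0. Qed.

Let integrable_env c : 0 <= c -> P.-integrable setT (fun w => (env c (Y w))%:E).
Proof.
move=> c0; have mY2 : measurable_fun setT (fun w => Y w ^+ 2) by exact: measurable_funX.
under eq_fun do rewrite EFinM EFinD; apply: integrableZl => //.
apply: (integrableD measurableT (f := fun=> 1%:E)).
  by apply: (bounded_integrable P (f := fun=> 1) (K := 1)) => // w; rewrite normr1.
apply/integrableP; split; first exact/measurable_EFinP.
by under eq_integral do rewrite gee0_abs ?lee_fin ?sqr_ge0//.
Qed.

Let tail (t0 K : R) (phi : 'rV[R]_d -> R -> R) x y : R :=
  phi x y * (~~ trunc t0 K y)%:R.

Let main (t0 K : R) (phi : 'rV[R]_d -> R -> R) x y : R :=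
  phi x y * (trunc t0 K y)%:R.

Let mtail t0 K (phi : 'rV[R]_d -> R -> R) :
  measurable_fun setT (fun x : 'rV[R]_d * R => phi x.1 x.2) ->
  measurable_fun setT (fun x : 'rV[R]_d * R => tail t0 K phi x.1 x.2).
Proof.
move=> mphi; apply: measurable_funM => //; apply: measurable_bool_natr.
apply: measurable_neg.
exact: (measurableT_comp (measurable_trunc t0 K) measurable_snd).
Qed.

Let mmain t0 K (phi : 'rV[R]_d -> R -> R) :
  measurable_fun setT (fun x : 'rV[R]_d * R => phi x.1 x.2) ->
  measurable_fun setT (fun x : 'rV[R]_d * R => main t0 K phi x.1 x.2).
Proof.
move=> mphi; apply: measurable_funM => //; apply: measurable_bool_natr.
exact: (measurableT_comp (measurable_trunc t0 K) measurable_snd).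
Qed.

Let km_split n t0 K (phi : 'rV[R]_d -> R -> R) w :
  km n phi w = km n (main t0 K phi) w + km n (tail t0 K phi) w.
Proof.
rewrite /km /km_integral -big_split /=; apply: eq_bigr => i _.
rewrite -mulrDr /main /tail -mulrDr; congr (_ * _).
by case: trunc; rewrite /= ?addr0 ?add0r mulr1.
Qed.

Let main_bound t0 K c (phi : 'rV[R]_d -> R -> R) : 0 <= c ->
  (forall x y, 0 <= phi x y <= env c y) ->
  forall x y, 0 <= main t0 K phi x y <= c * (1 + K ^+ 2).
Proof.
move=> c0 phiE x y; have /andP[p0 pE] := phiE x y; rewrite /main /trunc.
have B0 : 0 <= c * (1 + K ^+ 2) by rewrite mulr_ge0// addr_ge0// sqr_ge0.
case: (y <= t0) => /=; last by rewrite mulr0 lexx.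
have [yK|_] := leP `|y| K; last by rewrite mulr0 lexx.
rewrite mulr1 p0 /=; apply: le_trans pE _; rewrite /env ler_wpM2l// lerD2l.
by rewrite -real_normK ?num_real// lerXn2r ?nnegrE// (le_trans (normr_ge0 _) yK).
Qed.

Let main_supp t0 K (phi : 'rV[R]_d -> R -> R) x y :
  t0 < y -> main t0 K phi x y = 0.
Proof. by move=> lt; rewrite /main /trunc leNgt lt mulr0. Qed.

(* As every weight is at most 1, the tail of phi contributes at most n times its
   mean, which a truncation level depending on n makes small. *)
Lemma integral_km_le n (phi : 'rV[R]_d -> R -> R) (c : R) : 0 <= c ->
  measurable_fun setT (fun x : 'rV[R]_d * R => phi x.1 x.2) ->
  (forall x y, 0 <= phi x y <= env c y) ->
  (\int[P]_w (km n phi w)%:E <= \int[P]_w (phi (X w) (Y w))%:E)%E.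
Proof.
move=> c0 mphi phiE.
have phi0 x y : 0 <= phi x y by have /andP[] := phiE x y.
have tail0 t0 K x y : 0 <= tail t0 K phi x y by rewrite mulr_ge0.
have main0 t0 K x y : 0 <= main t0 K phi x y by rewrite mulr_ge0.
apply/lee_addgt0Pr => e e0.
(* Each of the n observations will contribute at most e1; n + 1 also covers n = 0. *)
pose e1 := e / n.+1%:R; have e10 : 0 < e1 by rewrite divr_gt0.
have survY := ae_surv_cens_time_gt0 mY mC endpoint endpoint_atom.
have [t0 [K [k0 He]]] := exists_trunc mY mT survY (menv c) (fun y => env_ge0 y c0)
  (integrable_env c0) e10.
under eq_integral do rewrite (km_split n t0 K).
rewrite ge0_integral_add//; last 4 first.
- by apply: measurable_km; exact: mmain.
- by move=> w; exact: km_ge0.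
- by apply: measurable_km; exact: mtail.
- by move=> w; exact: km_ge0.
apply: leeD.
  apply: le_trans (integral_km_trunc_le n (mmain t0 K mphi) (main_bound t0 K c0 phiE)
    (@main_supp t0 K phi) k0) _.
  apply: ge0_integral_mono => //.
  - exact: (measurableT_comp (mmain t0 K mphi) (measurable_fun_pair mX mY)).
  - exact: (measurableT_comp mphi (measurable_fun_pair mX mY)).
  - by move=> w; rewrite /main ler_piMr// lern1 leq_b1.
pose u (o : obs R d) : R := (obs_uncens o)%:R * (env c (obs_time o) * (~~ trunc t0 K (obs_time o))%:R).
have mu : measurable_fun setT u.
  have mt := @measurable_obs_time R d.
  apply: measurable_funM; first exact: (measurable_bool_natr (@measurable_obs_uncens R d)).
  apply: measurable_funM; first exact: (measurableT_comp (menv c) mt).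
  apply: measurable_bool_natr; apply: measurable_neg.
  exact: (measurableT_comp (measurable_trunc t0 K) mt).
have u0 o : 0 <= u o.
  by apply: mulr_ge0 => //; apply: mulr_ge0 => //; exact: env_ge0.
have Iu i : (\int[P]_w (u (Z i w))%:E <= e1%:E)%E.
  rewrite (integral_obs i (g := EFin \o u)); last 2 first.
  - exact/measurable_EFinP.
  - by move=> o; rewrite lee_fin.
  apply: le_trans He; apply: ge0_integral_mono => //.
  - exact: (measurableT_comp mu mobs).
  - apply: measurable_funM; first exact: (measurableT_comp (menv c) mY).
    apply: measurable_bool_natr; apply: measurable_neg.
    exact: (measurableT_comp (measurable_trunc t0 K) mY).
  move=> w; rewrite /u /obs_uncens /obs_time /= /delta /T.
  case: (leP (Y w) (C w)) => YC; rewrite ?mul1r// mul0r.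
  by apply: mulr_ge0 => //; exact: env_ge0.
apply: (@le_trans _ _ (\int[P]_w (\sum_(i < n) u (Z i w))%:E)%E).
  apply: ge0_integral_mono.
  - by apply: measurable_km; exact: mtail.
  - by move=> w; exact: km_ge0.
  - by apply: measurable_sum => i; exact: (measurableT_comp mu (mZ i)).
  move=> w; apply: ler_sum => i _; set W := km_weight _ i.
  have W1 : W <= 1.
    apply: le_trans (sum_km_weight_le1 (fun i : 'I_n => Z i w)).
    by rewrite (bigD1 i)//= lerDl sumr_ge0// => j _; exact: km_weight_ge0.
  have WE : W = (obs_uncens (Z i w))%:R * W.
    by rewrite /W km_weightE; case: obs_uncens; rewrite ?mul1r ?mul0r ?mulr0.
  rewrite {}WE /u -mulrA ler_wpM2l// /tail mulrA ler_wpM2r//.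
  have /andP[p0 pE] := phiE (obs_cov (Z i w)) (obs_time (Z i w)).
  by apply: le_trans pE; rewrite ler_piMl.
under eq_integral do rewrite -sumEFin.
rewrite ge0_integral_sum//.
- apply: (@le_trans _ _ (\sum_(i < n) e1%:E)%E); first exact: lee_sum.
  rewrite sumEFin lee_fin sumr_const card_ord -mulr_natl /e1 mulrCA ler_piMr ?(ltW e0)//.
  by rewrite ler_pdivrMr// mul1r ler_nat.
- by move=> i; apply/measurable_EFinP; exact: (measurableT_comp mu (mZ i)).
- by move=> i w _; rewrite lee_fin.
Qed.

Lemma km_consistency (phi : 'rV[R]_d -> R -> R) (c e p : R) : 0 <= c ->
  measurable_fun setT (fun x : 'rV[R]_d * R => phi x.1 x.2) ->
  (forall x y, 0 <= phi x y <= env c y) -> 0 < e -> 0 < p ->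
  evp P (fun n => [set w | `|km n phi w - \int[P]_w phi (X w) (Y w)| <= e]) p.
Proof.
move=> c0 mphi phiE e0 p0.
have phi0 x y : 0 <= phi x y by have /andP[] := phiE x y.
have tail0 t0 K x y : 0 <= tail t0 K phi x y by rewrite mulr_ge0.
(* The first bound serves the population tail; with the second, Markov's inequality at level e / 3
   gives the empirical tail probability at most q / (e / 3) <= p / 2. *)
pose q := Num.min (e / 3) (e * p / 6).
have q0 : 0 < q by rewrite lt_min !divr_gt0// mulr_gt0.
have survY := ae_surv_cens_time_gt0 mY mC endpoint endpoint_atom.
have [t0 [K [k0 He]]] := exists_trunc mY mT survY (menv c) (fun y => env_ge0 y c0)
  (integrable_env c0) q0.
have mXY := measurable_fun_pair mX mY.
have iphi : P.-integrable setT (fun w => (phi (X w) (Y w))%:E).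
  apply: le_integrable (integrable_env c0) => //.
    by apply/measurable_EFinP; exact: (measurableT_comp mphi mXY).
  move=> w _; rewrite lee_fin !ger0_norm ?env_ge0//.
  by have /andP[] := phiE (X w) (Y w).
have le_main x y : main t0 K phi x y <= phi x y by rewrite /main ler_piMr// lern1 leq_b1.
have le_tail x y : tail t0 K phi x y <= env c y * (~~ trunc t0 K y)%:R.
  by rewrite /tail ler_wpM2r//; have /andP[] := phiE x y.
have iT : P.-integrable setT (fun w => (tail t0 K phi (X w) (Y w))%:E).
  apply: le_integrable iphi => //.
    by apply/measurable_EFinP; exact: (measurableT_comp (mtail t0 K mphi) mXY).
  by move=> w _; rewrite lee_fin !ger0_norm// /tail ler_piMr// lern1 leq_b1.
have iM : P.-integrable setT (fun w => (main t0 K phi (X w) (Y w))%:E).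
  apply: le_integrable iphi => //.
    by apply/measurable_EFinP; exact: (measurableT_comp (mmain t0 K mphi) mXY).
  by move=> w _; rewrite lee_fin !ger0_norm// /main mulr_ge0.
have mtailq : (\int[P]_w (tail t0 K phi (X w) (Y w))%:E <= q%:E)%E.
  apply: le_trans He; apply: ge0_integral_mono => //.
  - exact: (measurableT_comp (mtail t0 K mphi) mXY).
  - apply: measurable_funM; first exact: (measurableT_comp (menv c) mY).
    apply: measurable_bool_natr; apply: measurable_neg.
    exact: (measurableT_comp (measurable_trunc t0 K) mY).
have meanE : \int[P]_w phi (X w) (Y w) =
    \int[P]_w main t0 K phi (X w) (Y w) + \int[P]_w tail t0 K phi (X w) (Y w).
  rewrite -RintegralD//; apply: eq_Rintegral => w _.
  by rewrite /main /tail -mulrDr; case: trunc; rewrite /= ?addr0 ?add0r mulr1.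
have tailq : \int[P]_w tail t0 K phi (X w) (Y w) <= e / 3.
  rewrite -lee_fin fineK ?integrable_fin_num//; apply: le_trans mtailq _.
  by rewrite lee_fin /q ge_min lexx.
have tailge0 : 0 <= \int[P]_w tail t0 K phi (X w) (Y w) by exact: Rintegral_ge0.
have e3 : 0 < e / 3 by rewrite divr_gt0.
have p2 : 0 < p / 2 by rewrite divr_gt0.
have ev1 := km_trunc_consistency (mmain t0 K mphi) (main_bound t0 K c0 phiE)
    (@main_supp t0 K phi) k0 e3 p2.
have ev2 : evp P (fun n => [set w | km n (tail t0 K phi) w <= e / 3]) (p / 2).
  apply: nearW => n.
  apply: (@le_trans _ _ (mu_ext P [set w | (e / 3 < km n (tail t0 K phi) w)%R])).
    by apply: le_mu_ext => w /= /negP; rewrite -ltNge.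
  have bound : (\int[P]_w (km n (tail t0 K phi) w)%:E <= q%:E)%E.
    apply: le_trans mtailq; apply: (integral_km_le n c0 (mtail t0 K mphi)) => x y.
    rewrite tail0 /=; apply: le_trans (le_tail x y) _.
    by rewrite ler_piMr ?env_ge0// lern1 leq_b1.
  apply: le_trans (markov_mu_ext (measurable_km n (mtail t0 K mphi)) _ bound e3) _.
    by move=> w; exact: km_ge0.
  rewrite lee_fin ler_pdivrMr//; apply: (@le_trans _ _ (e * p / 6)).
    by rewrite /q ge_min lexx orbT.
  by rewrite le_eqVlt; apply/orP; left; apply/eqP; field.
rewrite (_ : p = p / 2 + p / 2); last by field.
apply: (evpI ev1 ev2); apply: nearW => n w /= [h1 h2].
have km0 := km_ge0 n w (tail0 t0 K).
rewrite (km_split n t0 K) meanE; move: h1; rewrite !ler_norml => /andP[l1 l2].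
by apply/andP; split; lra.
Qed.

End censored_sample.

(** * Euclidean vectors and the support of X *)

Section row_vectors.
Context (R : realType) (d : nat).
Implicit Types (x y u v : 'rV[R]_d.+1).

Lemma open_measurable_rV (U : set 'rV[R]_d.+1) : open U -> measurable U.
Proof. exact: sub_sigma_algebra. Qed.

Lemma measurable_coord (i : 'I_d.+1) :
  measurable_fun setT (fun x : 'rV[R]_d.+1 => x 0 i).
Proof.
apply: (measurability _ (RGenOpens.measurableE R)).
move=> _ [_ [a [b ->] <-]]; rewrite setTI; apply: open_measurable_rV.
have /continuousP := @coord_continuous R 1 d.+1 0 i.
by apply; exact: interval_open.
Qed.

Lemma measurable_dot u : measurable_fun setT (fun x : 'rV[R]_d.+1 => dot u x).
Proof.
apply: measurable_sum => i; apply: measurable_funM => //; exact: measurable_coord.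
Qed.

Lemma enorm_le v : enorm v <= d.+1%:R * `|v|.
Proof.
rewrite -[leRHS]ger0_norm ?mulr_ge0// -sqrtr_sqr ler_wsqrtr//.
apply: (@le_trans _ _ (\sum_(i < d.+1) `|v| ^+ 2)).
  apply: ler_sum => i _; rewrite -expr2 -real_normK ?num_real//.
  rewrite lerXn2r ?nnegrE//.
  by rewrite [leRHS]mx_normrE; exact: (le_bigmax _ (fun ij : 'I_1 * 'I_d.+1 => `|v ij.1 ij.2|) (0, i)).
rewrite sumr_const card_ord exprMn -[leLHS]mulr_natl ler_wpM2r ?sqr_ge0//.
by rewrite expr2 ler_peMl// ler1n.
Qed.

Lemma compact_ball_cover (A : set 'rV[R]_d.+1) (r : 'rV[R]_d.+1 -> R) :
  compact A -> (forall x, A x -> 0 < r x) ->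
  exists s : seq 'rV[R]_d.+1, (forall x, x \in s -> A x) /\
    forall y, A y -> exists2 x, x \in s & `|x - y| < r x.
Proof.
rewrite compact_cover => cA r0.
have [|y Ay|s sA sc] := cA _ A (fun x => ball x (r x)).
- by move=> x Ax; apply: ball_open; exact: r0.
- by exists y => //; exact/ballxx/r0.
exists (finmap.enum_fset s); split=> [x xs|y /sc[x xs]].
  by have := sA x xs; rewrite inE.
by rewrite -ball_normE => ?; exists x.
Qed.

End row_vectors.

Section support.
Context (d0 : measure_display) (Omega : measurableType d0) (R : realType)
  (P : probability Omega R) (d : nat) (X : Omega -> 'rV[R]_d.+1)
  (mX : measurable_fun setT X).

Lemma open_setC_rv_support : open (~` rv_support P X).
Proof.
rewrite openE => x /existsNP[U /not_implyP[oU /not_implyP[Ux PU]]].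
move: (oU); rewrite openE => /(_ _ Ux); apply: filterS => y Uy /(_ U oU Uy).
exact: PU.
Qed.

Lemma measurable_rv_support : measurable (rv_support P X).
Proof.
by rewrite -[X in measurable X]setCK; apply: measurableC; apply: open_measurable_rV; exact: open_setC_rv_support.
Qed.

(* The complement of the support is covered by countably many null rational balls. *)
Lemma ae_rv_support : {ae P, forall w, rv_support P X (X w)}.
Proof.
pose B (q : 'rV[rat]_d.+1 * nat) : set 'rV[R]_d.+1 := ball (map_mx (ratr : rat -> R) q.1 : 'rV[R]_d.+1) (q.2.+1%:R^-1).
have oB q : open (B q) by apply: ball_open; rewrite invr_gt0.
pose F n : set Omega := if unpickle n is Some q then
  if P (X @^-1` B q) == 0%E then X @^-1` B q else set0 else set0.
apply: (negligibleS (A := \bigcup_n F n)); last first.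
  apply: negligible_bigcup => n; rewrite /F.
  case: unpickle => [q|]; last exact: negligible_set0.
  case: eqP => [P0|_]; last exact: negligible_set0.
  exists (X @^-1` B q); split => //.
  by rewrite -[X in measurable X]setTI; apply: mX => //; exact: open_measurable_rV.
move=> w /existsNP[U /not_implyP[oU /not_implyP[Ux PU]]].
have [e /= e0 eU] : nbhs_ball (X w) U by apply/nbhs_ballP; exact: open_nbhs_nbhs.
have [k ke] : exists k : nat, k.+1%:R^-1 < e / 2.
  have e2 : 0 < e / 2 by rewrite divr_gt0.
  by have /ltr_add_invr[k] := e2; rewrite add0r; exists k.
have k0 : 0 < k.+1%:R^-1 :> R by rewrite invr_gt0.
have [q qX] : exists q : 'rV[rat]_d.+1, ball (map_mx (ratr : rat -> R) q : 'rV[R]_d.+1) (k.+1%:R^-1) (X w).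
  have h i : exists q : rat, `|(ratr q : R) - X w 0 i| < k.+1%:R^-1.
    have lt : X w 0 i - k.+1%:R^-1 < X w 0 i + k.+1%:R^-1 by rewrite ltrD2l gtrN.
    have [q] := rat_in_itvoo lt.
    by rewrite in_itv /= -ltr_distlC distrC => ?; exists q.
  have /choice[f fP] : forall i, exists q : rat, `|(ratr q : R) - X w 0 i| < k.+1%:R^-1 by [].
  exists (\row_i f i); split => // i j; rewrite !mxE ord1 /ball /=; exact: fP.
exists (pickle (q, k)) => //; rewrite /F pickleK.
suff BU : B (q, k) `<=` U.
  have PB : P (X @^-1` B (q, k)) = 0%E.
    apply/eqP; rewrite eq_le measure_ge0 andbT leNgt; apply/negP => lt0.
    apply: PU; apply: lt_le_trans lt0 _; apply: le_measure; rewrite ?inE.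
    - by rewrite -[X in measurable X]setTI; apply: mX => //; exact: open_measurable_rV.
    - by rewrite -[X in measurable X]setTI; apply: mX => //; exact: open_measurable_rV.
    - by apply: preimage_subset.
  by rewrite PB eqxx.
move=> y By; apply: eU; rewrite [e]splitr.
apply: (le_ball (ltW _)); last exact: (ball_triangle (ball_sym qX) By).
by rewrite ltrD.
Qed.

End support.

(** Around theta0 a ball of radius e / (d + 1) stays within Euclidean distance e; around any other
    point equicontinuity keeps M at least half its gap above [M theta0]. A finite subcover leaves
    finitely many margins, and eta is a common lower bound. *)
Lemma well_separated_min (R : realType) (d : nat) (Theta : set 'rV[R]_d.+1)
    (theta0 : 'rV[R]_d.+1) (M : 'rV[R]_d.+1 -> R) :
  compact Theta ->
  (forall e, 0 < e -> exists2 r, 0 < r & forall t1 t2,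
     Theta t1 -> Theta t2 -> `|t1 - t2| < r -> `|M t1 - M t2| <= e) ->
  (forall t, Theta t -> M t <= M theta0 -> t = theta0) ->
  forall e, 0 < e -> exists2 eta, 0 < eta & forall t, Theta t ->
    M t < M theta0 + eta -> enorm (t - theta0) <= e.
Proof.
move=> cT Mequi Muniq e e0.
have loc t : exists re : R * R, Theta t -> [/\ 0 < re.1, 0 < re.2 &
    forall u, Theta u -> `|t - u| < re.1 -> M u < M theta0 + re.2 -> enorm (u - theta0) <= e].
  have [Tt|] := pselect (Theta t); last by exists (0, 0).
  have [Mt|Mt] := leP (M t) (M theta0).
    exists (e / d.+1%:R, 1) => _; split; rewrite ?divr_gt0//= => u Tu.
    rewrite (Muniq t Tt Mt) => tu _; apply: le_trans (enorm_le _) _.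
    by rewrite mulrC -ler_pdivlMr// distrC ltW.
  pose a := (M t - M theta0) / 2.
  have a0 : 0 < a by rewrite divr_gt0// subr_gt0.
  have [r r0 hr] := Mequi a a0; exists (r, a) => _; split => //= u Tu tu.
  have := hr t u Tt Tu tu; rewrite ler_norml => /andP[_]; rewrite {1 2}/a => h1 h2.
  by exfalso; lra.
have /choice[re reP] := loc.
have [s [sT sr]] := compact_ball_cover (r := fun t => (re t).1) cT (fun t Tt => let: And3 r0 _ _ := reP t Tt in r0).
have [eta eta0 etaP] : exists2 eta, 0 < eta & forall t, t \in s -> eta <= (re t).2.
  elim: s sT {sr} => [_|t s IH sT]; first by exists 1.
  have [|eta eta0 etaP] := IH; first by move=> u us; apply: sT; rewrite in_cons us orbT.
  have [_ r2 _] := reP t (sT t (mem_head _ _)).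
  exists (Num.min eta (re t).2); first by rewrite lt_min eta0.
  move=> u; rewrite in_cons => /orP[/eqP ->|us]; first by rewrite ge_min lexx orbT.
  by rewrite ge_min etaP.
exists eta => // u Tu Mu; have [t ts tu] := sr u Tu.
have [_ _ h] := reP t (sT t ts); apply: (h u Tu tu); apply: lt_le_trans Mu _.
by rewrite lerD2l etaP.
Qed.

(** The centring of V given X is known on events only. Splitting V into positive and negative parts
    makes it an equality of nonnegative weights, to which [integral_weight_eq] applies; adding K
    makes g nonnegative too, and the constant is removed at the end. *)
Lemma cond_mean_zero (d0 d1 : measure_display) (Omega : measurableType d0)
    (S : measurableType d1) (R : realType) (P : probability Omega R)
    (X : Omega -> S) (V : Omega -> R) (g : S -> R) (K : R) :
  measurable_fun setT X -> is_cond_expect P X V (fun _ => 0) ->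
  measurable_fun setT g -> (forall x, `|g x| <= K) ->
  P.-integrable setT (fun w => (V w * g (X w))%:E) /\
  \int[P]_w (V w * g (X w)) = 0.
Proof.
move=> mX [iV _ _ V0] mg gK; have mV : measurable_fun setT V.
  by have /integrableP[/measurable_EFinP] := iV.
have K0 : 0 <= K by apply: le_trans (gK point).
have gKK x : 0 <= g x + K <= K + K.
  have := gK x; rewrite ler_norml => /andP[g1 g2].
  by rewrite lerD2r g2 andbT -lerBlDr sub0r.
have ibd (h : S -> R) (c : R) : measurable_fun setT h -> (forall x, `|h x| <= c) ->
    P.-integrable setT (fun w => (V w * h (X w))%:E).
  move=> mh hc; have c0 : 0 <= c by apply: le_trans (hc point).
  apply: (@le_integrable _ _ _ _ _ measurableT _ (fun w => c%:E * (V w)%:E)%E).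
  - by apply/measurable_EFinP; apply: measurable_funM => //; exact: measurableT_comp.
  - by move=> w _; rewrite lee_fin !normrM mulrC ler_wpM2r// (ger0_norm c0).
  - exact: integrableZl.
have VE w : V w = V^\+ w - V^\- w by exact: esym (congr1 (fun h => h w) (funrposBneg V)).
have Vp0 w : 0 <= V^\+ w by exact: (funrpos_ge0 V w).
have Vn0 w : 0 <= V^\- w by exact: (funrneg_ge0 V w).
have Vabs w : `|V w| = V^\+ w + V^\- w by exact: esym (congr1 (fun h => h w) (funrposDneg V)).
have mVp : measurable_fun setT V^\+ by exact: measurable_funrpos mV.
have mVn : measurable_fun setT V^\- by exact: measurable_funrneg mV.
have part (W : Omega -> R) (h : S -> R) (c : R) : measurable_fun setT W ->
    (forall w, 0 <= W w <= `|V w|) -> measurable_fun setT h -> (forall x, `|h x| <= c) ->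
    P.-integrable setT (fun w => (W w * h (X w))%:E).
  move=> mW WV mh hc; apply: (le_integrable measurableT _ _ (ibd h c mh hc)).
    by apply/measurable_EFinP; apply: measurable_funM => //; exact: measurableT_comp.
  move=> w _; rewrite lee_fin !normrM ler_wpM2r//.
  by have /andP[w0 wV] := WV w; rewrite ger0_norm.
have pV w : 0 <= V^\+ w <= `|V w| by rewrite Vp0 Vabs lerDl Vn0.
have nV w : 0 <= V^\- w <= `|V w| by rewrite Vn0 Vabs lerDr Vp0.
have pos (h : S -> R) (c : R) : measurable_fun setT h -> (forall x, 0 <= h x <= c) ->
    \int[P]_w (V w * h (X w)) = 0.
  move=> mh hc; have h0 x : 0 <= h x by have /andP[] := hc x.
  have hn x : `|h x| <= c by rewrite ger0_norm//; have /andP[] := hc x.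
  have pn : (\int[P]_w ((V^\+ w) * h (X w))%:E = \int[P]_w ((V^\- w) * h (X w))%:E)%E.
    apply: (integral_weight_eq mX) => // A mA.
    have mXA : measurable (X @^-1` A) by rewrite -[Y in measurable Y]setTI; exact: mX.
    have one (W : Omega -> R) : measurable_fun setT W -> (forall w, 0 <= W w <= `|V w|) ->
        P.-integrable (X @^-1` A) (fun w => (W w)%:E).
      move=> mW WV; apply: (integrableS measurableT mXA) => //.
      have := part W (fun=> 1) 1 mW WV (measurable_cst _) (fun=> _).
      by under eq_fun do rewrite mulr1; apply; rewrite normr1.
    have iP := one _ mVp pV; have iN := one _ mVn nV.
    have := V0 A mA; under eq_integral do rewrite VE EFinB.
    rewrite integral0 integralB// => /(congr1 (fun z => z + \int[P]_(w in X @^-1` A) (V^\- w)%:E)%E).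
    by rewrite subeK ?integrable_fin_num// add0e.
  under eq_Rintegral do rewrite VE mulrBl.
  rewrite RintegralB//; last 2 first.
  - exact: (part _ h c mVp pV mh hn).
  - exact: (part _ h c mVn nV mh hn).
  by rewrite /Rintegral pn subrr.
split; first exact: (ibd g K mg gK).
have mgK : measurable_fun setT (fun x => g x + K) by exact: measurable_funD.
have e1 := pos (fun x => g x + K) (K + K) mgK gKK.
have e2 : \int[P]_w (V w * K) = 0.
  by apply: (pos (fun=> K) K) => // x; rewrite K0 lexx.
rewrite -[RHS](subrr 0) -[in X in _ = X - _]e1 -[in X in _ = _ - X]e2.
rewrite -RintegralB//.
- by apply: eq_Rintegral => w _; ring.
- apply: (ibd (fun x => g x + K) (K + K)) => // x.
  by apply: le_trans (ler_normD _ _) _; rewrite (ger0_norm K0) lerD2r.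
- by apply: (ibd (fun=> K) K) => // x; rewrite ger0_norm.
Qed.

(** * Uniform convergence of the criterion *)

Section uniform_criterion.
Context (d0 : measure_display) (Omega : measurableType d0) (R : realType)
  (P : probability Omega R) (d : nat) (Y : Omega -> R)
  (X : Omega -> 'rV[R]_d.+1) (mY : measurable_fun setT Y)
  (mX : measurable_fun setT X) (Z : nat -> Omega -> obs R d.+1).

Lemma evp_seq (I : eqType) (s : seq I) (E : I -> nat -> set Omega) :
  (forall i q, i \in s -> 0 < q -> evp P (E i) q) -> forall q, 0 < q ->
  evp P (fun n => [set w | forall i, i \in s -> E i n w]) q.
Proof.
elim: s => [_ q q0|i s IH h q q0].
  by apply: evpS (ltW q0) (nearW _ _) => [|n w h //]; apply: evp_ae => n; exact: aeW.
have q2 : 0 < q / 2 by rewrite divr_gt0.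
rewrite (_ : q = q / 2 + q / 2); last by field.
apply: (evpI (h i _ (mem_head _ _) q2) (IH _ _ q2)).
  by move=> j r js r0; apply: h => //; rewrite in_cons js orbT.
by apply: nearW => n w [hi hs] j; rewrite in_cons => /orP[/eqP ->//|]; exact: hs.
Qed.

Lemma km_integral_dev n (z : 'I_n -> obs R d.+1) (phi1 phi2 : 'rV[R]_d.+1 -> R -> R) c :
  (forall i, `|phi1 (obs_cov (z i)) (obs_time (z i)) -
               phi2 (obs_cov (z i)) (obs_time (z i))| <=
             c * (1 + obs_time (z i) ^+ 2)) ->
  `|km_integral z phi1 - km_integral z phi2| <=
  c * km_integral z (fun _ y => 1 + y ^+ 2).
Proof.
move=> h; rewrite /km_integral -sumrB mulr_sumr.
apply: le_trans (ler_norm_sum _ _ _) _; apply: ler_sum => i _.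
rewrite -mulrBr normrM ger0_norm ?km_weight_ge0// mulrCA.
by rewrite ler_wpM2l ?km_weight_ge0.
Qed.

(** The difference is (a - b) ((a - b) + 2 b - 2 y), and 2 |y| <= 1 + y^2; the constant 2 L + 2 is 1
    + 2 L + 1. *)
Lemma sq_dev (y a b L e : R) : `|a - b| <= e -> e <= 1 -> `|b| <= L ->
  `|(y - a) ^+ 2 - (y - b) ^+ 2| <= e * (2 * L + 2) * (1 + y ^+ 2).
Proof.
move=> ab e1 bL.
have -> : (y - a) ^+ 2 - (y - b) ^+ 2 = (a - b) * (a + b - 2 * y) by ring.
rewrite normrM -mulrA ler_pM//.
have h1 : `|a + b - 2 * y| <= `|a - b| + 2 * `|b| + 2 * `|y|.
  have -> : a + b - 2 * y = (a - b) + 2 * b - 2 * y by ring.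
  apply: le_trans (ler_normB _ _) _; rewrite normrM ger0_norm// lerD2r.
  by apply: le_trans (ler_normD _ _) _; rewrite normrM ger0_norm.
apply: le_trans h1 _; have y0 := normr_ge0 y; have b0 := normr_ge0 b.
rewrite -[y ^+ 2]real_normK ?num_real//.
have : 0 <= (`|y| - 1) ^+ 2 by exact: sqr_ge0.
by have := sqr_ge0 `|y|; nra.
Qed.

Context (Theta : set 'rV[R]_d.+1) (f : R -> 'rV[R]_d.+1 -> R)
  (B : set 'rV[R]_d.+1) (L : R)
  (Theta_compact : compact Theta)
  (mf : forall theta, Theta theta -> measurable_fun setT (f ^~ theta))
  (mB : measurable B)
  (fL : forall theta x, Theta theta -> B x -> `|f (dot theta x) theta| <= L)
  (f_equi : forall e, 0 < e -> exists2 r, 0 < r & forall t1 t2 x,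
     Theta t1 -> Theta t2 -> B x -> `|t1 - t2| < r ->
     `|f (dot t1 x) t1 - f (dot t2 x) t2| <= e)
  (Y_sq : (\int[P]_w ((Y w) ^+ 2)%:E < +oo)%E)
  (L0 : 0 <= L).

Let sq1_ge0 (y : R) : 0 <= 1 + y ^+ 2.
Proof. by rewrite addr_ge0// sqr_ge0. Qed.

Let L2_ge0 : 0 <= 2 * L + 2.
Proof. by rewrite addr_ge0// mulr_ge0. Qed.

Let phi theta x y : R := (y - f (dot theta x) theta) ^+ 2 * \1_B x.

Let M theta : R := \int[P]_w phi theta (X w) (Y w).

Let mphi theta : Theta theta ->
  measurable_fun setT (fun x : 'rV[R]_d.+1 * R => phi theta x.1 x.2).
Proof.
move=> Tt; apply: measurable_funM; last first.
  exact: (@measurableT_comp _ _ _ _ _ _ (\1_B : _ -> R)).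
apply: measurable_funX; apply: measurable_funB => //.
apply: (measurableT_comp (mf Tt)).
exact: (measurableT_comp (measurable_dot theta) measurable_fst).
Qed.

Let phi_bound theta x y : Theta theta ->
  0 <= phi theta x y <= (2 + 2 * L ^+ 2) * (1 + y ^+ 2).
Proof.
move=> Tt; have C0 : 0 <= (2 + 2 * L ^+ 2) * (1 + y ^+ 2).
  by rewrite mulr_ge0// addr_ge0// ?sqr_ge0// mulr_ge0// sqr_ge0.
rewrite /phi indicE; case: (boolP (x \in B)); last by rewrite mulr0 lexx.
rewrite inE mulr1 => Bx; rewrite sqr_ge0 /=.
have := fL Tt Bx; set a := f _ _ => aL.
have : a ^+ 2 <= L ^+ 2 by rewrite -real_normK ?num_real// lerXn2r ?nnegrE.
have := sqr_ge0 (y + a); have := sqr_ge0 y; have := sqr_ge0 L.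
have : 0 <= L ^+ 2 * y ^+ 2 by rewrite mulr_ge0 ?sqr_ge0.
nra.
Qed.

Let integrable_sq : P.-integrable setT (fun w => (1 + Y w ^+ 2)%:E).
Proof.
have mY2 : measurable_fun setT (fun w => Y w ^+ 2) by exact: measurable_funX.
under eq_fun do rewrite EFinD.
apply: (integrableD measurableT (f := fun=> 1%:E)).
  by apply: (bounded_integrable P (f := fun=> 1) (K := 1)) => // w; rewrite normr1.
apply/integrableP; split; first exact/measurable_EFinP.
by under eq_integral do rewrite gee0_abs ?lee_fin ?sqr_ge0//.
Qed.

Lemma integrable_sq_error theta : Theta theta ->
  P.-integrable setT (fun w => (phi theta (X w) (Y w))%:E).
Proof.
move=> Tt; apply: (@le_integrable _ _ _ _ _ measurableT _
  (fun w => ((2 + 2 * L ^+ 2) * (1 + Y w ^+ 2))%:E)).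
- by apply/measurable_EFinP; exact: (measurableT_comp (mphi Tt) (measurable_fun_pair mX mY)).
- move=> w _; rewrite lee_fin; have /andP[p0 pE] := phi_bound (X w) (Y w) Tt.
  by rewrite !ger0_norm// (le_trans p0).
- by under eq_fun do rewrite EFinM; exact: integrableZl.
Qed.

Let E2 := \int[P]_w (1 + Y w ^+ 2).

Let E2_ge0 : 0 <= E2.
Proof. by apply: Rintegral_ge0 => w _; rewrite addr_ge0 ?sqr_ge0. Qed.

Let phi_dev t1 t2 x y e : Theta t1 -> Theta t2 ->
  (B x -> `|f (dot t1 x) t1 - f (dot t2 x) t2| <= e) -> e <= 1 -> 0 <= e ->
  `|phi t1 x y - phi t2 x y| <= e * (2 * L + 2) * (1 + y ^+ 2).
Proof.
move=> T1 T2 fe e1 e0; rewrite /phi indicE; case: (boolP (x \in B)).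
  by rewrite inE !mulr1 => Bx; apply: sq_dev => //; [exact: fe | exact: fL].
by rewrite !mulr0 subrr normr0 mulr_ge0 ?sq1_ge0// mulr_ge0.
Qed.

Lemma crit_lim_equi (e : R) : 0 < e -> exists2 r, 0 < r & forall t1 t2,
  Theta t1 -> Theta t2 -> `|t1 - t2| < r -> `|M t1 - M t2| <= e.
Proof.
move=> e0; pose a := Num.min 1 (e / ((2 * L + 2) * (E2 + 1))).
have D0 : 0 < (2 * L + 2) * (E2 + 1).
  by rewrite mulr_gt0// ltr_wpDl// mulr_ge0.
have a0 : 0 < a by rewrite lt_min ltr01 divr_gt0.
have [r r0 hr] := f_equi a0; exists r => // t1 t2 T1 T2 t12.
have i1 := integrable_sq_error T1; have i2 := integrable_sq_error T2.
have iB : P.-integrable setT (EFin \o (fun w => phi t1 (X w) (Y w) - phi t2 (X w) (Y w))).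
  exact: (integrableB measurableT i1 i2).
rewrite /M -RintegralB//; apply: le_trans (le_normr_Rintegral _ _) _ => //.
apply: (@le_trans _ _ (\int[P]_w (a * (2 * L + 2) * (1 + Y w ^+ 2)))).
  apply: le_Rintegral => //.
  - exact: (integrable_norm iB).
  - exact: (integrableZl measurableT (a * (2 * L + 2)) integrable_sq).
  move=> w _; apply: phi_dev => //; last exact: ltW.
    by move=> Bx; exact: hr.
  by rewrite /a ge_min lexx.
rewrite RintegralZl// -/E2.
apply: (@le_trans _ _ (e / ((2 * L + 2) * (E2 + 1)) * (2 * L + 2) * (E2 + 1))).
  apply: ler_pM => //; last by rewrite lerDl.
    by rewrite mulr_ge0 ?(ltW a0)// addr_ge0// mulr_ge0.
  by rewrite ler_wpM2r ?addr_ge0 ?mulr_ge0// /a ge_min lexx orbT.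
by rewrite -mulrA divfK// gt_eqF.
Qed.

(* The cross term of (Y - f_theta)^2 expanded around f_theta0 has mean zero. *)
Lemma crit_lim_min (theta0 theta : 'rV[R]_d.+1) :
  is_cond_expect P X (fun w => Y w - f (dot theta0 (X w)) theta0) (fun _ => 0) ->
  Theta theta0 -> Theta theta -> M theta0 <= M theta.
Proof.
move=> model T0 Tt.
pose g x : R := (f (dot theta0 x) theta0 - f (dot theta x) theta) * \1_B x.
have mg : measurable_fun setT g.
  apply: measurable_funM => //; apply: measurable_funB.
    exact: (measurableT_comp (mf T0) (measurable_dot theta0)).
  exact: (measurableT_comp (mf Tt) (measurable_dot theta)).
have gL x : `|g x| <= L + L.
  rewrite /g indicE; case: (boolP (x \in B)); last by rewrite mulr0 normr0 addr_ge0.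
  rewrite inE mulr1 => Bx; apply: le_trans (ler_normB _ _) _.
  by apply: lerD; exact: fL.
have [iV V0] := cond_mean_zero mX model mg gL.
have i2 := integrableZl measurableT 2 iV.
rewrite -[M theta0]addr0 -(mulr0 2) -V0 -RintegralZl// /M -RintegralD//; last exact: integrable_sq_error.
apply: le_Rintegral => //.
- exact: (integrableD measurableT (integrable_sq_error T0) i2).
- exact: integrable_sq_error.
move=> w _; rewrite /phi /g indicE; case: (_ \in B); rewrite ?mulr0 ?addr0// !mulr1.
set a := f _ theta0; set b := f _ theta; have := sqr_ge0 (a - b); nra.
Qed.

Context (fhat : forall n : nat, ('I_n -> obs R d.+1) -> R -> 'rV[R]_d.+1 -> R).

Hypothesis fhat_cons : forall e p, 0 < e -> 0 < p ->
  evp P (fun n => [set w | forall theta x, Theta theta -> B x ->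
    `|fhat (fun i : 'I_n => Z i w) (dot theta x) theta - f (dot theta x) theta|
    <= e]) p.

(** Censoring enters the uniform bound only through this consistency and the two facts on the
    integral of 1 + y^2 below. *)
Hypothesis km_cons : forall (psi : 'rV[R]_d.+1 -> R -> R) (c e p : R), 0 <= c ->
  measurable_fun setT (fun x : 'rV[R]_d.+1 * R => psi x.1 x.2) ->
  (forall x y, 0 <= psi x y <= c * (1 + y ^+ 2)) -> 0 < e -> 0 < p ->
  evp P (fun n => [set w | `|km_integral (fun i : 'I_n => Z i w) psi -
                             \int[P]_w psi (X w) (Y w)| <= e]) p.

Hypothesis measurable_km_sq : forall n, measurable_fun setT (fun w =>
  km_integral (fun i : 'I_n => Z i w) (fun _ y => 1 + y ^+ 2)).

Hypothesis km_sq_le : forall n,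
  (\int[P]_w (km_integral (fun i : 'I_n => Z i w) (fun _ y => 1 + y ^+ 2))%:E <=
   \int[P]_w (1 + Y w ^+ 2)%:E)%E.

Lemma crit_uniform (e p : R) : 0 < e -> 0 < p ->
  evp P (fun n => [set w | forall theta, Theta theta ->
    `|crit_n (fun i : 'I_n => Z i w) B theta (fhat (fun i : 'I_n => Z i w)) -
      M theta| <= e]) p.
Proof.
move=> e0 p0; have p3 : 0 < p / 3 by rewrite divr_gt0.
have E1 : 0 < E2 + 1 by rewrite ltr_wpDl.
(* By Markov's inequality the Kaplan-Meier integral of 1 + y^2, of mean at most [E2], exceeds [K2]
   with probability at most p / 3. *)
pose K2 := E2 / (p / 3) + 1.
have K20 : 0 < K2 by rewrite ltr_wpDl// divr_ge0// ltW.
have D0 : 0 < (2 * L + 2) * K2 by rewrite mulr_gt0// ltr_wpDl// mulr_ge0.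
(* Four errors of e / 4 are planned: fhat to f, theta to a net point t under the Kaplan-Meier
   integral, Kaplan-Meier to population at t, and t back to theta under [M]. The first two are at
   most a (2 L + 2) K2, and [sq_dev] wants a <= 1. *)
pose a := Num.min 1 (e / 4 / ((2 * L + 2) * K2)).
have a0 : 0 < a by rewrite lt_min ltr01 !divr_gt0.
have a1 : a <= 1 by rewrite /a ge_min lexx.
have aK : a * (2 * L + 2) * K2 <= e / 4.
  by rewrite -mulrA -ler_pdivlMr// /a ge_min lexx orbT.
have e4 : 0 < e / 4 by rewrite divr_gt0.
have [r1 r10 fr] := f_equi a0.
have [r2 r20 Mr] := crit_lim_equi e4.
pose r := Num.min r1 r2; have r0 : 0 < r by rewrite lt_min r10.
have [s [sT sr]] := compact_ball_cover Theta_compact (fun (x : 'rV[R]_d.+1) (_ : Theta x) => r0).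
have C0 : 0 <= 2 + 2 * L ^+ 2 by rewrite addr_ge0// mulr_ge0// sqr_ge0.
have ev1 : evp P (fun n => [set w | forall t, t \in s ->
    `|km_integral (fun i : 'I_n => Z i w) (phi t) - M t| <= e / 4]) (p / 3).
  apply: (evp_seq (E := fun t n => [set w | `|km_integral (fun i : 'I_n => Z i w) (phi t) - M t| <= e / 4])) => // t q ts q0.
  apply: km_cons C0 _ _ e4 q0; first exact: (mphi (sT t ts)).
  by move=> x y; exact: phi_bound (sT t ts).
have ev2 := fhat_cons a0 p3.
have ev3 : evp P (fun n => [set w |
    km_integral (fun i : 'I_n => Z i w) (fun _ y => 1 + y ^+ 2) <= K2]) (p / 3).
  apply: nearW => n; pose S2 w := km_integral (fun i : 'I_n => Z i w) (fun _ y => 1 + y ^+ 2).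
  apply: (@le_trans _ _ (mu_ext P [set w | (K2 < S2 w)%R])).
    by apply: le_mu_ext => w /= /negP; rewrite -ltNge.
  have bound : (\int[P]_w (S2 w)%:E <= E2%:E)%E.
    by rewrite /E2 fineK ?integrable_fin_num//; exact: km_sq_le.
  apply: le_trans (markov_mu_ext (measurable_km_sq n) _ bound K20) _.
    by move=> w; apply: sumr_ge0 => i _; rewrite mulr_ge0 ?km_weight_ge0// addr_ge0// sqr_ge0.
  rewrite lee_fin ler_pdivrMr// /K2 mulrDr mulr1 mulrC divfK ?gt_eqF//.
  by rewrite lerDl ltW.
rewrite (_ : p = p / 3 + p / 3 + p / 3); last by field.
apply: (evpI (evpI ev1 ev2 _) ev3); first by apply: nearW => n w h; exact: h.
apply: nearW => n w /= [[h1 h2] h3] theta Tt.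
set z := fun i : 'I_n => Z i w in h1 h2 h3 *.
have [t ts tr] := sr theta Tt; have Tt' := sT t ts.
have tr1 : `|t - theta| < r1 by apply: lt_le_trans tr _; rewrite /r ge_min lexx.
have tr2 : `|t - theta| < r2 by apply: lt_le_trans tr _; rewrite /r ge_min lexx orbT.
have aS : a * (2 * L + 2) * km_integral z (fun _ y => 1 + y ^+ 2) <= e / 4.
  by apply: le_trans aK; rewrite ler_wpM2l// mulr_ge0 ?(ltW a0)// addr_ge0// mulr_ge0.
have d1 : `|crit_n z B theta (fhat z) - km_integral z (phi theta)| <= e / 4.
  apply: le_trans aS; apply: km_integral_dev => i; rewrite /phi indicE.
  case: (boolP (_ \in B)).
    by rewrite inE !mulr1 => Bx; apply: sq_dev => //; [exact: h2 | exact: fL].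
  by rewrite !mulr0 subrr normr0 mulr_ge0 ?sq1_ge0// mulr_ge0// ltW.
have d2 : `|km_integral z (phi t) - km_integral z (phi theta)| <= e / 4.
  apply: le_trans aS; apply: km_integral_dev => i.
  by apply: phi_dev => //; [move=> Bx; exact: fr | exact: ltW].
have := h1 t ts; have := Mr t theta Tt' Tt tr2.
move: d1 d2; rewrite !ler_norml => /andP[? ?] /andP[? ?] /andP[? ?] /andP[? ?].
by apply/andP; split; lra.
Qed.

End uniform_criterion.

(** * From the stated assumptions to uniform convergence and consistency *)

Lemma oP1P (d0 : measure_display) (Omega : measurableType d0) (R : realType)
    (P : probability Omega R) (V : nat -> Omega -> \bar R) :
  oP1 P V <-> forall e p : R, 0 < e -> 0 < p ->
    evp P (fun n => [set w | (`|V n w| <= e%:E)%E]) p.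
Proof.
have eqC e n : ~` [set w | (`|V n w| <= e%:E)%E] = [set w | (e%:E < `|V n w|)%E].
  by apply/seteqP; split => w /=; rewrite ltNge => /negP.
split=> [h e p e0 p0|h e e0].
  have /fine_cvgP[hf /cvgrPdist_le/(_ p p0) hp] := h e e0.
  rewrite /evp; near=> n; rewrite eqC.
  have fn : mu_ext P [set w | (e%:E < `|V n w|)%E] \is a fin_num by near: n.
  rewrite -(fineK fn) lee_fin.
  have : `|0 - fine (mu_ext P [set w | (e%:E < `|V n w|)%E])| <= p by near: n.
  by rewrite sub0r normrN; apply: le_trans; exact: ler_norm.
have fin n : mu_ext P [set w | (e%:E < `|V n w|)%E] \is a fin_num.
  rewrite ge0_fin_numE ?mu_ext_ge0//.
  apply: le_lt_trans (mu_ext_measurable P measurableT (@subsetT _ _)) _.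
  by apply: le_lt_trans (@probability_le1 _ _ _ P _ measurableT) _; rewrite ltry.
apply/fine_cvgP; split; first exact: nearW.
apply/cvgrPdist_le => p p0; have := h e p e0 p0; apply: filterS => n.
rewrite eqC -{1}(fineK (fin n)) lee_fin /= sub0r normrN ger0_norm//.
by apply: fine_ge0; exact: mu_ext_ge0.
Unshelve. all: by end_near. Qed.

Lemma holder_equicontinuous (R : realType) (d : nat)
    (Theta S : set 'rV[R]_d.+1) (f : R -> 'rV[R]_d.+1 -> R) :
  (exists (gamma : R) (Phi : 'rV[R]_d.+1 -> R),
     [/\ 0 < gamma, exists K : R, forall x, `|Phi x| <= K &
     forall theta1 theta2 x, Theta theta1 -> Theta theta2 -> S x ->
       `|f (dot theta1 x) theta1 - f (dot theta2 x) theta2|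
         <= enorm (theta1 - theta2) `^ gamma * Phi x]) ->
  forall e : R, 0 < e -> exists2 r, 0 < r & forall t1 t2 x, Theta t1 -> Theta t2 ->
    S x -> `|t1 - t2| < r -> `|f (dot t1 x) t1 - f (dot t2 x) t2| <= e.
Proof.
move=> [g [Phi [g0 [K PhiK] fh]]] e e0.
have K0 : 0 <= K by apply: le_trans (PhiK 0).
have K1 : 0 < K + 1 by rewrite ltr_wpDl.
(* [a] solves a^gamma (K + 1) = e; the radius a / (d + 1) converts the Euclidean norm of the Hoelder
   condition to the sup norm of the topology. *)
pose a := (e / (K + 1)) `^ g^-1.
have eK : 0 < e / (K + 1) by rewrite divr_gt0.
have a0 : 0 < a by rewrite powR_gt0.
have aE : a `^ g = e / (K + 1) by rewrite -powRrM mulVf ?gt_eqF// powRr1// ltW.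
exists (a / d.+1%:R); first by rewrite divr_gt0.
move=> t1 t2 x T1 T2 Sx t12; apply: le_trans (fh t1 t2 x T1 T2 Sx) _.
have le1 : enorm (t1 - t2) <= a.
  apply: le_trans (enorm_le _) _.
  by rewrite mulrC -ler_pdivlMr// ltW.
have le2 : enorm (t1 - t2) `^ g <= e / (K + 1).
  by rewrite -aE ge0_ler_powR ?nnegrE ?(ltW g0) ?sqrtr_ge0// ltW.
apply: (@le_trans _ _ (e / (K + 1) * (K + 1))); last by rewrite divfK ?gt_eqF.
apply: (@le_trans _ _ (enorm (t1 - t2) `^ g * (K + 1))).
  rewrite ler_wpM2l ?powR_ge0//; apply: le_trans (ler_norm _) _.
  by apply: le_trans (PhiK x) _; rewrite lerDl.
by rewrite ler_wpM2r// ltW.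
Qed.

Lemma ae_obs_cov_support (d0 : measure_display) (Omega : measurableType d0)
    (R : realType) (P : probability Omega R) (d : nat) (T : Omega -> R)
    (delta : Omega -> bool) (X : Omega -> 'rV[R]_d.+1)
    (Z : nat -> Omega -> obs R d.+1) :
  measurable_fun setT X ->
  iid_copies P Z (fun w => (T w, delta w, X w) : obs R d.+1) ->
  {ae P, forall w, forall i, rv_support P X (obs_cov (Z i w))}.
Proof.
move=> mX [mZ idZ _]; apply: ae_foralln => i.
pose A : set (obs R d.+1) := ~` [set o | rv_support P X (obs_cov o)].
have mA : measurable A.
  apply: measurableC; rewrite -[Y in measurable Y]setTI.
  by apply: measurable_obs_cov => //; exact: measurable_rv_support.
exists (Z i @^-1` A); split=> //.
  by rewrite -[Y in measurable Y]setTI; exact: mZ.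
apply: etrans (idZ i A mA) _; have [N [mN N0 sub]] := ae_rv_support P mX.
apply/eqP; rewrite eq_le measure_ge0 andbT -N0.
apply: le_measure; rewrite ?inE//.
rewrite [Y in measurable Y](_ : _ = X @^-1` (~` rv_support P X))//.
rewrite -[Y in measurable Y]setTI; apply: mX => //.
by apply: measurableC; exact: measurable_rv_support.
Qed.

Lemma trimmed_sup_normP (R : realType) (d : nat) (Theta S B : set 'rV[R]_d)
    (dens : 'rV[R]_d -> R -> R) (c : R) (g : R -> 'rV[R]_d -> R) (e : R) :
  0 < c ->
  (forall x theta, B x -> Theta theta -> c <= dens theta (dot theta x)) ->
  (`|trimmed_sup_norm Theta S dens c g| <= e%:E)%E ->
  forall theta x, Theta theta -> (B `&` S) x -> `|g (dot theta x) theta| <= e.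
Proof.
move=> c0 Bc he theta x Tt [Bx Sx]; rewrite -lee_fin; apply: le_trans he.
apply: le_trans (lee_abs _); apply: ereal_sup_ubound.
exists theta => //; exists x => //.
rewrite (_ : c / 2 < dens theta (dot theta x)) ?mulr1//.
by apply: lt_le_trans (Bc x theta Bx Tt); rewrite ltr_pdivrMr// ltr_pMr// ltr1n.
Qed.

Unset Implicit Arguments.
Set Strict Implicit.

Theorem theorem1 (R : realType) (disp : measure_display)
    (Omega : measurableType disp) (P : probability Omega R)
    (* the dimension of X is d.+1 *)
    (d : nat)
    (Y C : {RV P >-> R}) (X : {RV P >-> 'rV[R]_d.+1})
    (T : Omega -> R) (T_def : T = fun w => Num.min (Y w) (C w))
    (delta : Omega -> bool) (delta_def : delta = fun w => Y w <= C w)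
    (* the observed sample *)
    (Z : nat -> Omega -> obs R d.+1)
    (Z_iid : iid_copies P Z (fun w => (T w, delta w, X w) : obs R d.+1))
    (* standing assumptions on the censoring *)
    (YC_indep : independent2 P Y C)
    (delta_cond : exists q : R -> R,
       is_cond_expect P Y (fun w => (delta w)%:R) q /\
       is_cond_expect P (fun w => (X w, Y w)) (fun w => (delta w)%:R)
         (fun xy => q xy.2))
    (endpoint : right_endpoint P Y = right_endpoint P T)
    (* an atom of F at the common finite right endpoint is an atom of H; without
       this the Kaplan-Meier integral loses the mass of F at the endpoint *)
    (endpoint_atom : forall t : R, right_endpoint P Y = t%:E ->
       (0 < P [set w | Y w = t])%E -> (0 < P [set w | T w = t])%E)
    (YC_neq : P [set w | Y w = C w] = 0%E)
    (* the single-index model *)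
    (Theta : set 'rV[R]_d.+1) (theta0 : 'rV[R]_d.+1)
    (theta0_in : Theta theta0) (theta0_first : theta0 0 ord0 = 1)
    (f : R -> 'rV[R]_d.+1 -> R)
    (f_regr : forall theta, Theta theta ->
       is_cond_expect P (fun w => dot theta (X w)) Y (fun u => f u theta))
    (model : is_cond_expect P X
       (fun w => Y w - f (dot theta0 (X w)) theta0) (fun _ => 0))
    (dens : 'rV[R]_d.+1 -> R -> R)
    (dens_is : forall theta, Theta theta ->
       is_density P (fun w => dot theta (X w)) (dens theta))
    (* trimming *)
    (c : R) (c_gt0 : 0 < c) (B : set 'rV[R]_d.+1) (B_meas : measurable B)
    (B_trim : forall x theta, B x -> Theta theta ->
       c <= dens theta (dot theta x))
    (* the estimator of f, a function of the first n observations *)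
    (fhat : forall n : nat, ('I_n -> obs R d.+1) -> R -> 'rV[R]_d.+1 -> R)
    (* (1) *)
    (Y_sq : ('E_P[(fun w => (Y w ^+ 2)%R)] < +oo)%E)
    (* (2) *)
    (identif : forall theta1, Theta theta1 ->
       crit_lim P X Y B theta1 f = crit_lim P X Y B theta0 f ->
       theta1 = theta0)
    (* (3) *)
    (Theta_compact : compact Theta)
    (supp_compact : compact (rv_support P X))
    (f_cont : {within Theta `*` rv_support P X,
       continuous (fun p : 'rV[R]_d.+1 * 'rV[R]_d.+1 =>
                     f (dot p.1 p.2) p.1)})
    (f_holder : exists (gamma : R) (Phi : 'rV[R]_d.+1 -> R),
       [/\ 0 < gamma,
           exists K : R, forall x, `|Phi x| <= K &
           forall theta1 theta2 x, Theta theta1 -> Theta theta2 ->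
             rv_support P X x ->
             `|f (dot theta1 x) theta1 - f (dot theta2 x) theta2|
               <= enorm (theta1 - theta2) `^ gamma * Phi x])
    (* (4) *)
    (fhat_consistent : oP1 P (fun n w =>
       trimmed_sup_norm Theta (rv_support P X) dens c
         (fun u theta => fhat n (fun i : 'I_n => Z i w) u theta - f u theta))) :
  oP1 P (fun n w =>
    ereal_sup [set `|(crit_n (fun i : 'I_n => Z i w) B theta
                        (fhat n (fun i : 'I_n => Z i w)))%:E
                     - crit_lim P X Y B theta f|%E
              | theta in Theta])
  /\
  (forall thetan : nat -> Omega -> 'rV[R]_d.+1,
     (forall n, {ae P, forall w,
        Theta (thetan n w) /\
        forall theta, Theta theta ->
          crit_n (fun i : 'I_n => Z i w) B (thetan n w)
            (fhat n (fun i : 'I_n => Z i w))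
          <= crit_n (fun i : 'I_n => Z i w) B theta
               (fhat n (fun i : 'I_n => Z i w))}) ->
     oP1 P (fun n w => (enorm (thetan n w - theta0))%:E)).
Proof.
have mY : measurable_fun setT Y by [].
have mC : measurable_fun setT C by [].
have mX : measurable_fun setT X by [].
subst T delta; set S := rv_support P X in supp_compact f_cont f_holder fhat_consistent *.
have mS : measurable S by exact: measurable_rv_support.
(* f is bounded and equicontinuous on the support of X only. As X and the observed covariates lie in
   it almost surely, [B'] may replace [B] in both criteria. *)
pose B' := B `&` S; have mB' : measurable B' by exact: measurableI.
have mf t : Theta t -> measurable_fun setT (f ^~ t) by move=> Tt; have [] := f_regr t Tt.
have [L L0 fL] : exists2 L, 0 <= L & forall t x, Theta t -> B' x -> `|f (dot t x) t| <= L.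
  have /compact_bounded[N [_ hN]] := continuous_compact f_cont (compact_setX Theta_compact supp_compact).
  exists (`|N| + 1); first by rewrite addr_ge0.
  move=> t x Tt [_ Sx]; apply: (hN (`|N| + 1)).
    by apply: le_lt_trans (ler_norm N) _; rewrite ltrDl.
  by exists (t, x).
have f_equi (e : R) : 0 < e -> exists2 r, 0 < r & forall t1 t2 x, Theta t1 -> Theta t2 ->
    B' x -> `|t1 - t2| < r -> `|f (dot t1 x) t1 - f (dot t2 x) t2| <= e.
  move=> e0; have [r r0 h] := holder_equicontinuous f_holder e0.
  by exists r => // t1 t2 x T1 T2 [_ Sx]; exact: h.
have Y2 : (\int[P]_w ((Y w) ^+ 2)%:E < +oo)%E by move: Y_sq; rewrite unlock.
pose M t := \int[P]_w ((Y w - f (dot t (X w)) t) ^+ 2 * \1_B' (X w)).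
have critE t : Theta t -> crit_lim P X Y B t f = (M t)%:E.
  move=> Tt; have it := integrable_sq_error mY mX mf mB' fL Y2 L0 Tt.
  rewrite /M /Rintegral fineK; last exact: integrable_fin_num.
  rewrite /crit_lim unlock; have mXB D : measurable D ->
    measurable_fun setT (fun w => (((Y w - f (dot t (X w)) t) ^+ 2 * \1_D (X w))%:E)).
    move=> mD; apply/measurable_EFinP; apply: measurable_funM; last first.
      exact: (@measurableT_comp _ _ _ _ _ _ (\1_D : _ -> R)).
    apply: measurable_funX; apply: measurable_funB => //.
    exact: (measurableT_comp (mf t Tt) (measurableT_comp (measurable_dot t) mX)).
  apply: ge0_ae_eq_integral => //.
  - exact: mXB.
  - exact: mXB.
  - by move=> w _; rewrite lee_fin mulr_ge0 ?sqr_ge0.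
  - by move=> w _; rewrite lee_fin mulr_ge0 ?sqr_ge0.
  have := ae_rv_support P mX; apply: filterS => w Sw _.
  by congr ((_ * _)%:E); rewrite !indicE in_setI (mem_set Sw) andbT.
have M_min t : Theta t -> M theta0 <= M t.
  by move=> Tt; exact: (crit_lim_min mY mX mf mB' fL Y2 L0 model theta0_in Tt).
have unif (e p : R) : 0 < e -> 0 < p -> evp P (fun n => [set w | forall t, Theta t ->
    `|crit_n (fun i : 'I_n => Z i w) B t (fhat n (fun i : 'I_n => Z i w)) - M t| <= e]) p.
  move=> e0 p0.
  have fhat_cons (e1 p1 : R) : 0 < e1 -> 0 < p1 ->
      evp P (fun n => [set w | forall t x, Theta t -> B' x ->
        `|fhat n (fun i : 'I_n => Z i w) (dot t x) t - f (dot t x) t| <= e1]) p1.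
    move=> e10 p10; have /oP1P/(_ e1 p1 e10 p10) h := fhat_consistent.
    apply: (evpS h) => //; apply: nearW => n w /= hw t x Tt Bx.
    exact: (trimmed_sup_normP c_gt0 B_trim hw Tt Bx).
  have sq_meas : measurable_fun setT (fun x : 'rV[R]_d.+1 * R => 1 + x.2 ^+ 2).
    by apply: measurable_funD => //; apply: measurable_funX; exact: measurable_snd.
  have km_sq_le n : (\int[P]_w (km_integral (fun i : 'I_n => Z i w) (fun _ y => 1 + y ^+ 2))%:E
      <= \int[P]_w (1 + Y w ^+ 2)%:E)%E.
    apply: (integral_km_le mY mC mX Z_iid YC_indep delta_cond endpoint endpoint_atom
      YC_neq Y2 n ler01 sq_meas) => _ y.
    by rewrite mul1r lexx addr_ge0// sqr_ge0.
  have h := crit_uniform mY mX Theta_compact mf mB' fL f_equi Y2 L0 fhat_cons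
    (fun psi c1 e1 p1 => @km_consistency _ _ _ P _ _ _ _ mY mC mX _ Z_iid YC_indep delta_cond
       endpoint endpoint_atom YC_neq Y2 psi c1 e1 p1)
    (fun n => measurable_km Z_iid n (phi := fun _ y => 1 + y ^+ 2) sq_meas) km_sq_le e0 p0.
  have hS := evp_ae (fun n => ae_obs_cov_support mX Z_iid).
  rewrite -[p]addr0; apply: (evpI h hS); apply: nearW => n w [/= hw Sw] t Tt.
  rewrite (_ : crit_n _ B t _ = crit_n (fun i : 'I_n => Z i w) B' t (fhat n (fun i : 'I_n => Z i w))).
    exact: hw.
  apply: eq_bigr => i _; congr (_ * (_ * _)).
  by rewrite !indicE in_setI (mem_set (Sw i)) andbT.
split.
  apply/oP1P => e p e0 p0; apply: (evpS (unif e p e0 p0)) => //.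
  apply: nearW => n w /= hw.
  (* theta0 makes the index set nonempty: an empty supremum would be -oo, of absolute value +oo. *)
  have sup_ge0 : (0 <= `|(crit_n (fun i : 'I_n => Z i w) B theta0
      (fhat n (fun i : 'I_n => Z i w)))%:E - crit_lim P X Y B theta0 f|)%E by [].
  rewrite gee0_abs; last first.
    by apply: le_trans sup_ge0 _; apply: ereal_sup_ubound; exists theta0.
  apply: ge_ereal_sup => _ [t Tt <-].
  by rewrite critE// -EFinB lee_fin; exact: hw.
move=> thetan thetan_min; apply/oP1P => e p e0 p0.
(* [identif] is about equal values; minimality of [M theta0] turns the inequality into an
   equality. *)
have M_uniq t : Theta t -> M t <= M theta0 -> t = theta0.
  move=> Tt Mt; apply: identif => //; rewrite !critE//; congr (_%:E).
  by apply/eqP; rewrite eq_le Mt M_min.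
have [eta eta0 etaP] := well_separated_min Theta_compact
  (fun e => @crit_lim_equi _ _ _ _ _ _ _ mY mX _ _ _ _ mf mB' fL f_equi Y2 L0 e)
  M_uniq e0.
(* M(theta_n) <= M_n(theta_n) + eta / 3 <= M_n(theta0) + eta / 3 <= M(theta0) + 2 eta / 3, which is
   below M(theta0) + eta. *)
have eta3 : 0 < eta / 3 by rewrite divr_gt0.
rewrite -[p]addr0; apply: (evpI (unif _ p eta3 p0) (evp_ae thetan_min)).
apply: nearW => n w [/= hw [Tn minn]].
rewrite /= lee_fin ger0_norm ?sqrtr_ge0//; apply: etaP => //.
have := hw _ Tn; have := hw _ theta0_in; have := minn _ theta0_in.
rewrite -/(M _) -/(M theta0) !ler_norml => hA /andP[hB hC] /andP[hD hE]; lra.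
Qed.
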